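(* Let $m$ be a positive integer. The normalized Baker--Akhiezer function $\Psi(x,z)$ for the deformed system $R=A_n(m)$ is symmetric under permutation of its arguments: $\Psi(x,z)=\Psi(z,x)$.
   Context: $q\in\mathbb C^\times$ is not a root of unity, $\log q$ fixed, $q^a=e^{a\log q}$, $[a]=q^a-q^{-a}$. $e_1,\dots,e_{n+1}$ is the standard basis of $\mathbb R^{n+1}$, $(\cdot,\cdot)$ the standard scalar product extended bilinearly to $\mathbb C^{n+1}$; $x,z\in\mathbb C^{n+1}$. The deformed system $R=A_n(m)=R^0\cup R^1$: $R^0=\{\pm(e_i-e_j):1\le i<j\le n\}$ with $m_\alpha=m$, $R^1=\{\pm(e_i-\sqrt m\,e_{n+1}):1\le i\le n\}$ with $m_\alpha=1$; $R_+=\{e_i-e_j:1\le i<j\le n\}\cup\{e_i-\sqrt m\,e_{n+1}:1\le i\le n\}$; $\rho=\frac12\sum_{\alpha\in R_+}m_\alpha\alpha$; $P=\mathbb Ze_1\oplus\dots\oplus\mathbb Ze_n\oplus\sqrt m\,\mathbb Ze_{n+1}$. A Baker--Akhiezer function for $R$ is a function $\psi=q^{2(x,z)}\sum_\nu\psi_\nu(x)q^{2(\nu,z)}$, the sum over $\nu\in\rho+P$ lying in the polytope $\mathcal N=\{-\rho+\sum_{\alpha\in R_+}l_\alpha\alpha:0\le l_\alpha\le m_\alpha\}$, satisfying in $z$: $\psi(x,z+se_i)=\psi(x,z+se_j)$ whenever $q^{2z_i}=q^{2z_j}$ ($1\le s\le m$, $1\le i<j\le n$), and $\psi(x,z+e_i)=\psi(x,z+\sqrt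 m\,e_{n+1})$ whenever $q^{1-m+2z_i}=q^{2\sqrt m\,z_{n+1}}$ ($i=1,\dots,n$). It exists and is unique up to a factor depending on $x$; the normalized one, $\Psi$, is the one with $$\psi_\rho(x)=\prod_{\alpha\in R_+}\prod_{j=1}^{m_\alpha}\bigl[(\alpha,\tfrac12j\alpha-x)\bigr].$$
   Formalization: The coefficients ψ_ν(x) of the normalized function Ψ are required to be continuous in x, because where ψ_ρ(x)=0 the normalization alone does not determine Ψ(x,·) and an arbitrary choice there would break the symmetry. *)

(* Defs.v *)
From HB Require Import structures.
From mathcomp Require Import all_boot all_order all_algebra.
From mathcomp Require Import complex.
From mathcomp Require Import all_classical all_reals all_analysis.

Set Implicit Arguments.
Unset Strict Implicit.
Unset Printing Implicit Defensive.

Import Order.TTheory GRing.Theory Num.Theory.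
Import numFieldNormedType.Exports.

Local Open Scope classical_set_scope.
Local Open Scope ring_scope.
Local Open Scope complex_scope.

Definition cexp (R : realType) (a : R[i]) : R[i] :=
  (expR (complex.Re a))%:C * (cos (complex.Im a) +i* sin (complex.Im a)).

(* q^a, where lq is the fixed value of log q *)
Definition qpow (R : realType) (lq a : R[i]) : R[i] := cexp (a * lq).

(* [a] = q^a - q^{-a} *)
Definition qbr (R : realType) (lq a : R[i]) : R[i] := qpow lq a - qpow lq (- a).

Definition cvec (R : realType) (k : nat) (v : 'rV[R]_k) : 'rV[R[i]]_k :=
  map_mx (real_complex R) v.

(* the bilinear (not Hermitian) extension of the standard scalar product *)
Definition dotC (R : realType) (k : nat) (u v : 'rV[R[i]]_k) : R[i] :=
  \sum_(i < k) u 0 i * v 0 i.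

Section DeformedSystem.
Variables (R : realType) (n m : nat).

Definition sqm : R := Num.sqrt m%:R.

(* ee i is e_{i+1} for i : 'I_n, and elast is e_{n+1} *)
Definition ee (i : 'I_n) : 'rV[R]_n.+1 := delta_mx 0 (widen_ord (leqnSn n) i).
Definition elast : 'rV[R]_n.+1 := delta_mx 0 ord_max.

Definition R0plus : seq 'rV[R]_n.+1 :=
  [seq ee p.1 - ee p.2 | p in [pred p : 'I_n * 'I_n | (p.1 < p.2)%N]].
Definition R1plus : seq 'rV[R]_n.+1 := [seq ee i - sqm *: elast | i : 'I_n].
Definition R0 : seq 'rV[R]_n.+1 := R0plus ++ [seq - a | a <- R0plus].
Definition R1 : seq 'rV[R]_n.+1 := R1plus ++ [seq - a | a <- R1plus].

(* R_+ has no repetitions, so sums over this sequence are sums over the set *)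
Definition Rplus : seq 'rV[R]_n.+1 := R0plus ++ R1plus.

(* multiplicities on R0 ++ R1; the value off the root system is irrelevant *)
Definition mult (a : 'rV[R]_n.+1) : nat := if a \in R0 then m else 1.

Definition rho : 'rV[R]_n.+1 := 2^-1 *: \sum_(a <- Rplus) (mult a)%:R *: a.

Definition lattP : set 'rV[R]_n.+1 :=
  [set v | exists (k : 'I_n -> int) (l : int),
     v = \sum_(i < n) (k i)%:~R *: ee i + (l%:~R * sqm) *: elast].

Definition polyN : set 'rV[R]_n.+1 :=
  [set v | exists l : 'rV[R]_n.+1 -> R,
     (forall a, a \in Rplus -> 0 <= l a <= (mult a)%:R) /\
     v = - rho + \sum_(a <- Rplus) l a *: a].

(* (rho + P) `&` N; this set is finite *)
Definition suppN : set 'rV[R]_n.+1 :=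
  [set v | lattP (v - rho) /\ polyN v].

Variable lq : R[i].
Implicit Types (x z : 'rV[R[i]]_n.+1).
Implicit Types (Psi : 'rV[R[i]]_n.+1 -> 'rV[R[i]]_n.+1 -> R[i]).
Implicit Types (c : 'rV[R]_n.+1 -> 'rV[R[i]]_n.+1 -> R[i]).

(* c nu x is the coefficient psi_nu(x) *)
Definition BA_expansion c Psi : Prop :=
  forall x z, Psi x z =
    qpow lq (2 * dotC x z) *
    \sum_(nu \in suppN) (c nu x * qpow lq (2 * dotC (cvec nu) z)).

Definition BA_R0_conditions Psi : Prop :=
  forall (i j : 'I_n) (s : nat) x z,
    (i < j)%N -> (1 <= s <= m)%N ->
    qpow lq (2 * dotC (cvec (ee i)) z) = qpow lq (2 * dotC (cvec (ee j)) z) ->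
    Psi x (z + s%:R *: cvec (ee i)) = Psi x (z + s%:R *: cvec (ee j)).

Definition BA_R1_conditions Psi : Prop :=
  forall (i : 'I_n) x z,
    qpow lq (1 - m%:R + 2 * dotC (cvec (ee i)) z)
      = qpow lq (2 * sqm%:C * dotC (cvec elast) z) ->
    Psi x (z + cvec (ee i)) = Psi x (z + sqm%:C *: cvec elast).

Definition BA_with_coefs c Psi : Prop :=
  [/\ BA_expansion c Psi, BA_R0_conditions Psi & BA_R1_conditions Psi].

Definition BA_function Psi : Prop := exists c, BA_with_coefs c Psi.

Definition BA_norm x : R[i] :=
  \prod_(a <- Rplus) \prod_(1 <= j < (mult a).+1)
    qbr lq (dotC (cvec a) ((j%:R / 2) *: cvec a - x)).

(* At the zeros of BA_norm the value of psi_rho(x) does not pin down the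
   solution, so the normalized function is fixed there by continuity in x. *)
Definition BA_normalized Psi : Prop :=
  exists c, [/\ BA_with_coefs c Psi,
                (forall nu, suppN nu ->
                   continuous (c nu : 'rV[R[i]^o]_n.+1 -> R[i]^o)) &
                (forall x, c rho x = BA_norm x)].

End DeformedSystem.

(* Main.v *)
(* Put p_i = e_i for i <= n and p_(n+1) = sqrt m e_(n+1), so that the positive
   roots are alpha_ab = p_a - p_b with a < b; an exponent nu = sum_i K_i p_i / 2
   is stored as the integer vector K, and points x, z by the X_i = (p_i, x).

   The conditions on psi in z say that along every line of exponents parallel
   to a root the coefficients psi_nu(x) have vanishing bracket moments. When x
   goes to infinity in a Weyl chamber these equations degenerate to a system
   with only the zero solution once psi_rho is fixed; hence, by Cramer's rule
   and continuity, psi_nu(x) = sum_mu A(nu, mu) q^(2 (mu, x)). In terms of A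
   the conditions become a linear system in nu, with a shift of mu.
   On a wall q^(2 (alpha, x)) = 1 the same moments bound from below the width
   of the support of the difference of psi_(nu - s alpha)(x + s alpha / 2) and
   psi_(nu + s alpha)(x - s alpha / 2), as a function of nu; since the
   coefficients on the vertices and edges of the polytope are explicit products,
   this difference vanishes on an extremal edge and therefore everywhere, which
   is the same linear system for the transpose of A. A solution of the system
   supported in the polytope is determined by its row nu = rho, and that row of
   A - A^T is zero; so A is symmetric. *)

(* The engine is a width estimate. On a line parallel to a root, [mu] vanishing moments leave either
   no support point or at least [mu + 1] of them. If this holds for all roots not orthogonal to
   [eta], a nonzero finitely supported function is at least as wide in direction [eta] as the
   polytope; confined to the width of the polytope, it must reach the face of [eta]. For generic
   [eta] this face is a vertex, which gives uniqueness in the limit systems. On the wall of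
   [alpha_ab] the brackets of that root can vanish, so [eta] has to be orthogonal to it and the face
   is an edge; hence the explicit coefficients along edges. Since permutations of all the indices
   need not preserve the deformed system, the vertices are reached from [rho2] by crossing one edge
   after another, not by reflection.

   Cramer's rule gives only quotients, and only along a line. Continuity cancels the denominators
   there; a degree bound uniform over parallel lines then allows interpolation at fixed translates,
   which joins the expansions along lines into one exponential sum in all coordinates. *)
From HB Require Import structures.
Require Import Defs.
From mathcomp Require Import all_boot all_order all_algebra.
From mathcomp Require Import complex.
From mathcomp Require Import all_classical all_reals all_analysis.
From mathcomp Require Import ring lra zify.

Set Implicit Arguments.
Unset Strict Implicit.
Unset Printing Implicit Defensive.

Import Order.TTheory GRing.Theory Num.Theory.
Import numFieldNormedType.Exports.

Local Open Scope ring_scope.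

(** * Bracket moments and lattice strings *)

Definition br (F : fieldType) (z : F) : F := z - z^-1.

Section Moments.
Variables (F : fieldType) (T : eqType).
Implicit Types (s : seq T) (b w : T -> F).

Lemma moments_horner s b w d (P : {poly F}) :
  (forall j, (j < d)%N -> \sum_(k <- s) b k * w k ^+ j = 0) ->
  (size P <= d)%N -> \sum_(k <- s) b k * P.[w k] = 0.
Proof.
move=> mom sP; transitivity (\sum_(k <- s) \sum_(i < size P) P`_i * (b k * w k ^+ i)).
  by apply: eq_bigr => k _; rewrite horner_coef mulr_sumr; apply: eq_bigr => i _; ring.
rewrite exchange_big big1 // => i _.
by rewrite -mulr_sumr mom ?mulr0 // (leq_trans (ltn_ord i)).
Qed.

Lemma vandermonde_eq0 s b w :
  uniq s -> {in s &, injective w} ->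
  (forall j, (j < size s)%N -> \sum_(k <- s) b k * w k ^+ j = 0) ->
  {in s, forall k, b k = 0}.
Proof.
move=> us wi mom k0 k0s.
(* [P] vanishes at every node except [w k0], so testing the moments against it isolates the term of
   [k0]. *)
pose P := \prod_(l <- rem k0 s) ('X - (w l)%:P).
have sP : size P = size s.
  by rewrite /P size_prod_XsubC size_rem // prednK //; case: (s) k0s.
have := moments_horner mom (eq_leq sP).
rewrite (big_rem k0) //= big_seq big1 ?addr0 => [/eqP|l ls].
  rewrite mulf_eq0 => /orP[/eqP //|].
  rewrite /P horner_prod => /eqP /eqP; rewrite prodf_seq_eq0 => /hasP[l ls] /=.
  rewrite !hornerE subr_eq0 => /eqP /wi E.
  move: ls; rewrite mem_rem_uniq // inE => /andP[/eqP nl ls].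
  by case: nl; rewrite E.
suff /eqP -> : P.[w l] == 0 by rewrite mulr0.
rewrite /P horner_prod prodf_seq_eq0; apply/hasP; exists l => //=.
by rewrite !hornerE subrr.
Qed.

(* With [w = phi + phi^-1], multiplication by [w] acts on the brackets
   [phi^s - phi^-s] as a three-term recurrence in [s]. *)
Lemma bracket_moments s b (phi : T -> F) mu :
  (forall k, phi k != 0) ->
  (forall r, (0 < r <= mu)%N -> \sum_(k <- s) b k * (phi k ^+ r - phi k ^- r) = 0) ->
  forall j, (j < mu)%N ->
  \sum_(k <- s) (b k * (phi k - (phi k)^-1)) * (phi k + (phi k)^-1) ^+ j = 0.
Proof.
move=> phi0 mom.
(* General [r], because the recurrence for the bracket of order [r] calls on the orders [r + 1] and
   [r - 1]; at [r = 0] the bracket is zero. *)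
suff H j r : (r + j <= mu)%N ->
    \sum_(k <- s) (b k * (phi k ^+ r - phi k ^- r)) * (phi k + (phi k)^-1) ^+ j = 0.
  by move=> j jm; have := H j 1%N; rewrite add1n => /(_ jm); under eq_bigr do rewrite !expr1.
elim: j r => [|j IH] [|r] rm.
- by apply: big1 => k _; rewrite !expr0 invr1 subrr mulr0 mul0r.
- by under eq_bigr do rewrite expr0 mulr1; apply: mom; rewrite addn0 in rm.
- by apply: big1 => k _; rewrite !expr0 invr1 subrr mulr0 mul0r.
- have h1 : (r.+2 + j <= mu)%N by lia.
  have h2 : (r + j <= mu)%N by lia.
  have := congr2 +%R (IH _ h1) (IH _ h2); rewrite addr0 -big_split => {h1 h2}E.
  apply: etrans E; apply: eq_bigr => k _; rewrite [_ ^+ j.+1]exprS /=.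
  set W := _ ^+ j; rewrite !exprS.
  by field; rewrite ?expf_neq0 ?phi0.
Qed.

End Moments.

(** * Width of a finite planar set *)

Section PlanarWidth.
Variables (T : eqType) (A : seq T) (x y : T -> rat).
Let top t K := K \in A /\ {in A, forall K', x K' + t * y K' <= x K + t * y K}.

Lemma top_exists K0 t : K0 \in A -> exists K, top t K.
Proof.
suff H (s : seq T) : K0 \in s -> exists K, K \in s /\ {in s, forall K', x K' + t * y K' <= x K + t * y K}.
  by move=> /H.
case: s => // a s _; elim: s a => [|b s IH] a.
  by exists a; split; [rewrite inE|move=> K'; rewrite inE => /eqP ->].
have [K [Ks Kt]] := IH b.
have [le|lt] := leP (x a + t * y a) (x K + t * y K).
  exists K; split; first by rewrite inE Ks orbT.
  by move=> K'; rewrite inE => /orP[/eqP -> //|/Kt].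
exists a; split; first by rewrite inE eqxx.
move=> K'; rewrite inE => /orP[/eqP -> //|/Kt h].
exact: le_trans h (ltW lt).
Qed.

Lemma top_mono t t' K K' : t < t' -> top t K -> top t' K' -> y K <= y K'.
Proof.
move=> tt [KA Kt] [KA' Kt']; have := Kt _ KA'; have := Kt' _ KA.
move=> h1 h2; have : (t' - t) * (y K' - y K) >= 0 by lra.
rewrite pmulr_rge0 ?subr_gt0 // subr_ge0 //.
Qed.

(* A maximizer of [x + t y] moves monotonically in [y] as [t] grows, and at each
   of the distinct times [r.1] it jumps by at least [r.2]. *)
Lemma planar_width (K0 : T) (L : seq (rat * rat)) :
  K0 \in A -> uniq [seq r.1 | r <- L] ->
  {in L, forall r, forall K, top r.1 K ->
     exists K1 K2, [/\ top r.1 K1, top r.1 K2 & y K1 + r.2 <= y K2]} ->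
  exists K1 K2, [/\ K1 \in A, K2 \in A & \sum_(r <- L) r.2 <= y K2 - y K1].
Proof.
move=> K0A uL HL.
pose le_t := [rel r r' : rat * rat | r.1 <= r'.1].
pose L' := sort le_t L.
have pL : perm_eq L' L by rewrite /L' perm_sort.
have tot : total le_t by move=> r r' /=; exact: le_total.
have sL : sorted <%R [seq r.1 | r <- L'].
  rewrite lt_sorted_uniq_le; apply/andP; split.
    by rewrite (perm_uniq (perm_map _ pL)).
  by rewrite sorted_map; apply: (sort_sorted tot).
have HL' : {in L', forall r K, top r.1 K ->
     exists K1 K2, [/\ top r.1 K1, top r.1 K2 & y K1 + r.2 <= y K2]}.
  by move=> r; rewrite (perm_mem pL) => /HL.
rewrite -(perm_big _ pL) /=.
case: L' sL HL' {pL} => [|r L'] sL HL'.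
  by exists K0, K0; split => //; rewrite big_nil subrr.
(* The lower point is kept as a maximizer at the earliest time, so that [top_mono] can attach the
   jump of a still earlier time. *)
suff [K1 [K2 [K1t K2A le]]] : exists K1 K2, [/\ top r.1 K1, K2 \in A &
     \sum_(r <- r :: L') r.2 <= y K2 - y K1].
  by exists K1, K2; split => //; case: K1t.
elim: L' r sL HL' => [|r' L' IH] r sL HL'.
  have [K Kt] := top_exists r.1 K0A.
  have [K1 [K2 [K1t [K2A _] le]]] := HL' _ (mem_head _ _) _ Kt.
  by exists K1, K2; split => //; rewrite big_seq1; lra.
have /andP[rr' sL'] := sL.
have [|K1 [K2 [K1t K2A le]]] := IH r' sL'.
  by move=> z zL; apply: HL'; rewrite inE zL orbT.
have [K Kt] := top_exists r.1 K0A.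
have [K3 [K4 [K3t K4t le']]] := HL' _ (mem_head _ _) _ Kt.
exists K3, K2; split => //.
have := top_mono rr' K4t K1t.
by rewrite big_cons; lra.
Qed.

End PlanarWidth.

Definition dotz N (u K : 'rV[int]_N) : int := \sum_(i < N) u 0 i * K 0 i.

Lemma dotzDl N (u u' K : 'rV[int]_N) : dotz (u + u') K = dotz u K + dotz u' K.
Proof. by rewrite /dotz -big_split; apply: eq_bigr => i _; rewrite mxE mulrDl. Qed.

Lemma dotzC N (u K : 'rV[int]_N) : dotz u K = dotz K u.
Proof. by apply: eq_bigr => i _; rewrite mulrC. Qed.

Lemma dotzDr N (u K K' : 'rV[int]_N) : dotz u (K + K') = dotz u K + dotz u K'.
Proof. by rewrite !(dotzC u) dotzDl. Qed.

Lemma dotzZl N (u K : 'rV[int]_N) k : dotz (k *: u) K = k * dotz u K.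
Proof. by rewrite /dotz mulr_sumr; apply: eq_bigr => i _; rewrite mxE mulrA. Qed.

Lemma dotzZr N (u K : 'rV[int]_N) k : dotz u (k *: K) = k * dotz u K.
Proof. by rewrite !(dotzC u) dotzZl. Qed.

Lemma dotzNr N (u K : 'rV[int]_N) : dotz u (- K) = - dotz u K.
Proof. by rewrite -scaleN1r dotzZr mulN1r. Qed.

Lemma dotzNl N (u K : 'rV[int]_N) : dotz (- u) K = - dotz u K.
Proof. by rewrite dotzC dotzNr dotzC. Qed.

Lemma dotzBr N (u K K' : 'rV[int]_N) : dotz u (K - K') = dotz u K - dotz u K'.
Proof. by rewrite dotzDr dotzNr. Qed.

Lemma dotz0r N (u : 'rV[int]_N) : dotz u 0 = 0.
Proof. by rewrite -[0](scale0r 0) dotzZr mul0r. Qed.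

Lemma dotz_delta N (u : 'rV[int]_N) i : dotz u (delta_mx 0 i) = u 0 i.
Proof.
rewrite /dotz (bigD1 i) //= big1 => [|j ji]; last by rewrite mxE eqxx (negbTE ji) mulr0.
by rewrite mxE !eqxx mulr1 addr0.
Qed.

Lemma dotz_sumr N (u : 'rV[int]_N) (J : Type) (s : seq J) (Q : pred J) f :
  dotz u (\sum_(j <- s | Q j) f j) = \sum_(j <- s | Q j) dotz u (f j).
Proof. exact: (big_morph _ (dotzDr u) (dotz0r u)). Qed.

(* The functional [u_i = x^i] does not vanish on the given vectors for all but
   finitely many [x], since each of them is a nonzero polynomial. *)
Lemma generic_functional N (D : seq 'rV[int]_N) :
  (forall d, d \in D -> d != 0) -> exists u, forall d, d \in D -> dotz u d != 0.
Proof.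
move=> D0; pose P := \prod_(d <- D) rVpoly d.
have P0 : P != 0.
  rewrite prodf_seq_neq0; apply/allP => d /D0 d0 /=.
  by apply: contraNneq d0 => /(congr1 (@poly_rV _ N)); rewrite rVpolyK raddf0 => ->.
pose rs : seq int := [seq (i : nat)%:Z | i <- iota 0 (size P)].
have urs : uniq rs by rewrite map_inj_uniq ?iota_uniq // => i j [].
have /allPn[x _ nx] : ~~ all (root P) rs.
  by apply: contraTN isT => /(max_poly_roots P0)/(_ urs); rewrite size_map size_iota ltnn.
exists (\row_i x ^+ i) => d dD.
apply: contraNneq nx => E; rewrite /root /P horner_prod prodf_seq_eq0.
apply/hasP; exists d => //=.
rewrite (@horner_coef_wide _ N) ?size_poly //=; apply/eqP.
apply: etrans E; apply: eq_bigr => i _.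
by rewrite coef_rVpoly_ord mxE mulrC.
Qed.

HB.lock Definition alpha N (a b : 'I_N) : 'rV[int]_N := delta_mx 0 a - delta_mx 0 b.
Canonical alpha_unlock := Unlockable alpha.unlock.

(** * Strings of exponents parallel to a root *)

Section Strings.
Variables (N : nat).
Notation V := 'rV[int]_N.
Implicit Types (a b i : 'I_N) (u eta zeta K M : V).

(* [key a b] is constant exactly on the lines [K + Z alpha a b]. *)
Definition key a b K : V := K + K 0 b *: alpha a b.

Lemma alphaE a b i : alpha a b 0 i = (i == a)%:Z - (i == b)%:Z.
Proof. by rewrite unlock !mxE eqxx /= !natz. Qed.

Lemma alpha_l a b : a != b -> alpha a b 0 a = 1.
Proof. by move=> ab; rewrite alphaE eqxx (negbTE ab). Qed.

Lemma alpha_r a b : a != b -> alpha a b 0 b = -1.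
Proof. by move=> ab; rewrite alphaE eqxx eq_sym (negbTE ab). Qed.

Lemma alpha_o a b i : i != a -> i != b -> alpha a b 0 i = 0.
Proof. by move=> /negbTE ia /negbTE ib; rewrite alphaE ia ib. Qed.

Lemma dotz_alpha u a b : dotz u (alpha a b) = u 0 a - u 0 b.
Proof. by rewrite unlock dotzBr !dotz_delta. Qed.

Lemma keyD a b K K' : key a b (K + K') = key a b K + key a b K'.
Proof. by rewrite /key mxE scalerDl addrACA. Qed.

Lemma keyN a b K : key a b (- K) = - key a b K.
Proof. by rewrite /key mxE scaleNr opprD. Qed.

Lemma key_line a b K k : a != b -> key a b (K + k *: alpha a b) = key a b K.
Proof.
move=> ab; rewrite /key mxE (mxE _ _ 0 b) alpha_r // scalerDl mulrN1 scaleNr.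
by rewrite -addrA; congr (_ + _); rewrite addrCA subrr addr0.
Qed.

Lemma key_eq a b K K' : a != b -> key a b K = key a b K' ->
  K' = K + (K' 0 a - K 0 a) *: alpha a b.
Proof.
move=> ab E; have E1 : K' = K + (K 0 b - K' 0 b) *: alpha a b.
  by rewrite scalerBl addrA -/(key a b K) E /key addrK.
suff -> : K' 0 a - K 0 a = K 0 b - K' 0 b by [].
by move/rowP: E1 => /(_ a); rewrite !mxE alpha_l // mulr1 => ->; rewrite addrAC subrr add0r.
Qed.

Lemma dotz_key u a b K : u 0 a = u 0 b -> dotz u (key a b K) = dotz u K.
Proof. by move=> E; rewrite /key dotzDr dotzZr dotz_alpha E subrr mulr0 addr0. Qed.

(** Exponents are doubled, so points of one parity on a line are steps of [2 *: alpha a b] apart; a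
    span of [2 * m] is that of [m + 1] consecutive points. *)
Definition full_string (F : fieldType) (f : V -> F) (a b : 'I_N) (m : nat) : Prop :=
  forall K, f K != 0 -> exists K1 K2,
  [/\ f K1 != 0, f K2 != 0, key a b K1 = key a b K, key a b K2 = key a b K &
      K1 0 a + 2 * m%:Z <= K2 0 a].

Section Moments.
Variables (F : fieldType) (f : V -> F) (supp : seq V).
Hypothesis usupp : uniq supp.
Hypothesis fsupp : forall K, f K != 0 -> K \in supp.
Hypothesis fpar : forall K K', f K != 0 -> f K' != 0 -> exists k : V, K' = K + 2 *: k.

Lemma seq_max (s : seq V) K0 i : K0 \in s ->
  exists K, K \in s /\ {in s, forall K', K' 0 i <= K 0 i}.
Proof.
elim: s K0 => // K s IH K0; case: s IH => [|K1 s] IH _.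
  by exists K; split; [rewrite inE|move=> K'; rewrite inE => /eqP ->].
have [K2 [Ks Kt]] := IH K1 (mem_head _ _).
have [le|lt] := leP (K 0 i) (K2 0 i).
  by exists K2; split=> [|K']; rewrite inE ?Ks ?orbT // => /orP[/eqP -> //|/Kt].
exists K; split=> [|K']; rewrite inE ?eqxx // => /orP[/eqP -> //|/Kt h].
exact: le_trans h (ltW lt).
Qed.

Lemma seq_min (s : seq V) K0 i : K0 \in s ->
  exists K, K \in s /\ {in s, forall K', K 0 i <= K' 0 i}.
Proof.
move=> K0s; have [|K [Ks Kt]] := @seq_max [seq - K | K <- s] (- K0) i.
  by apply: map_f.
case/mapP: Ks => K' K's E; exists K'; split => // K'' K''s.
by have := Kt _ (map_f _ K''s); rewrite E !mxE lerN2.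
Qed.

(** By Vandermonde, at most [m] support points with distinct nodes [w] and [m] vanishing moments
    would force the values to vanish. The weight [d] absorbs a nonzero factor such as the bracket
    left over by [bracket_moments]. *)
Lemma full_string_moments a b (m : nat) (d w : V -> F) : a != b ->
  (forall K, f K != 0 -> d K != 0) ->
  (forall K K', f K != 0 -> f K' != 0 -> key a b K = key a b K' -> w K = w K' -> K = K') ->
  (forall ka j, (j < m)%N ->
     \sum_(K <- supp | key a b K == ka) (f K * d K) * w K ^+ j = 0) ->
  full_string f a b m.
Proof.
move=> ab d0 wi mom K fK.
pose cl := [seq K' <- supp | (key a b K' == key a b K) && (f K' != 0)].
have clP K' : (K' \in cl) = (key a b K' == key a b K) && (f K' != 0).
  by rewrite mem_filter; case: eqP => //= _; case: (boolP (f K' != 0)) => //= /fsupp ->.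
have Kcl : K \in cl by rewrite clP eqxx.
have [K1 [K1c K1m]] := @seq_min cl _ a Kcl.
have [K2 [K2c K2m]] := @seq_max cl _ a Kcl.
move: (K1c) (K2c); rewrite !clP => /andP[/eqP k1 f1] /andP[/eqP k2 f2].
exists K1, K2; split => //; rewrite leNgt; apply/negP => lt.
suff sz : (size cl <= m)%N.
  have /(_ K Kcl)/eqP : {in cl, forall K', f K' * d K' = 0}.
    apply: (@vandermonde_eq0 F _ cl (fun K' => f K' * d K') w).
    - exact: filter_uniq.
    - move=> K3 K4; rewrite !clP => /andP[/eqP k3 f3] /andP[/eqP k4 f4].
      by apply: wi => //; rewrite k3 k4.
    - move=> j js; rewrite -[RHS](mom (key a b K) j (leq_trans js sz)).
      rewrite big_filter big_mkcondr /=; apply: eq_bigr => K' _.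
      by case: eqP => //= ->; rewrite !mul0r.
  by rewrite mulf_eq0 (negbTE fK) (negbTE (d0 _ fK)).
(* The number of steps of [2 *: alpha a b] from the lowest point [K1]; a span shorter than [2 * m]
   leaves only the values below [m]. *)
pose h (K' : V) := absz (divz (K' 0 a - K1 0 a) 2).
have hE K' : K' \in cl -> K' 0 a = K1 0 a + 2 * (h K')%:Z.
  move=> K'c; have := K1m _ K'c; move: K'c; rewrite clP => /andP[_ /(fpar f1)[k E]] le.
  have E' : K' 0 a = K1 0 a + 2 * k 0 a by rewrite E !mxE.
  by rewrite /h; lia.
rewrite -(size_map h) -(size_iota 0 m); apply: uniq_leq_size.
  rewrite map_inj_in_uniq ?filter_uniq // => K3 K4 c3 c4 E.
  have Ea : K3 0 a = K4 0 a by rewrite (hE K3) // (hE K4) // E.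
  move: c3 c4; rewrite !clP => /andP[/eqP k3 _] /andP[/eqP k4 _].
  by have := key_eq ab (etrans k3 (esym k4)); rewrite Ea subrr scale0r addr0.
move=> j /mapP[K' K'c ->]; rewrite mem_iota add0n /=.
have := hE _ K'c; have := K2m _ K'c; lia.
Qed.

End Moments.
End Strings.

Lemma dotz_delta_l N (K : 'rV[int]_N) i : dotz (delta_mx 0 i) K = K 0 i.
Proof. by rewrite dotzC dotz_delta. Qed.

(** * The polytope, its faces and the width of supports *)

Section Polytope.
Variables (N : nat) (mu : 'I_N -> 'I_N -> nat).
Notation V := 'rV[int]_N.
Implicit Types (a b i : 'I_N) (u eta zeta K M : V).

(** The support function of the doubled polytope, the zonotope that is the sum of the segments from
    [- mu a b] to [mu a b] times [alpha a b]. *)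
Definition width u : int :=
  \sum_(p : 'I_N * 'I_N | (p.1 < p.2)%N) (mu p.1 p.2)%:Z * `|u 0 p.1 - u 0 p.2|.

(* The vertex of the polytope [dotz u K <= width u] in direction [eta], or the
   centre of the corresponding face when [eta] has equal coordinates. *)
Definition face_centre eta : V :=
  \sum_(p : 'I_N * 'I_N | (p.1 < p.2)%N)
    (sgz (eta 0 p.1 - eta 0 p.2) * (mu p.1 p.2)%:Z) *: alpha p.1 p.2.

Definition rho2 : V :=
  \sum_(p : 'I_N * 'I_N | (p.1 < p.2)%N) (mu p.1 p.2)%:Z *: alpha p.1 p.2.

Definition in_parity K : Prop := exists k : V, K = rho2 + 2 *: k.

Definition in_polytope K : Prop := in_parity K /\ forall u, dotz u K <= width u.

Lemma dotz_face_centre zeta eta : dotz zeta (face_centre eta) =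
  \sum_(p : 'I_N * 'I_N | (p.1 < p.2)%N)
    (sgz (eta 0 p.1 - eta 0 p.2) * (mu p.1 p.2)%:Z) * (zeta 0 p.1 - zeta 0 p.2).
Proof. by rewrite dotz_sumr; apply: eq_bigr => p _; rewrite dotzZr dotz_alpha. Qed.

(** Symmetry of [mu] makes the summand antisymmetric, so the sum over pairs folds into a sum over
    one index. In this form the coordinates at [a] and [b] can be compared term by term in
    [gform_face_centre]. *)
Lemma face_centreE eta i : (forall j k, mu j k = mu k j) ->
  face_centre eta 0 i = \sum_j sgz (eta 0 i - eta 0 j) * (mu i j)%:Z.
Proof.
move=> musym; rewrite -dotz_delta_l dotz_face_centre.
pose T j k := sgz (eta 0 j - eta 0 k) * (mu j k)%:Z.
have Tanti j k : T k j = - T j k by rewrite /T musym -opprB sgzN mulNr.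
have d0 j : (delta_mx 0 i : V) 0 j = (j == i)%:Z by rewrite mxE eqxx /= natz.
transitivity (\sum_(p : 'I_N * 'I_N) (p.1 != p.2)%:Z * (T p.1 p.2 * (p.1 == i)%:Z)).
  rewrite [RHS](bigID (fun p : 'I_N * 'I_N => (p.1 < p.2)%N)) /=.
  rewrite [X in _ = _ + X](reindex_inj (h := fun p : 'I_N * 'I_N => (p.2, p.1))) /=; last first.
    by move=> [j k] [j' k'] [-> ->].
  rewrite [X in _ = _ + X](bigID (fun p : 'I_N * 'I_N => (p.1 < p.2)%N)) /=.
  rewrite [X in _ = _ + (_ + X)]big1 ?addr0; last first.
    move=> [j k] /=; rewrite -!leqNgt -eqn_leq => /eqP/val_inj ->.
    by rewrite eqxx mul0r.
  rewrite [X in _ = _ + X](eq_bigl (fun p : 'I_N * 'I_N => (p.1 < p.2)%N)); last first.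
    by move=> [j k] /=; case: ltngtP.
  rewrite -big_split /=; apply: eq_bigr => -[j k] /= jk.
  rewrite !d0 -/(T j k) (Tanti j k).
  have [jk' kj] : j != k /\ k != j by split; rewrite -val_eqE neq_ltn jk ?orbT.
  by rewrite jk' kj /= !mul1r mulrBr mulNr.
rewrite -(pair_bigA _ (fun j k => (j != k)%:Z * (T j k * (j == i)%:Z))) /=.
rewrite (bigD1 i) //= [X in _ + X]big1 ?addr0 => [|j /negbTE ji]; last first.
  by apply: big1 => k _; rewrite ji !mulr0.
apply: eq_bigr => k _; rewrite eqxx mulr1; have [->|_] := eqVneq i k; last by rewrite mul1r.
by rewrite mul0r /T subrr sgz0 mul0r.
Qed.

(** The directional derivative of the support function at [eta]: for large [M] the sign of each
    difference is that of [eta], and only the ties of [eta] keep an absolute value. *)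
Lemma width_scale_large eta zeta :
  exists M : int, width (M *: eta + zeta) = M * width eta + dotz zeta (face_centre eta) +
    \sum_(p : 'I_N * 'I_N | (p.1 < p.2)%N && (eta 0 p.1 == eta 0 p.2))
      (mu p.1 p.2)%:Z * `|zeta 0 p.1 - zeta 0 p.2|.
Proof.
(* Distinct integer coordinates of [eta] differ by at least 1, so an [M] that bounds all differences
   of [zeta] decides every sign. *)
pose M : int := \sum_(p : 'I_N * 'I_N) `|zeta 0 p.1 - zeta 0 p.2|.
have ML p : `|zeta 0 p.1 - zeta 0 p.2| <= M.
  by rewrite /M (bigD1 p) //= lerDl sumr_ge0.
exists M; rewrite dotz_face_centre /width mulr_sumr -big_split /= big_mkcondr -big_split /=.
apply: eq_bigr => p _; rewrite !mxE; have := ML p.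
move: (mu _ _)%:Z (eta 0 p.1) (eta 0 p.2) (zeta 0 p.1) (zeta 0 p.2) => m e1 e2 z1 z2 h.
case: eqP => [->|ne].
  by rewrite subrr sgz0 normr0 !mulr0 !mul0r !add0r; congr (_ * `|_|); ring.
have [e|e|e] := ltgtP e1 e2; last by case: ne.
  have -> : `|e1 - e2| = - (e1 - e2) by lia.
  rewrite ltr0_sgz ?subr_lt0 //.
  have le0 : M * e1 + z1 - (M * e2 + z2) <= 0 by nia.
  by rewrite ler0_norm //; ring.
have -> : `|e1 - e2| = e1 - e2 by lia.
rewrite gtr0_sgz ?subr_gt0 //.
have ge0 : 0 <= M * e1 + z1 - (M * e2 + z2) by nia.
by rewrite ger0_norm //; ring.
Qed.

(** On the face of [eta] the terms in [M] cancel from the polytope inequality for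
    [M *: eta + zeta]. *)
Lemma face_bound eta zeta K : in_polytope K -> dotz eta K = width eta ->
  dotz zeta K <= dotz zeta (face_centre eta) +
    \sum_(p : 'I_N * 'I_N | (p.1 < p.2)%N && (eta 0 p.1 == eta 0 p.2))
      (mu p.1 p.2)%:Z * `|zeta 0 p.1 - zeta 0 p.2|.
Proof.
move=> [_ KH] E; have [M EM] := width_scale_large eta zeta.
by have := KH (M *: eta + zeta); rewrite EM dotzDl dotzZl E -addrA lerD2l.
Qed.

Lemma face_vertex eta K : (forall a b, (a < b)%N -> eta 0 a != eta 0 b) ->
  in_polytope K -> dotz eta K = width eta -> K = face_centre eta.
Proof.
move=> gen KS E; apply/rowP => i; apply/eqP; rewrite eq_le.
have h zeta : dotz zeta K <= dotz zeta (face_centre eta).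
  have := face_bound zeta KS E; rewrite big1 ?addr0 // => p /andP[/gen + /eqP e].
  by rewrite e eqxx.
rewrite -!dotz_delta_l h /=.
by have := h (- delta_mx 0 i); rewrite !dotzNl lerN2.
Qed.

(** By [face_bound] for [zeta] and [- zeta], every functional that agrees on [a] and [b] is constant
    on the face; the face is therefore a segment along [alpha a b]. *)
Lemma face_edge eta K a b : (a < b)%N -> eta 0 a = eta 0 b ->
  (forall i j : 'I_N, (i < j)%N -> eta 0 i = eta 0 j -> i = a /\ j = b) ->
  in_polytope K -> dotz eta K = width eta ->
  exists r : int, K = face_centre eta + r *: alpha a b /\ `|r| <= (mu a b)%:Z.
Proof.
move=> ab eab gen KS E.
have nab : a != b by rewrite -val_eqE neq_ltn ab.
have h zeta : dotz zeta K <= dotz zeta (face_centre eta) +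
    (mu a b)%:Z * `|zeta 0 a - zeta 0 b|.
  have := face_bound zeta KS E; rewrite (bigD1 (a, b)) /=; last by rewrite ab eab eqxx.
  rewrite [X in _ + (_ + X)]big1 ?addr0 // => -[i j] /= /andP[/andP[ij /eqP e]].
  by have [-> ->] := gen _ _ ij e; rewrite eqxx.
have h0 zeta : zeta 0 a = zeta 0 b -> dotz zeta K = dotz zeta (face_centre eta).
  move=> z; apply/eqP; rewrite eq_le; have := h zeta; have := h (- zeta).
  rewrite !mxE z !subrr !normr0 !mulr0 !addr0 !dotzNl lerN2 => h1 h2.
  by rewrite h1 h2.
pose r := K 0 a - face_centre eta 0 a.
exists r; split; last first.
  have := h (delta_mx 0 a); have := h (- delta_mx 0 a).
  rewrite !dotzNl !dotz_delta_l !mxE !eqxx /= [b == a]eq_sym (negbTE nab) /= /r.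
  lia.
apply/rowP => i; rewrite !mxE.
have [->|ia] := eqVneq i a; first by rewrite alpha_l // /r; ring.
have [->|ib] := eqVneq i b.
  rewrite alpha_r // /r.
  have := h0 (delta_mx 0 a + delta_mx 0 b); rewrite !dotzDl !dotz_delta_l !mxE !eqxx.
  rewrite [b == a]eq_sym (negbTE nab) /= => /(_ erefl); lia.
rewrite alpha_o // mulr0 addr0 -!dotz_delta_l h0 // !mxE.
by rewrite ![_ == i]eq_sym (negbTE ia) (negbTE ib).
Qed.

Lemma dotz_face_centre_self eta : dotz eta (face_centre eta) = width eta.
Proof.
rewrite dotz_face_centre; apply: eq_bigr => p _.
rewrite mulrAC mulrC; congr (_ * _).
move: (eta 0 p.1 - eta 0 p.2) => w.
by have [w0|w0|->] := ltgtP w 0; rewrite ?sgz0 ?mul0r ?normr0 // ?(ltr0_sgz w0) ?(gtr0_sgz w0) ?mul1r ?mulN1r;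
  rewrite ?(ltr0_norm w0) ?(gtr0_norm w0).
Qed.

Lemma widthN u : width (- u) = width u.
Proof. by apply: eq_bigr => p _; rewrite !mxE -opprD normrN. Qed.

Lemma polytope_abs u K : in_polytope K -> `|dotz u K| <= width u.
Proof.
move=> [_ KH]; rewrite ler_norml KH andbT lerNl -(widthN u).
by apply: le_trans (KH (- u)); rewrite dotzNl.
Qed.

Lemma rho2_in_polytope : in_polytope rho2.
Proof.
split; first by exists 0; rewrite scaler0 addr0.
move=> u; rewrite dotz_sumr; apply: ler_sum => q _.
by rewrite dotzZr dotz_alpha ler_wpM2l // ler_norm.
Qed.

(** Project the support to the plane by [(xi, eta)]. A root not orthogonal to [eta] is orthogonal to
    [xi + t eta] at exactly one time [t], and there a maximizer can slide along a full string,
    changing [eta] by at least [2 mu |eta(alpha)|]. For generic [xi] the times are distinct, so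
    [planar_width] adds these jumps up to [2 * width eta]. *)
Lemma width_lemma (F : fieldType) (f : V -> F) (supp : seq V) eta K0 :
  (forall K, f K != 0 -> K \in supp) -> f K0 != 0 ->
  (forall a b, (a < b)%N -> eta 0 a != eta 0 b -> full_string f a b (mu a b)) ->
  exists K1 K2, [/\ f K1 != 0, f K2 != 0 & 2 * width eta <= dotz eta K2 - dotz eta K1].
Proof.
move=> fsupp fK0 fullf.
pose A := [seq K <- supp | f K != 0].
have AP K : (K \in A) = (f K != 0).
  by rewrite mem_filter; case: (boolP (f K != 0)) => //= /fsupp ->.
pose ps := [seq p : 'I_N * 'I_N <- enum {: 'I_N * 'I_N} | (p.1 < p.2)%N && (eta 0 p.1 != eta 0 p.2)].
pose al (p : 'I_N * 'I_N) := alpha p.1 p.2.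
pose wd (p : 'I_N * 'I_N) : int := eta 0 p.1 - eta 0 p.2.
(* Two roots share a time [tm] exactly when [xi] vanishes on this combination, which is nonzero for
   distinct positive roots. *)
pose D := [seq d <- [seq wd p *: al p' - wd p' *: al p | p <- ps, p' <- ps] | d != 0].
have [|xi xiP] := @generic_functional N D.
  by move=> d; rewrite mem_filter => /andP[].
pose zd (p : 'I_N * 'I_N) : int := xi 0 p.1 - xi 0 p.2.
pose tm p : rat := - (zd p)%:~R / (wd p)%:~R.
pose L := [seq (tm p, (2 * (mu p.1 p.2)%:Z * `|wd p|)%:~R : rat) | p <- ps].
pose x K : rat := (dotz xi K)%:~R.
pose y K : rat := (dotz eta K)%:~R.
have psP p : p \in ps -> (p.1 < p.2)%N /\ wd p != 0.
  by rewrite mem_filter subr_eq0 => /andP[/andP[]].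
have wdQ p : p \in ps -> (wd p)%:~R != 0 :> rat by case/psP => _ ?; rewrite intr_eq0.
have [|||K1 [K2 [K1A K2A le]]] := @planar_width _ A x y K0 L.
- by rewrite AP.
- rewrite /L -map_comp /= map_inj_in_uniq; first by rewrite filter_uniq ?enum_uniq.
  move=> p p' pp pp' /= E.
  have E0 : dotz xi (wd p *: al p' - wd p' *: al p) = 0.
    rewrite dotzBr !dotzZr !dotz_alpha -/(zd p) -/(zd p').
    have wp := wdQ _ pp; have wp' := wdQ _ pp'.
    apply/eqP; rewrite -(intr_eq0 rat) rmorphB !rmorphM /=.
    move: E; rewrite /tm => /eqP; rewrite eqr_div // => /eqP E.
    by apply/eqP; lra.
  have {E0} /eqP E0 : wd p *: al p' - wd p' *: al p == 0.
    apply: contraPT E0 => ne; apply/eqP/xiP; rewrite mem_filter ne /=.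
    by apply/allpairsP; exists (p, p').
  have [lt wp] := psP _ pp; have [lt' wp'] := psP _ pp'.
  have ev i : wd p * ((i == p'.1)%:Z - (i == p'.2)%:Z) =
              wd p' * ((i == p.1)%:Z - (i == p.2)%:Z).
    move/rowP: E0 => /(_ i); rewrite mxE [X in _ + X]mxE !(mxE _ _ 0 i).
    by rewrite -!alphaE => /eqP; rewrite subr_eq0 => /eqP.
  have e1 := ev p'.1; have e2 := ev p'.2.
  have n12 : (p'.1 == p'.2) = false by apply/negbTE; rewrite -val_eqE neq_ltn lt'.
  rewrite eqxx n12 in e1; rewrite eqxx eq_sym n12 in e2.
  have m12 : (p.1 == p.2) = false by apply/negbTE; rewrite -val_eqE neq_ltn lt.
  have [E1|N1] := eqVneq p'.1 p.1.
    have [E2|N2] := eqVneq p'.2 p.2; first by rewrite (surjective_pairing p) -E1 -E2 -surjective_pairing.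
    have [E3|N3] := eqVneq p'.2 p.1; first by rewrite E1 E3 ltnn in lt'.
    by rewrite (negbTE N2) (negbTE N3) in e2; lia.
  have [E3|N3] := eqVneq p'.1 p.2; last by rewrite (negbTE N1) (negbTE N3) in e1; lia.
  have [E4|N4] := eqVneq p'.2 p.1; first by rewrite E3 E4 ltnNge ltnW in lt'.
  have [E5|N5] := eqVneq p'.2 p.2; first by rewrite E3 E5 ltnn in lt'.
  by rewrite (negbTE N4) (negbTE N5) in e2; lia.
- move=> _ /mapP[p pp ->] K [] /=; rewrite AP => fK Kmax.
  have [lt wp] := psP _ pp; have wpQ := wdQ _ pp.
  have nab : p.1 != p.2 by rewrite -val_eqE neq_ltn lt.
  have [] := fullf p.1 p.2 lt _ K fK; first by rewrite -subr_eq0.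
  move=> K1 [K2 [f1 f2 k1 k2 le]].
  have line K' : key p.1 p.2 K' = key p.1 p.2 K ->
      y K' = y K + (K' 0 p.1 - K 0 p.1)%:~R * (wd p)%:~R /\
      x K' + tm p * y K' = x K + tm p * y K.
    move=> /esym/(key_eq nab); move: (K' 0 p.1 - K 0 p.1) => k ->.
    rewrite /x /y !dotzDr !dotzZr !dotz_alpha.
    rewrite -/(zd p) -/(wd p) /tm; move: (zd p) (wd p) wpQ => zp wp' wpQ'.
    by rewrite !rmorphD !rmorphM /=; split=> //; field.
  have [[y1 t1] [y2 t2]] := (line _ k1, line _ k2).
  have tp1 : K1 \in A /\ {in A, forall K', x K' + tm p * y K' <= x K1 + tm p * y K1}.
    by split; [rewrite AP|move=> K' /Kmax; rewrite t1].
  have tp2 : K2 \in A /\ {in A, forall K', x K' + tm p * y K' <= x K2 + tm p * y K2}.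
    by split; [rewrite AP|move=> K' /Kmax; rewrite t2].
  have [neg|pos] := leP (wd p) 0.
    exists K2, K1; split=> //; rewrite y1 y2 -addrA lerD2l -!intrM -!intrD ler_int.
    rewrite ler0_norm //; move: (wd p) neg (K2 0 _) (K1 0 _) (K 0 _) (mu _ _) le => w w0 k2' k1' k' mm le.
    have := mulr_le0 w0 (_ : k1' + 2 * mm%:Z - k2' <= 0); rewrite subr_le0 le => /(_ isT).
    by lia.
  exists K1, K2; split=> //; rewrite y1 y2 -addrA lerD2l -!intrM -!intrD ler_int.
  rewrite gtr0_norm //; move: (wd p) pos (K2 0 _) (K1 0 _) (K 0 _) (mu _ _) le => w w0 k2' k1' k' mm le.
  have := mulr_ge0 (ltW w0) (_ : 0 <= k2' - (k1' + 2 * mm%:Z)); rewrite subr_ge0 le => /(_ isT).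
  by lia.
exists K1, K2; rewrite -!AP; split=> //.
rewrite -(ler_int rat) rmorphB /=; apply: le_trans le.
rewrite big_map /= -(rmorph_sum (intmul 1)) ler_int /=.
rewrite /width mulr_sumr big_filter big_enum_cond /= (bigID (fun p => eta 0 p.1 == eta 0 p.2)) /=.
rewrite big1 ?add0r; last by move=> p /andP[_ /eqP ->]; rewrite subrr normr0 !mulr0.
by rewrite le_eqVlt; apply/orP; left; apply/eqP; apply: eq_big => // p _; rewrite mulrA.
Qed.

(** A support of length at least [2 * width eta] inside the interval from [- width eta] to
    [width eta] touches its upper end. *)
Lemma width_attained (F : fieldType) (f : V -> F) (supp : seq V) eta K0 :
  (forall K, f K != 0 -> K \in supp) -> f K0 != 0 ->
  (forall a b, (a < b)%N -> eta 0 a != eta 0 b -> full_string f a b (mu a b)) ->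
  (forall K, f K != 0 -> `|dotz eta K| <= width eta) ->
  exists K, f K != 0 /\ dotz eta K = width eta.
Proof.
move=> fsupp fK0 full bnd.
have [K1 [K2 [f1 f2 le]]] := width_lemma fsupp fK0 full.
by exists K2; split=> //; have := bnd _ f1; have := bnd _ f2; lia.
Qed.
End Polytope.

(** * The limit systems and their solutions *)

Section Systems.
Variables (N : nat) (g : 'I_N -> nat) (mu : 'I_N -> 'I_N -> nat).
Variables (F : fieldType) (p : F).
Notation V := 'rV[int]_N.
Implicit Types (a b i : 'I_N) (u eta zeta K M : V).
Hypothesis g_gt0 : forall i, (0 < g i)%N.
Hypothesis p_neq0 : p != 0.
Hypothesis p_nroot : forall j : int, j != 0 -> p ^ j != 1.

Lemma nroot_inj : injective (fun j : int => p ^ j).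
Proof.
move=> i j E; apply/eqP; rewrite -subr_eq0; apply: contraPT E => /p_nroot ne E.
by move: ne; rewrite expfzDr // -invr_expz E mulfV ?eqxx // expfz_neq0.
Qed.

(* [2 (alpha_ab, nu)] for [K = 2 nu] *)
Definition gform a b K : int := (g a)%:Z * K 0 a - (g b)%:Z * K 0 b.

Lemma gformD a b K K' : gform a b (K + K') = gform a b K + gform a b K'.
Proof. by rewrite /gform !mxE; ring. Qed.

Lemma gformZ a b k K : gform a b (k *: K) = k * gform a b K.
Proof. by rewrite /gform !mxE; ring. Qed.

Lemma gform_alpha a b : a != b -> gform a b (alpha a b) = (g a + g b)%:Z.
Proof. by move=> ab; rewrite /gform alpha_l // alpha_r // mulr1 mulrN1 opprK PoszD. Qed.

Lemma gform_inj a b K K' : a != b -> key a b K = key a b K' ->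
  gform a b K = gform a b K' -> K = K'.
Proof.
move=> ab /(key_eq ab) ->; rewrite gformD gformZ gform_alpha // => E.
have : (K' 0 a - K 0 a) * (g a + g b)%:Z = 0.
  by apply: (@addrI _ (gform a b K)); rewrite addr0.
move=> /eqP; rewrite mulf_eq0 => /orP[/eqP ->|]; first by rewrite scale0r addr0.
by rewrite eqz_nat addn_eq0 => /andP[/eqP ga _]; have := g_gt0 a; rewrite ga.
Qed.

(** A functional positive on all [alpha a b] with [a < b]; the vertex it selects is [rho2]. *)
Definition std : V := \row_i (- (i : nat)%:Z).

Lemma std_generic a b : (a < b)%N -> std 0 a != std 0 b.
Proof. by rewrite !mxE eqr_opp eqz_nat neq_ltn => ->. Qed.

Lemma face_centre_std : face_centre mu std = rho2 mu.
Proof.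
by apply: eq_bigr => q lt; rewrite !mxE gtr0_sgz ?mul1r // opprK addrC subr_gt0 ltz_nat.
Qed.

Lemma in_polytope_parity (f : V -> F) : (forall K, f K != 0 -> in_polytope mu K) ->
  forall K K', f K != 0 -> f K' != 0 -> exists k : V, K' = K + 2 *: k.
Proof.
move=> fS K K' /fS[[k ->] _] /fS[[k' ->] _]; exists (k' - k).
by rewrite scalerBr; apply/rowP => i; rewrite !mxE; ring.
Qed.

Section Limit.
Variables (supp : seq V) (usupp : uniq supp).
Hypothesis suppP : forall K, in_polytope mu K -> K \in supp.

(* The string conditions degenerate to these when [x] tends to infinity in the
   Weyl chamber described by the signs [eps]. *)
Lemma limit_system_eq0 (f : V -> F) (eps : 'I_N -> 'I_N -> int) :
  (forall K, f K != 0 -> in_polytope mu K) ->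
  (forall a b, eps a b = 1 \/ eps a b = -1) ->
  (forall a b s ka, (a < b)%N -> (0 < s <= mu a b)%N ->
     \sum_(K <- supp | key a b K == ka) f K * p ^ (eps a b * s%:Z * gform a b K) = 0) ->
  f (rho2 mu) = 0 -> forall K, f K = 0.
Proof.
move=> fS epsP sys f0 K0; apply: contra_eq (f0) => fK0; apply/eqP => _.
have [|K [fK EK]] := width_attained (fun K fK => suppP (fS K fK)) fK0 (eta := std) (mu := mu) _
   (fun K fK => polytope_abs _ (fS K fK)).
  move=> a b ab _; have nab : a != b by rewrite -val_eqE neq_ltn ab.
  pose w K := p ^ (eps a b * gform a b K).
  apply: (@full_string_moments _ _ f supp usupp _ _ a b _ w w nab).
  - by move=> K /fS/suppP.
  - exact: in_polytope_parity.
  - by move=> K _; rewrite /w expfz_neq0.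
  - move=> K K' _ _ kK /nroot_inj E; apply: (gform_inj nab kK).
    by case: (epsP a b) E => ->; lia.
  (* The condition with [s = j + 1] is the moment of order [j]; its extra factor [w K] plays the
     part of [d]. *)
  - move=> ka j jm; rewrite -[RHS](sys a b j.+1 ka ab jm); apply: eq_bigr => K _.
    rewrite -mulrA -exprS /w exprnP exprz_exp; congr (_ * _ ^ _); lia.
move: (fK); rewrite (face_vertex std_generic (fS _ fK) EK) face_centre_std.
by rewrite f0 eqxx.
Qed.

(** What a string condition says about the coefficient of one exponential in [x]: the two terms of
    the bracket of order [s] shift [M] by [s alpha] in opposite directions, so the two columns
    differ by [2 s alpha]. *)
Definition wall_system (C : V -> V -> F) : Prop :=
  forall a b s ka M, (a < b)%N -> (0 < s <= mu a b)%N ->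
  \sum_(K <- supp | key a b K == ka) C K M * p ^ (s%:Z * gform a b K) =
  \sum_(K <- supp | key a b K == ka)
    C K (M + (2 * s%:Z) *: alpha a b) * p ^ (- (s%:Z * gform a b K)).

(** For [M0] maximal in direction [u], one side of each condition involves only a column beyond the
    maximum and vanishes. The rest is the limit system for the chamber of [u], so a nonzero column
    [M0] has a nonzero entry in row [rho2]. *)
Lemma wall_system_top (C : V -> V -> F) u M0 K0 : wall_system C ->
  (forall K M, C K M != 0 -> in_polytope mu K) ->
  (forall a b, (a < b)%N -> u 0 a != u 0 b) ->
  (forall K M, C K M != 0 -> dotz u M <= dotz u M0) ->
  C K0 M0 != 0 -> C (rho2 mu) M0 != 0.
Proof.
move=> sys CS ugen utop; apply: contra_neq => C0.
apply: (@limit_system_eq0 (fun K => C K M0)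
   (fun a b => if u 0 b < u 0 a then 1 else -1)) => // [K|a b|a b s ka ab sm].
- exact: CS.
- by case: ifP; [left|right].
have above M : dotz u M0 < dotz u M -> forall K, C K M = 0.
  by move=> lt K; apply: contraTeq lt => /utop; rewrite leNgt.
case: ltrP => le.
  under eq_bigr do rewrite mul1r.
  rewrite (sys a b s ka M0 ab sm) big1 // => K _; rewrite above ?mul0r //.
  by rewrite dotzDr dotzZr dotz_alpha; nia.
have lt : u 0 a < u 0 b by rewrite lt_neqAle ugen.
under eq_bigr do rewrite mulN1r mulNr.
have := sys a b s ka (M0 - (2 * s%:Z) *: alpha a b) ab sm.
rewrite subrK => <-; rewrite big1 // => K _; rewrite above ?mul0r //.
by rewrite dotzBr dotzZr dotz_alpha; nia.
Qed.

Lemma dotz_max (s : seq V) u M0 : M0 \in s ->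
  exists M, M \in s /\ {in s, forall M', dotz u M' <= dotz u M}.
Proof.
elim: s M0 => // M s IH M0; case: s IH => [|M1 s] IH _.
  by exists M; split; [rewrite inE|move=> M'; rewrite inE => /eqP ->].
have [M2 [Ms Mt]] := IH M1 (mem_head _ _).
have [le|lt] := leP (dotz u M) (dotz u M2).
  by exists M2; split=> [|M']; rewrite inE ?Ms ?orbT // => /orP[/eqP -> //|/Mt].
exists M; split=> [|M']; rewrite inE ?eqxx // => /orP[/eqP -> //|/Mt h].
exact: le_trans h (ltW lt).
Qed.

Lemma wall_system_max (C : V -> V -> F) (suppM : seq V) u K0 M0 : wall_system C ->
  (forall K M, C K M != 0 -> in_polytope mu K) ->
  (forall K M, C K M != 0 -> M \in suppM) ->
  (forall a b, (a < b)%N -> u 0 a != u 0 b) ->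
  C K0 M0 != 0 -> exists M, C (rho2 mu) M != 0 /\ dotz u M0 <= dotz u M.
Proof.
move=> sys CS CM ugen C0.
pose Ms := [seq M <- suppM | has (fun K => C K M != 0) supp].
have MsP K M : C K M != 0 -> M \in Ms.
  move=> ne; rewrite mem_filter (CM _ _ ne) andbT; apply/hasP; exists K => //.
  exact: suppP (CS _ _ ne).
have [M [Min Mmax]] := dotz_max u (MsP _ _ C0).
move: (Min); rewrite mem_filter => /andP[/hasP[K _ ne] _].
exists M; split; last exact: Mmax (MsP _ _ C0).
by apply: (wall_system_top sys CS ugen) ne => K' M' /MsP/Mmax.
Qed.

Lemma wall_system_eq0 (C : V -> V -> F) (suppM : seq V) : wall_system C ->
  (forall K M, C K M != 0 -> in_polytope mu K) ->
  (forall K M, C K M != 0 -> M \in suppM) ->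
  (forall M, C (rho2 mu) M = 0) -> forall K M, C K M = 0.
Proof.
move=> sys CS CM C0 K M; apply/eqP; apply/negP => /negP ne.
have [M' [/eqP]] := wall_system_max sys CS CM std_generic ne.
by rewrite C0.
Qed.

Lemma width_triangle u u' (k : nat) : width mu (k%:Z *: u + u') <= k%:Z * width mu u + width mu u'.
Proof.
rewrite /width mulr_sumr -big_split /=; apply: ler_sum => q _; rewrite !mxE.
rewrite mulrCA -mulrDr ler_wpM2l //.
have -> : k%:Z * u 0 q.1 + u' 0 q.1 - (k%:Z * u 0 q.2 + u' 0 q.2) =
  k%:Z * (u 0 q.1 - u 0 q.2) + (u' 0 q.1 - u' 0 q.2) by ring.
by apply: le_trans (ler_normD _ _) _; rewrite normrM.
Qed.

Lemma wall_system_polytope (C : V -> V -> F) (suppM : seq V) : wall_system C ->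
  (forall K M, C K M != 0 -> in_polytope mu K) ->
  (forall K M, C K M != 0 -> M \in suppM) ->
  (forall M, C (rho2 mu) M != 0 -> in_polytope mu M) ->
  forall K M, C K M != 0 -> in_polytope mu M.
Proof.
move=> sys CS CM C0 K M ne; split.
  apply: contrapT => npar; apply: (negP ne); apply/eqP.
  (* The system relates only columns that differ by even vectors, so the part of [C] in the wrong
     parity is itself a solution, and its row [rho2] is zero. *)
  pose C' K M := if `[< in_parity mu M >] then 0 else C K M.
  have -> : C K M = C' K M by rewrite /C'; case: asboolP.
  have C'C K' M' : C' K' M' != 0 -> C K' M' != 0.
    by rewrite /C'; case: asboolP => // _; rewrite eqxx.
  apply: (@wall_system_eq0 C' suppM) => [|K' M' /C'C/CS //|K' M' /C'C/CM //|M'].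
    move=> a b s ka M' ab sm; rewrite /C'.
    have E : `[< in_parity mu (M' + (2 * s%:Z) *: alpha a b) >] = `[< in_parity mu M' >].
      rewrite -scalerA; apply: asbool_equiv_eq; split=> -[k E].
        exists (k - s%:Z *: alpha a b).
        by rewrite scalerBr addrA -E addrK.
      by exists (k + s%:Z *: alpha a b); rewrite scalerDr addrA -E.
    rewrite E; case: asboolP => _; last exact: sys.
    by rewrite !big1 // => K' _; rewrite mul0r.
  rewrite /C'; case: asboolP => // np; apply/eqP; apply/negP => /negP /C0[].
  by [].
move=> u.
(* [u] may have ties, but [k *: u + std] has none for [k > N], since coordinates of [std] differ by
   less than [N]. The inequality for all large [k] implies the one for [u]. *)
suff H (k : nat) : (N < k)%N ->
    k%:Z * dotz u M + dotz std M <= k%:Z * width mu u + width mu std.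
  rewrite leNgt; apply/negP => lt.
  pose k : nat := (N + absz (width mu std - dotz std M)%R).+1.
  have := H k; rewrite /k ltnS leq_addr => /(_ isT); nia.
move=> kN; have ugen a b : (a < b)%N -> (k%:Z *: u + std) 0 a != (k%:Z *: u + std) 0 b.
  move=> ab; rewrite !mxE; apply/negP => /eqP E.
  have bN := ltn_ord b.
  move: (u 0 a) (u 0 b) E => ua ub E.
  have k0 : 0 <= k%:Z by [].
  have [lt|lt|E'] := ltgtP ua ub.
  - by have := mulr_ge0 k0 (_ : 0 <= ub - ua - 1); lia.
  - by have := mulr_ge0 k0 (_ : 0 <= ua - ub - 1); lia.
  - by rewrite E' in E; lia.
have [M' [ne' le]] := wall_system_max sys CS CM ugen ne.
rewrite -dotzZl -dotzDl; apply: le_trans le _.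
by apply: le_trans (width_triangle _ _ _); case: (C0 _ ne').
Qed.

Lemma std_rho2 a b (s : nat) : (a < b)%N -> (0 < s)%N ->
  ~ in_polytope mu (rho2 mu + (2 * s%:Z) *: alpha a b).
Proof.
move=> ab s0 [_ /(_ std)]; rewrite dotzDr -face_centre_std dotz_face_centre_self.
rewrite dotzZr dotz_alpha !mxE; nia.
Qed.

Lemma wall_system_sym (C : V -> V -> F) : wall_system C ->
  wall_system (fun K M => C M K) ->
  (forall K M, C K M != 0 -> in_polytope mu K) ->
  (forall K M, C K M != 0 -> in_polytope mu M) ->
  forall K M, C K M = C M K.
Proof.
move=> sys sysT CK CM K M; apply/eqP; rewrite -subr_eq0; apply/eqP; move: K M.
have AS K M : C K M - C M K != 0 -> in_polytope mu K /\ in_polytope mu M.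
  have [->|ne _] := eqVneq (C K M) 0; last by split; [exact: CK ne|exact: CM ne].
  by rewrite sub0r oppr_eq0 => ne; split; [exact: CM ne|exact: CK ne].
apply: (@wall_system_eq0 (fun K M => C K M - C M K) supp).
- move=> a b s ka M ab sm.
  transitivity (\sum_(K <- supp | key a b K == ka) C K M * p ^ (s%:Z * gform a b K) -
     \sum_(K <- supp | key a b K == ka) C M K * p ^ (s%:Z * gform a b K)).
    by rewrite -sumrB; apply: eq_bigr => K _; rewrite mulrBl.
  rewrite (sys a b s ka M ab sm) (sysT a b s ka M ab sm) -sumrB.
  by apply: eq_bigr => K _; rewrite mulrBl.
- by move=> K M /AS[].
- by move=> K M /AS[_ /suppP].
(* Row [rho2] of the difference solves a limit system: at the column [rho2] the right-hand sides sit
   at [rho2 + 2 s alpha], which [std_rho2] puts outside the polytope. Antisymmetry makes its entry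
   at [rho2] zero. *)
apply: (@limit_system_eq0 _ (fun _ _ => 1)) => [M /AS[] //|a b|a b s ka ab sm|].
- by left.
- under eq_bigr do rewrite mul1r mulrBl.
  rewrite sumrB (sysT a b s ka (rho2 mu) ab sm) (sys a b s ka (rho2 mu) ab sm).
  have s0 : (0 < s)%N by case/andP: sm.
  rewrite !big1 ?subr0 // => K _.
    have [->|ne] := eqVneq (C K (rho2 mu + (2 * s%:Z) *: alpha a b)) 0; first by rewrite mul0r.
    by case: (std_rho2 ab s0); exact: CM ne.
  have [->|ne] := eqVneq (C (rho2 mu + (2 * s%:Z) *: alpha a b) K) 0; first by rewrite mul0r.
  by case: (std_rho2 ab s0); exact: CK ne.
- by rewrite subrr.
Qed.

End Limit.

Lemma polytope_seq : exists s : seq V, uniq s /\ forall K, K \in s <-> in_polytope mu K.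
Proof.
pose B : nat := absz (\sum_i width mu (delta_mx 0 i)).
have wB i : width mu (delta_mx 0 i) <= B%:Z.
  have w0 u : 0 <= width mu u by apply: sumr_ge0 => q _; rewrite mulr_ge0.
  rewrite /B gez0_abs; last exact: sumr_ge0.
  by rewrite (bigD1 i) //= lerDl sumr_ge0.
pose box := [seq (\row_i ((h i : nat)%:Z - B%:Z)) : V | h : {ffun 'I_N -> 'I_(B + B).+1} <- enum {: {ffun 'I_N -> 'I_(B + B).+1}}].
exists (undup [seq K <- box | `[< in_polytope mu K >]]); split; first exact: undup_uniq.
move=> K; rewrite mem_undup mem_filter; split=> [/andP[/asboolP //]|KS].
apply/andP; split; first exact/asboolP.
apply/mapP; exists [ffun i => inord (absz (K 0 i + B%:Z))]; first by rewrite mem_enum.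
apply/rowP => i; rewrite mxE ffunE.
have := le_trans (polytope_abs (delta_mx 0 i) KS) (wB i); rewrite dotz_delta_l.
move: (K 0 i) => k kB; rewrite inordK; first by clear -kB; lia.
by clear -kB; lia.
Qed.

End Systems.

(** * Coefficients along an edge *)

Section Bracket.
Variable F : fieldType.
Implicit Types (z y : F).

Lemma brV z : br z^-1 = - br z.
Proof. by rewrite /br invrK opprB. Qed.

Lemma br_eq0 z : z != 0 -> (br z == 0) = (z ^+ 2 == 1).
Proof.
move=> z0; rewrite /br subr_eq0 -(inj_eq (mulfI z0)) mulfV //.
Qed.

Lemma br_sign z y : y ^+ 2 = 1 -> br (y * z) = y * br z.
Proof.
move=> y2; have yV : y^-1 = y.
  have y0 : y != 0 by apply: contra_eq_neq y2 => ->; rewrite expr0n eq_sym oner_eq0.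
  by apply: (mulfI y0); rewrite mulfV // -expr2 y2.
by rewrite /br invfM yV mulrBr.
Qed.

End Bracket.

Lemma prod_nat_scale (F : comPzRingType) (y : F) (k l : nat) (f : nat -> F) :
  \prod_(k <= j < l) (y * f j) = y ^+ (l - k) * \prod_(k <= j < l) f j.
Proof. by rewrite big_split /= big_const_nat iter_mulr_1. Qed.

Section EdgeString.
Variables (F : fieldType) (p : F) (G m : nat).
Hypothesis p_neq0 : p != 0.
Hypothesis p_nroot : forall j : int, j != 0 -> p ^ j != 1.
Hypothesis G_gt0 : (0 < G)%N.
Implicit Types (y : F) (j : int).

Definition bq j : F := br (p ^ (j * G%:Z)).

(** A q-factorial without its normalizing powers; the quotient in [edge_coef] is a q-binomial
    coefficient. *)
Definition bfact (k : nat) : F := \prod_(1 <= j < k.+1) bq j%:Z.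

(* Up to a common factor, the coefficients along an edge of the polytope. *)
Definition edge_coef (k : nat) y : F :=
  bfact m / (bfact k * bfact (m - k)) *
  \prod_((m - k).+1 <= j < m.+1) br (y * p ^ (j%:Z * G%:Z)) *
  \prod_(k.+1 <= j < m.+1) br (p ^ (j%:Z * G%:Z) / y).

Lemma bq_neq0 j : j != 0 -> bq j != 0.
Proof.
move=> j0; rewrite /bq br_eq0 ?expfz_neq0 // exprnP exprz_exp p_nroot //.
by rewrite !mulf_neq0 // lt0n_neq0.
Qed.

Lemma bqN j : bq (- j) = - bq j.
Proof. by rewrite /bq mulNr -invr_expz brV. Qed.

Lemma bfact_neq0 k : bfact k != 0.
Proof.
rewrite prodf_seq_neq0; apply/allP => j; rewrite mem_index_iota => /andP[j0 _] /=.
by apply: bq_neq0; lia.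
Qed.

Lemma bfact_range (a b s : nat) : (a <= b)%N ->
  bfact (a + s) * \prod_(a.+1 <= j < b.+1) bq (j%:Z + s%:Z) = bfact (b + s).
Proof.
elim: b => [|b IH]; first by rewrite leqn0 => /eqP ->; rewrite big_geq // mulr1.
rewrite leq_eqVlt => /orP[/eqP ->|]; first by rewrite big_geq // mulr1.
rewrite ltnS => ab; rewrite big_nat_recr //= mulrA IH // [in RHS]/bfact big_nat_recr //=.
Qed.

Lemma bfact_range_sub (a b s : nat) : (a <= b)%N -> (s <= a)%N ->
  bfact (a - s) * \prod_(a.+1 <= j < b.+1) bq (j%:Z - s%:Z) = bfact (b - s).
Proof.
elim: b => [|b IH]; first by rewrite leqn0 => /eqP ->; rewrite big_geq // mulr1.
rewrite leq_eqVlt => /orP[/eqP ->|]; first by rewrite big_geq // mulr1.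
rewrite ltnS => ab sa; rewrite big_nat_recr //= mulrA IH // subSn ?(leq_trans sa) //.
rewrite [in RHS]/bfact big_nat_recr //=; congr (_ * bq _).
by have := leq_trans sa ab; lia.
Qed.

Lemma edge_coef0 y : edge_coef 0 y = \prod_(1 <= j < m.+1) br (p ^ (j%:Z * G%:Z) / y).
Proof.
rewrite /edge_coef subn0 [X in _ / (X * _)]big_geq // mul1r divff ?bfact_neq0 //.
by rewrite [X in _ * X * _]big_geq // !mul1r.
Qed.

Lemma edge_coef_last y : edge_coef m y = \prod_(1 <= j < m.+1) br (p ^ (j%:Z * G%:Z) / y^-1).
Proof.
rewrite /edge_coef subnn [X in _ / (_ * X)]big_geq // mulr1 divff ?bfact_neq0 //.
by rewrite [X in _ * X]big_geq // mul1r mulr1; apply: eq_bigr => j _; rewrite invrK mulrC.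
Qed.

Section Wall.
Variables (y : F) (s : nat).
Hypothesis y2 : y ^+ 2 = 1.
Let yp := y * p ^ (s%:Z * G%:Z).
Let ym := y * p ^ (- (s%:Z * G%:Z)).

Let y0 : y != 0.
Proof. by apply: contra_eq_neq y2 => ->; rewrite expr0n eq_sym oner_eq0. Qed.

Let yV : y^-1 = y.
Proof. by apply: (mulfI y0); rewrite mulfV // -expr2 y2. Qed.

Let br_yp j : br (yp * p ^ (j * G%:Z)) = y * bq (j + s%:Z).
Proof. by rewrite -mulrA -expfzDr // br_sign // -mulrDl addrC. Qed.

Let br_ypV j : br (p ^ (j * G%:Z) / yp) = y * bq (j - s%:Z).
Proof.
rewrite /yp invfM yV mulrCA -[_^-1]/(_^-1) invr_expz -expfzDr // br_sign //.
by rewrite -mulrBl.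
Qed.

Let br_ym j : br (ym * p ^ (j * G%:Z)) = y * bq (j - s%:Z).
Proof. by rewrite -mulrA -expfzDr // br_sign // addrC -mulrBl. Qed.

Let br_ymV j : br (p ^ (j * G%:Z) / ym) = y * bq (j + s%:Z).
Proof.
rewrite /ym invfM yV mulrCA invr_expz -expfzDr // br_sign //.
by rewrite opprK -mulrDl.
Qed.

(** The factor [j = s] of the second product becomes the bracket of a sign, which is zero; in
    [edge_coef_wall_high] the same happens in the first product. *)
Lemma edge_coef_wall_low k : (k < s)%N -> (s <= m)%N -> edge_coef k yp = 0.
Proof.
move=> ks sm; rewrite /edge_coef; apply/eqP; rewrite mulf_eq0; apply/orP; right.
rewrite prodf_seq_eq0; apply/hasP; exists s; first by rewrite mem_index_iota ks ltnS.
by rewrite /= br_ypV subrr /bq mul0r expr0z /br invr1 subrr mulr0.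
Qed.

Lemma edge_coef_wall_high k : (k <= m)%N -> (m < k + s)%N -> (s <= m)%N -> edge_coef k ym = 0.
Proof.
move=> km ks sm; rewrite /edge_coef; apply/eqP; rewrite !mulf_eq0; apply/orP; left.
apply/orP; right; rewrite prodf_seq_eq0; apply/hasP; exists s.
  by rewrite mem_index_iota; lia.
by rewrite /= br_ym subrr /bq mul0r expr0z /br invr1 subrr mulr0.
Qed.

(** On the wall every bracket is [y] times [bq (j + s)] or [bq (j - s)], so the products telescope
    to quotients of [bfact]. The quotients agree on both sides, and the powers of [y] total [m] on
    each. *)
Lemma edge_coef_wall k : (k + s <= m)%N -> edge_coef (k + s) yp = edge_coef k ym.
Proof.
move=> ksm; rewrite /edge_coef.
under eq_bigr do rewrite br_yp.
under [X in _ * X = _]eq_bigr do rewrite br_ypV.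
under [X in _ = _ * X * _]eq_bigr do rewrite br_ym.
under [X in _ = _ * X]eq_bigr do rewrite br_ymV.
rewrite !prod_nat_scale.
have r1 := @bfact_range (m - (k + s)) m s (leq_subr _ _).
have r2 := @bfact_range_sub (k + s) m s ksm (leq_addl _ _).
have r3 := @bfact_range_sub (m - k) m s (leq_subr _ _) _.
have r4 := @bfact_range k m s (leq_trans (leq_addr _ _) ksm).
have {}r3 := r3 (ltac:(lia)).
have E1 : (m - (k + s) + s = m - k)%N by lia.
have E3 : (m - k - s = m - (k + s))%N by lia.
rewrite E1 in r1; rewrite addnK in r2; rewrite E3 in r3.
have e1 : (m.+1 - (m - (k + s)).+1 = k + s)%N by lia.
have e2 : (m.+1 - (k + s).+1 = m - (k + s))%N by lia.
have e3 : (m.+1 - (m - k).+1 = k)%N by lia.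
have e4 : (m.+1 - k.+1 = m - k)%N by lia.
rewrite e1 e2 e3 e4.
move: (bfact_neq0 (m - k)) (bfact_neq0 k) (bfact_neq0 (m - (k + s))) (bfact_neq0 (k + s)).
move: r1 r2 r3 r4.
set f1 := bfact (m - k); set f2 := bfact k; set f3 := bfact (m - (k + s)).
set f4 := bfact (k + s); set P1 := \prod_(_ <= _ < _) _; set P2 := \prod_(_ <= _ < _) _.
set P3 := \prod_(_ <= _ < _) _; set P4 := \prod_(_ <= _ < _) _.
move=> r1 r2 r3 r4 f10 f20 f30 f40.
have -> : P1 = bfact (m + s) / f1 by rewrite -r1 mulrC mulKf.
have -> : P2 = bfact (m - s) / f2 by rewrite -r2 mulrC mulKf.
have -> : P3 = bfact (m - s) / f3 by rewrite -r3 mulrC mulKf.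
have -> : P4 = bfact (m + s) / f4 by rewrite -r4 mulrC mulKf.
have ye : y ^+ (k + s) * y ^+ (m - (k + s)) = y ^+ k * y ^+ (m - k).
  by rewrite -!exprD; congr (_ ^+ _); lia.
transitivity (bfact m / (f4 * f3) * (bfact (m + s) / f1) * (bfact (m - s) / f2) *
   (y ^+ (k + s) * y ^+ (m - (k + s)))); first by ring.
by rewrite ye; field; rewrite f10 f20 f30 f40.
Qed.

End Wall.

Section Generic.
Variables (y : F) (e : nat -> F).
Hypothesis y_neq0 : y != 0.
Hypothesis y_generic : forall j, y ^+ 2 * p ^ j != 1.
Hypothesis esys : forall s, (0 < s <= m)%N ->
  \sum_(0 <= k < m.+1) e k * br ((y * p ^ ((m%:Z - 2 * k%:Z) * G%:Z)) ^+ s) = 0.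

Let gam j : F := br (y * p ^ (j * G%:Z)).
Let phi (k : nat) : F := y * p ^ ((m%:Z - 2 * k%:Z) * G%:Z).
Let w (k : nat) : F := phi k + (phi k)^-1.

Let gam_neq0 j : gam j != 0.
Proof.
rewrite /gam br_eq0 ?mulf_neq0 ?expfz_neq0 // exprMn [(p ^ _) ^+ 2]exprnP exprz_exp.
exact: y_generic.
Qed.

Let phi_neq0 k : phi k != 0.
Proof. by rewrite mulf_neq0 ?expfz_neq0. Qed.

(** The identity [(v u + 1/(v u)) - (v/u + u/v) = (u - 1/u) (v - 1/v)], where [v u] is [phi k] and
    [v / u] is [phi l]. *)
Let w_sub (k l : nat) : w k - w l = bq (l%:Z - k%:Z) * gam (m%:Z - k%:Z - l%:Z).
Proof.
pose u := p ^ ((l%:Z - k%:Z) * G%:Z); pose v := y * p ^ ((m%:Z - k%:Z - l%:Z) * G%:Z).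
have u0 : u != 0 by rewrite expfz_neq0.
have v0 : v != 0 by rewrite mulf_neq0 ?expfz_neq0.
have -> : w k = v * u + (v * u)^-1.
  by rewrite /w /phi /u /v -mulrA -expfzDr //; congr (_ * p ^ _ + (_ * p ^ _)^-1); ring.
have -> : w l = v / u + (v / u)^-1.
  rewrite /w /phi /u /v invr_expz -mulrA -expfzDr //.
  by congr (_ * p ^ _ + (_ * p ^ _)^-1); ring.
by rewrite /bq /gam -/u -/v /br; field; rewrite u0 v0.
Qed.

Let rest k : {poly F} :=
  \prod_(0 <= l < k) ('X - (w l)%:P) * \prod_(k.+1 <= l < m.+1) ('X - (w l)%:P).

Let rest_monic k : rest k \is monic.
Proof. by rewrite rpredM // monic_prod_XsubC. Qed.

Let rest_size k : (k <= m)%N -> size (rest k) = m.+1.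
Proof.
move=> km; rewrite size_monicM ?monic_prod_XsubC ?monic_neq0 ?monic_prod_XsubC //.
by rewrite !size_prod_XsubC !size_iota; lia.
Qed.

Let rest_root k l : (l <= m)%N -> l != k -> (rest k).[w l] = 0.
Proof.
move=> lm lk; apply/eqP; rewrite hornerM mulf_eq0 !horner_prod !prodf_seq_eq0.
have [lt|ge] := ltnP l k.
  by apply/orP; left; apply/hasP; exists l; rewrite ?mem_index_iota ?lt //= hornerXsubC subrr.
have gt : (k < l)%N by rewrite ltn_neqAle eq_sym lk.
apply/orP; right; apply/hasP; exists l; rewrite ?mem_index_iota ?gt ?ltnS //=.
by rewrite hornerXsubC subrr.
Qed.

(* Both [rest k] are monic of degree [m], so the functional
   [P |-> sum_l e_l (phi_l - phi_l^-1) P(w_l)], which kills polynomials of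
   smaller degree, takes the same value on them. *)
Let residue k : (k <= m)%N ->
  e k * br (phi k) * (rest k).[w k] = e 0 * br (phi 0) * (rest 0).[w 0].
Proof.
move=> km; have mom := bracket_moments phi_neq0 esys.
have sz : (size (rest k - rest 0)%R <= m)%N.
  have [->|ne] := eqVneq (rest k - rest 0) 0; first by rewrite size_poly0.
  have le : (size (rest k - rest 0)%R <= m.+1)%N.
    by apply: (leq_trans (size_polyD _ _)); rewrite size_polyN !rest_size // maxnn.
  rewrite -ltnS ltn_neqAle le andbT; apply/negP => /eqP E.
  move: ne; rewrite -lead_coef_eq0 lead_coefE E /= coefB.
  have c1 l : (l <= m)%N -> (rest l)`_m = 1.
    by move=> lm; have /monicP := rest_monic l; rewrite lead_coefE rest_size.
  by rewrite !c1 // subrr eqxx.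
have ev l : (l <= m)%N -> \sum_(0 <= k0 < m.+1) e k0 * br (phi k0) * (rest l).[w k0] =
    e l * br (phi l) * (rest l).[w l].
  move=> lm; rewrite (bigD1_seq l) ?mem_index_iota ?iota_uniq //=.
  rewrite big_seq_cond big1 ?addr0 // => k0; rewrite mem_index_iota => /andP[/andP[_ k0m] ne].
  by rewrite rest_root ?mulr0.
have := moments_horner mom sz.
under eq_bigr do rewrite hornerD hornerN mulrBr.
rewrite sumrB !ev // => /eqP; rewrite subr_eq0 => /eqP; exact.
Qed.

(** [residue] makes [e k * D k] independent of [k]; writing [D k] in brackets by [w_sub] shows the
    same of [D k * edge_coef k y]. As [D] does not vanish at generic [y], the two sequences are
    proportional. *)
Lemma edge_coefP k : (k <= m)%N -> e k * edge_coef 0 y = e 0 * edge_coef k y.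
Proof.
move=> km.
pose D k := br (phi k) * (rest k).[w k].
pose E := bfact m * (\prod_(0 <= j < m.+1) gam j%:Z *
  \prod_(1 <= j < m.+1) br (p ^ (j%:Z * G%:Z) / y)).
have bphi l : br (phi l) = gam (m%:Z - l%:Z - l%:Z) by rewrite /gam /phi; congr (br (_ * p ^ _)); ring.
have restE l : (rest l).[w l] =
    (\prod_(0 <= j < l) bq (j%:Z - l%:Z) * \prod_(l.+1 <= j < m.+1) bq (j%:Z - l%:Z)) *
    (\prod_(0 <= j < l) gam (m%:Z - l%:Z - j%:Z) *
     \prod_(l.+1 <= j < m.+1) gam (m%:Z - l%:Z - j%:Z)).
  rewrite hornerM !horner_prod mulrACA -!big_split /=.
  by congr (_ * _); apply: eq_bigr => j _; rewrite hornerXsubC w_sub.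
have nE (j : nat) : gam (- j%:Z) = - br (p ^ (j%:Z * G%:Z) / y).
  by rewrite -brV invf_div /gam mulNr -invr_expz.
have DE l : (l <= m)%N -> D l * edge_coef l y = E.
  move=> lm; rewrite /D /E /edge_coef restE bphi.
  have -> : \prod_(0 <= j < l) bq (j%:Z - l%:Z) = (-1) ^+ l * bfact l.
    have sc := prod_nat_scale (-1 : F) 0%N l (fun j : nat => bq j.+1%:Z).
    rewrite big_nat_rev /= /bfact big_add1 /=; rewrite subn0 in sc; rewrite -sc.
    by apply: eq_big_nat => j jl; rewrite mulN1r -bqN; congr bq; lia.
  have -> : \prod_(l.+1 <= j < m.+1) bq (j%:Z - l%:Z) = bfact (m - l).
    have := bfact_range_sub lm (leqnn l).
    by rewrite subnn [bfact 0]big_geq // mul1r.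
  (* [br (phi l)] fills the gap at [j = l], so the arguments of [gam] run through all integers from
     [m - l] down to [- l]; the negative ones turn into brackets in [1 / y], with a sign each. *)
  have gs : gam (m%:Z - l%:Z - l%:Z) * (\prod_(0 <= j < l) gam (m%:Z - l%:Z - j%:Z) *
     \prod_(l.+1 <= j < m.+1) gam (m%:Z - l%:Z - j%:Z)) =
     \prod_(0 <= j < m.+1) gam (m%:Z - l%:Z - j%:Z).
    have lm1 : (l <= m.+1)%N by lia.
    rewrite [RHS](big_cat_nat _ lm1) //=.
    by rewrite (big_ltn (m := l)) ?ltnS // mulrCA.
  have gs2 : \prod_(0 <= j < m.+1) gam (m%:Z - l%:Z - j%:Z) =
     \prod_(0 <= j < (m - l).+1) gam j%:Z *
     ((-1) ^+ l * \prod_(1 <= j < l.+1) br (p ^ (j%:Z * G%:Z) / y)).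
    have lm1 : ((m - l).+1 <= m.+1)%N by lia.
    rewrite (big_cat_nat _ lm1) //=.
    congr (_ * _).
      by rewrite big_nat_rev /=; apply: eq_big_nat => j jl; congr gam; lia.
    have -> : (m - l).+1 = (1 + (m - l))%N by lia.
    have {1}-> : m.+1 = (l.+1 + (m - l))%N by lia.
    have sc := prod_nat_scale (-1 : F) 1%N l.+1 (fun j : nat => br (p ^ (j%:Z * G%:Z) / y)).
    rewrite big_addn addnK; rewrite subn1 /= in sc; rewrite -sc.
    by apply: eq_big_nat => j jl; rewrite mulN1r -nE; congr gam; lia.
  have -> : \prod_(0 <= j < m.+1) gam j%:Z = \prod_(0 <= j < (m - l).+1) gam j%:Z *
     \prod_((m - l).+1 <= j < m.+1) gam j%:Z.
    by rewrite -big_cat_nat //; lia.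
  have -> : \prod_(1 <= j < m.+1) br (p ^ (j%:Z * G%:Z) / y) =
     \prod_(1 <= j < l.+1) br (p ^ (j%:Z * G%:Z) / y) *
     \prod_(l.+1 <= j < m.+1) br (p ^ (j%:Z * G%:Z) / y).
    by rewrite -big_cat_nat.
  rewrite [gam _ * (_ * _)]mulrCA gs gs2 /gam; move: (bfact_neq0 l) (bfact_neq0 (m - l)) => f1 f2.
  have sgn : (-1) ^+ l * (-1) ^+ l = 1 :> F by rewrite -exprMn mulrNN mulr1 expr1n.
  set P1 := \prod_(0 <= _ < _) _; set P2 := \prod_(1 <= _ < _) _.
  set P3 := \prod_(_ <= _ < _) br (y * _); set P4 := \prod_(_ <= _ < _) br (_ / y).
  transitivity (((-1) ^+ l * (-1) ^+ l) * (bfact m * (P1 * P3 * (P2 * P4)))); last by rewrite sgn mul1r.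
  by field; rewrite f1 f2.
have D0 l : (l <= m)%N -> D l != 0.
  move=> lm; rewrite mulf_neq0 // ?bphi ?gam_neq0 // restE !mulf_neq0 //;
    rewrite prodf_seq_neq0; apply/allP => j; rewrite mem_index_iota => jr; rewrite /= ?gam_neq0 //;
    by apply: bq_neq0; lia.
have := residue km; rewrite -!mulrA -/(D k) -/(D 0) => r.
have h1 : e k * edge_coef 0 y * (D k * D 0) = e 0 * edge_coef k y * (D k * D 0).
  transitivity ((e k * D k) * (D 0 * edge_coef 0 y)); first by ring.
  by rewrite r !DE // -(DE k km); ring.
by apply: mulIf h1; rewrite mulf_neq0 ?D0.
Qed.

End Generic.
End EdgeString.

Local Open Scope classical_set_scope.
Local Open Scope ring_scope.
Local Open Scope complex_scope.

(** * Exponential sums *)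

Lemma horner_cvg (K : numFieldType) (T : Type) (F : set_system T) {FF : Filter F}
    (P : {poly K}) (h : T -> K) (l : K) :
  h @ F --> l -> (fun s => P.[h s]) @ F --> P.[l].
Proof.
move=> hl; elim/poly_ind: P => [|P c IH].
  by under eq_fun do rewrite horner0; rewrite horner0; apply: cvg_cst.
rewrite hornerMXaddC; under eq_fun do rewrite hornerMXaddC.
by apply: cvgD; [apply: cvgM|apply: cvg_cst].
Qed.

Section ComplexExp.
Variable R : realType.
Implicit Types (a b z : R[i]) (s t : R).

Lemma cexpD a b : cexp (a + b) = cexp a * cexp b.
Proof.
case: a b => [a1 a2] [b1 b2]; rewrite /cexp /= expRD cosD sinD.
by apply/eqP; rewrite eq_complex /=; apply/andP; split; apply/eqP; ring.
Qed.

Lemma cexp0 : cexp (0 : R[i]) = 1.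
Proof. by rewrite /cexp /= expR0 cos0 sin0 mul1r. Qed.

Lemma cexp_neq0 a : cexp a != 0.
Proof.
apply/eqP => E; have := cexpD a (- a).
by rewrite subrr cexp0 E mul0r => /eqP; rewrite oner_eq0.
Qed.

Lemma cexpN a : cexp (- a) = (cexp a)^-1.
Proof.
by apply: (mulfI (cexp_neq0 a)); rewrite -cexpD subrr cexp0 divff ?cexp_neq0.
Qed.

Lemma cexp_real s : cexp s%:C = (expR s)%:C.
Proof. by rewrite /cexp /= cos0 sin0 mulr1. Qed.

Lemma norm_cexp a : `|cexp a| = (expR (complex.Re a))%:C.
Proof.
rewrite /cexp normrM [`|cos _ +i* _|]normc_def /= cos2Dsin2 sqrtr1 mulr1.
by rewrite normc_def /= expr0n /= addr0 sqrtr_sqr ger0_norm ?expR_ge0.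
Qed.

Lemma cexp_eq1 z : cexp z = 1 -> complex.Re z = 0 /\ sin (complex.Im z) = 0.
Proof.
move=> E; have z0 : complex.Re z = 0.
  have := norm_cexp z; rewrite E normr1 => /(@complexI R 1); rewrite -[X in X = _]expR0.
  by move=> /expR_inj <-.
split=> //; move: E; rewrite /cexp z0 expR0 mul1r => /eqP; rewrite eq_complex /=.
by move=> /andP[_ /eqP].
Qed.

Lemma unit_circle_param (c s : R) : c ^+ 2 + s ^+ 2 = 1 ->
  exists t, cos t = c /\ sin t = s.
Proof.
move=> E; have c1 : -1 <= c <= 1 by apply/andP; split; nra.
have s2 : s ^+ 2 = 1 - c ^+ 2 by rewrite -E addrAC subrr add0r.
have [s0|s0] := leP 0 s.
  exists (acos c); rewrite acosK ?in_itv //= sin_acos // -s2 sqrtr_sqr ger0_norm //.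
exists (- acos c); rewrite cosN sinN acosK ?in_itv //= sin_acos // -s2 sqrtr_sqr.
by rewrite ltr0_norm // opprK.
Qed.

Lemma cexp_surj z : z != 0 -> exists a, cexp a = z.
Proof.
move=> z0; pose r := Num.sqrt (complex.Re z ^+ 2 + complex.Im z ^+ 2).
have nz : `|z| = r%:C by rewrite normc_def.
have r0 : 0 < r by rewrite -ltcR -nz normr_gt0.
have rE : r ^+ 2 = complex.Re z ^+ 2 + complex.Im z ^+ 2.
  by rewrite sqr_sqrtr // addr_ge0 // sqr_ge0.
have [|t [ct st]] := @unit_circle_param (complex.Re z / r) (complex.Im z / r).
  by rewrite !expr_div_n -mulrDl -rE divff // expf_neq0 // gt_eqF.
exists (ln r +i* t); rewrite /cexp /= lnK ?posrE // ct st.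
have -> : z = complex.Re z +i* complex.Im z by case: (z).
move: (complex.Re z) (complex.Im z) (r) r0 => x y r' r0 /=.
by apply/eqP; rewrite eq_complex /=; apply/andP; split; apply/eqP; field; rewrite gt_eqF.
Qed.

Lemma real_complex_continuous t : (fun s : R => s%:C : R[i]^o) @ t --> (t%:C : R[i]^o).
Proof.
apply/cvgrPdist_lt => e; rewrite ltcE /= => /andP[/eqP ie re].
near=> s.
rewrite -rmorphB normc_def /= expr0n /= addr0 sqrtr_sqr ltcE /= ie eqxx /=.
near: s.
have : (fun s : R => s) @ t --> t by apply: cvg_id.
by move/cvgrPdist_lt => /(_ (complex.Re e) re).
Unshelve. all: by end_near.
Qed.

Lemma cexp_line_continuous (w : R[i]) :
  (fun s : R => cexp (s%:C * w) : R[i]^o) @ (0 : R) --> (1 : R[i]^o).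
Proof.
have toC (f : R -> R) (l : R) : f @ (0 : R) --> l ->
    (fun s => (f s)%:C : R[i]^o) @ (0 : R) --> (l%:C : R[i]^o).
  by move=> fl; apply: (cvg_comp f (real_complex R) fl); exact: real_complex_continuous.
have lin (v : R) : (fun s : R => s * v) @ (0 : R) --> (0 : R).
  have h := @cvgM R R (nbhs (0 : R)) _ id (fun _ => v) 0 v cvg_id (cvg_cst v).
  by rewrite mul0r in h; exact: h.
case: w => w1 w2.
have E s : cexp (s%:C * (w1 +i* w2)) =
    (expR (s * w1))%:C * ((cos (s * w2))%:C + 'i%C * (sin (s * w2))%:C).
  rewrite /cexp /= !mul0r subr0 addr0; congr (_ * _).
  by apply/eqP; rewrite eq_complex /=; apply/andP; split; apply/eqP; ring.
under eq_fun do rewrite E.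
have -> : (1 : R[i]^o) = (expR (0 : R))%:C * ((cos (0 : R))%:C + 'i%C * (sin (0 : R))%:C).
  by rewrite expR0 cos0 sin0 mulr0 addr0 mulr1.
apply: cvgM.
  apply: toC; apply: (cvg_comp (fun s : R => s * w1) (@expR R)); first exact: lin.
  exact: continuous_expR.
apply: cvgD.
  apply: toC; apply: (cvg_comp (fun s : R => s * w2) (@cos R)); first exact: lin.
  exact: continuous_cos.
apply: cvgM; first exact: cvg_cst.
apply: toC; apply: (cvg_comp (fun s : R => s * w2) (@sin R)); first exact: lin.
exact: continuous_sin.
Qed.

Lemma eq0_of_punctured (G : R -> R[i]^o) (l : R[i]^o) :
  G @ (0 : R) --> l -> (forall s, s != 0 -> G s = 0) -> l = 0.
Proof.
move=> Gl G0.
have h : (fun n => G (harmonic n)) @ \oo --> l.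
  exact: (cvg_comp (@harmonic R) G cvg_harmonic Gl).
have E : (fun n => G (harmonic n)) = (fun _ => 0).
  by apply/funext => n; apply: G0; rewrite /= invr_eq0 pnatr_eq0.
rewrite E in h; have := @cvg_unique _ (@norm_hausdorff R[i] R[i]^o) _ _ _ _ h.
by apply; apply: cvg_cst.
Qed.

End ComplexExp.

Opaque cexp.

Lemma sum_pred1_seq (T : zmodType) (I : eqType) (s : seq I) (i : I) (f : I -> T) :
  uniq s -> i \in s -> \sum_(j <- s | j == i) f j = f i.
Proof.
move=> us si; rewrite (big_rem i) //= eqxx big_seq_cond big1 ?addr0 // => j.
by rewrite mem_rem_uniq // inE => /andP[/andP[/negbTE ->]].
Qed.

Lemma sum_eq_support (T : zmodType) (I : eqType) (s s' : seq I) (f : I -> T) :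
  uniq s -> uniq s' -> (forall i, f i != 0 -> i \in s) -> (forall i, f i != 0 -> i \in s') ->
  \sum_(i <- s) f i = \sum_(i <- s') f i.
Proof.
move=> us us' fs fs'; rewrite (bigID (mem s')) [RHS](bigID (mem s)) /=.
have H (s1 s2 : seq I) : (forall i, f i != 0 -> i \in s2) -> \sum_(i <- s1 | i \notin s2) f i = 0.
  by move=> fs2; apply: big1 => i; apply: contraNeq => /fs2.
rewrite (H s s' fs') (H s' s fs) !addr0 -big_filter -[RHS]big_filter.
apply: perm_big; apply: uniq_perm.
- exact: filter_uniq.
- exact: filter_uniq.
- by move=> i; rewrite !mem_filter andbC.
Qed.

Lemma sum_by_key (T : zmodType) (I J : eqType) (s : seq I) (h : I -> J) (f : I -> T) :
  \sum_(k <- undup [seq h i | i <- s]) \sum_(i <- s | h i == k) f i = \sum_(i <- s) f i.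
Proof.
rewrite (exchange_big_dep predT) //= [LHS]big_seq [RHS]big_seq; apply: eq_bigr => i si.
under eq_bigl do rewrite eq_sym.
by rewrite sum_pred1_seq ?undup_uniq // mem_undup map_f.
Qed.

Section QPow.
Variables (R : realType) (lq : R[i]).
Local Notation C := R[i].
Local Notation qp := (qpow lq).
Implicit Types (a b : C).

Lemma qpowD a b : qp (a + b) = qp a * qp b.
Proof. by rewrite /qpow mulrDl cexpD. Qed.

Lemma qpow0 : qp 0 = 1.
Proof. by rewrite /qpow mul0r cexp0. Qed.

Lemma qpow_neq0 a : qp a != 0.
Proof. exact: cexp_neq0. Qed.

Lemma qpowN a : qp (- a) = (qp a)^-1.
Proof. by rewrite /qpow mulNr cexpN. Qed.

Lemma qpow_nat (k : nat) a : qp (k%:R * a) = qp a ^+ k.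
Proof.
elim: k => [|k IH]; first by rewrite mul0r qpow0.
by rewrite -natr1 mulrDl mul1r qpowD IH exprSr.
Qed.

Lemma qpow_int (k : int) a : qp (k%:~R * a) = qp a ^ k.
Proof.
case: k => k; first by rewrite qpow_nat.
by rewrite NegzE mulrNz mulNr qpowN qpow_nat -exprnN.
Qed.

Lemma qpow_surj z : lq != 0 -> z != 0 -> exists a, qp a = z.
Proof.
move=> l0 /cexp_surj[a <-]; exists (a / lq).
by rewrite /qpow mulfVK.
Qed.

Lemma qpow_line_continuous a b0 b1 :
  (fun s : R => qp (- ((a + s%:C * b0) * b1)) : C^o) @ (0 : R) --> (qp (- (a * b1)) : C^o).
Proof.
pose w := - b0 * b1 * lq.
have E (s : R) : qp (- ((a + s%:C * b0) * b1)) = qp (- (a * b1)) * cexp (s%:C * w).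
  by rewrite /qpow -cexpD; congr cexp; rewrite /w; ring.
under eq_fun do rewrite E.
have h := @cvgM R[i] R (nbhs (0 : R)) _ (fun _ => qp (- (a * b1))) _ _ 1
  (cvg_cst (qp (- (a * b1)) : R[i]^o)) (cexp_line_continuous w).
by rewrite mulr1 in h; exact: h.
Qed.

(** The exponents in [rho + P] may be half-integral, so the phases are integral powers of
    [q^(1/2)]. *)
Definition sqrtq : C := qp 2^-1.

Lemma sqrtq_neq0 : sqrtq != 0.
Proof. exact: qpow_neq0. Qed.

Lemma sqrtq_sqr : sqrtq ^+ 2 = qp 1.
Proof. by rewrite -qpow_nat divff // pnatr_eq0. Qed.

Lemma qpow_half_int (k : int) : qp (k%:~R / 2) = sqrtq ^ k.
Proof. by rewrite qpow_int. Qed.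

Lemma qpow_intr (k : int) : qp k%:~R = sqrtq ^ (2 * k).
Proof. by rewrite -qpow_half_int intrM mulrAC divff ?mul1r // pnatr_eq0. Qed.

Lemma sqrtq_nroot : (forall k : nat, (0 < k)%N -> cexp lq ^+ k != 1) ->
  forall j : int, j != 0 -> sqrtq ^ j != 1.
Proof.
move=> nr j j0; have E : sqrtq ^+ 2 = cexp lq by rewrite sqrtq_sqr /qpow mul1r.
have H (k : nat) : (0 < k)%N -> sqrtq ^+ k != 1.
  by move=> /nr; apply: contra_neq; rewrite -E exprAC => ->; rewrite expr1n.
case: j j0 => k k0; first by apply: H; rewrite lt0n.
by rewrite NegzE -invr_expz invr_eq1; apply: H.
Qed.

End QPow.

Section ExpSums.
Variables (R : realType) (N : nat) (lq : R[i]).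
Local Notation C := R[i].
Local Notation V := 'rV[int]_N.
Local Notation X_ := 'rV[R[i]]_N.
Local Notation qp := (qpow lq).
Local Notation p := (sqrtq lq).
Implicit Types (M K Z : V) (X Y : X_).
Hypothesis p_nroot : forall j : int, j != 0 -> p ^ j != 1.

(* [q^(M, X)]; since exponents are stored doubled, [q^(2 (nu, x))] is the value
   at [M = 2 nu]. *)
Definition qmon M X : C := qp (\sum_i (M 0 i)%:~R * X 0 i).

Definition intv Z : X_ := map_mx intr Z.

Lemma qmon_neq0 M X : qmon M X != 0.
Proof. exact: qpow_neq0. Qed.

Lemma qmonDl M M' X : qmon (M + M') X = qmon M X * qmon M' X.
Proof.
rewrite -qpowD -big_split; congr qpow; apply: eq_bigr => i _ /=.
by rewrite mxE intrD mulrDl.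
Qed.

Lemma qmonDr M X Y : qmon M (X + Y) = qmon M X * qmon M Y.
Proof.
rewrite -qpowD -big_split; congr qpow; apply: eq_bigr => i _ /=.
by rewrite mxE mulrDr.
Qed.

Lemma qmon0 X : qmon 0 X = 1.
Proof. by rewrite /qmon big1 ?qpow0 // => i _; rewrite mxE mul0r. Qed.

Lemma qmonZl (k : int) M X : qmon (k *: M) X = qmon M X ^ k.
Proof.
rewrite -qpow_int mulr_sumr; congr qpow; apply: eq_bigr => i _ /=.
by rewrite mxE intrM mulrA.
Qed.

Lemma qmonN M X : qmon (- M) X = (qmon M X)^-1.
Proof. by rewrite -scaleN1r qmonZl -invr_expz expr1z. Qed.

Lemma qmonZr (c : C) M X : qmon M (c *: X) = qp (c * \sum_i (M 0 i)%:~R * X 0 i).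
Proof.
rewrite mulr_sumr; congr qpow; apply: eq_bigr => i _ /=.
by rewrite mxE mulrCA.
Qed.

Lemma sum_intv M Z : \sum_i (M 0 i)%:~R * intv Z 0 i = (dotz M Z)%:~R.
Proof. by rewrite rmorph_sum; apply: eq_bigr => i _; rewrite mxE rmorphM. Qed.

Lemma qmon_intv M Z : qmon M (intv Z) = p ^ (2 * dotz M Z).
Proof. by rewrite /qmon sum_intv qpow_intr. Qed.

Lemma qmon_delta i X : qmon (delta_mx 0 i) X = qp (X 0 i).
Proof.
rewrite /qmon (bigD1 i) //= big1 ?addr0 => [|j ji]; last first.
  by rewrite mxE (negbTE ji) andbF mul0r.
by rewrite mxE !eqxx mul1r.
Qed.

Lemma qmon_direction M (t : C) Z : qmon M (t *: intv Z) = qp (t * (dotz M Z)%:~R).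
Proof. by rewrite qmonZr sum_intv. Qed.

(** Independence of characters: on the multiples of a [u] that separates the finitely many keys they
    become powers of distinct numbers, and Vandermonde applies. *)
Lemma exp_indep (B : seq V) (A : V -> C) (h : V -> V) :
  (forall Z, \sum_(K <- B) A K * p ^ (2 * dotz (h K) Z) = 0) ->
  forall ka, \sum_(K <- B | h K == ka) A K = 0.
Proof.
move=> H ka; pose B' := undup [seq h K | K <- B].
have [kB|kB] := boolP (ka \in B'); last first.
  rewrite big_seq_cond big1 // => K /andP[KB /eqP E]; case/negP: kB.
  by rewrite mem_undup -E map_f.
pose D := [seq d <- [seq k - k' | k <- B', k' <- B'] | d != 0].
have [|u uP] := @generic_functional N D.
  by move=> d; rewrite mem_filter => /andP[].
pose b k := \sum_(K <- B | h K == k) A K.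
pose w k := p ^ (2 * dotz k u).
apply: (@vandermonde_eq0 C _ B' b w) kB => [|k k' kB kB' /=|j _].
- exact: undup_uniq.
- rewrite /w => /(nroot_inj (sqrtq_neq0 lq) p_nroot) E; apply/eqP.
  rewrite -subr_eq0; apply/negP => /negP ne.
  have /uP : k - k' \in D by rewrite mem_filter ne; apply/allpairsP; exists (k, k').
  by rewrite dotzBr !(dotzC u) subr_eq0 => /eqP; apply; lia.
- rewrite -[RHS](H (j%:Z *: u)) /b.
  rewrite -[RHS](sum_by_key _ h); apply: eq_big_seq => k _.
  rewrite mulr_suml; apply: eq_bigr => K /eqP <-.
  rewrite /w dotzZr exprnP exprz_exp; congr (_ * _ ^ _); lia.
Qed.

Definition exp_sum (f : X_ -> C) : Prop :=
  exists l : seq (C * V), forall X, f X = \sum_(t <- l) t.1 * qmon t.2 X.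

Lemma exp_sum_ext f f' : f =1 f' -> exp_sum f -> exp_sum f'.
Proof. by move=> E [l fl]; exists l => X; rewrite -E. Qed.

Lemma exp_sum_cst c : exp_sum (fun _ => c).
Proof. by exists [:: (c, 0)] => X; rewrite big_seq1 qmon0 mulr1. Qed.

Lemma exp_sumD f f' : exp_sum f -> exp_sum f' -> exp_sum (fun X => f X + f' X).
Proof. by move=> [l fl] [l' fl']; exists (l ++ l') => X; rewrite big_cat fl fl'. Qed.

Lemma exp_sumM f f' : exp_sum f -> exp_sum f' -> exp_sum (fun X => f X * f' X).
Proof.
move=> [l fl] [l' fl']; exists [seq (t.1 * t'.1, t.2 + t'.2) | t <- l, t' <- l'] => X.
rewrite big_allpairs_dep /= fl fl' mulr_suml; apply: eq_bigr => t _.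
by rewrite mulr_sumr; apply: eq_bigr => t' _; rewrite qmonDl /=; ring.
Qed.

Lemma exp_sum_prod (J : Type) (s : seq J) (Q : pred J) (f : J -> X_ -> C) :
  (forall j, exp_sum (f j)) -> exp_sum (fun X => \prod_(j <- s | Q j) f j X).
Proof.
move=> fl; elim: s => [|j s IH].
  by apply: exp_sum_ext (exp_sum_cst 1) => X; rewrite big_nil.
case Qj : (Q j); last by apply: exp_sum_ext IH => X; rewrite big_cons Qj.
by apply: exp_sum_ext (exp_sumM (fl j) IH) => X; rewrite big_cons Qj.
Qed.

Lemma exp_sum_coef f : exp_sum f -> exists (A : V -> C) (B : seq V),
  [/\ uniq B, forall M, A M != 0 -> M \in B & forall X, f X = \sum_(M <- B) A M * qmon M X].
Proof.
move=> [l fl]; pose A M := \sum_(t <- l | t.2 == M) t.1.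
exists A, (undup [seq t.2 | t <- l]); split; first exact: undup_uniq.
  move=> M; apply: contraNT; rewrite mem_undup => nM; rewrite /A big_seq_cond big1 //.
  by move=> t /andP[tl /eqP E]; case/negP: nM; rewrite -E map_f.
move=> X; rewrite fl -(sum_by_key l (fun t => t.2)); apply: eq_big_seq => M _.
by rewrite mulr_suml; apply: eq_bigr => t /eqP ->.
Qed.

Lemma exp_sum_coef0 (B : seq V) (A : V -> C) X0 : uniq B ->
  (forall M, A M != 0 -> M \in B) ->
  (forall Z, \sum_(M <- B) A M * qmon M (X0 + intv Z) = 0) -> forall M, A M = 0.
Proof.
move=> uB AB H M; have [MB|/negP nM] := boolP (M \in B); last first.
  by apply/eqP; apply/negP => /negP /AB.
have := @exp_indep B (fun M => A M * qmon M X0) id _ M.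
rewrite sum_pred1_seq // => /(_ _)/eqP; rewrite mulf_eq0 (negbTE (qmon_neq0 _ _)) orbF.
move=> E; apply/eqP; apply: E => Z; rewrite -[RHS](H Z); apply: eq_bigr => K _.
by rewrite qmonDr qmon_intv mulrA.
Qed.

(** Distinct exponentials stay independent on any translate of the integer lattice, so an identity
    may be verified on a translate that avoids all degenerate points. *)
Lemma exp_sum_eq0 f X0 : exp_sum f -> (forall Z, f (X0 + intv Z) = 0) -> forall X, f X = 0.
Proof.
move=> /exp_sum_coef[A [B [uB AB fE]]] H X; rewrite fE big1 // => M _.
rewrite (@exp_sum_coef0 B A X0 uB AB) ?mul0r // => Z.
by rewrite -[RHS](H Z) fE.
Qed.

(* Along the direction [Y], [f] is a Laurent polynomial in [q^t] whose
   coefficients are combinations of fixed translates of [f]. *)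
Definition laurent_along (f : X_ -> C) Y : Prop :=
  exists l : seq (C * int * X_), forall X (t : C),
    f (X + t *: Y) = \sum_(e <- l) e.1.1 * qp (e.1.2%:~R * t) * f (X + e.2).

Lemma laurent_alongD f Y Y' :
  laurent_along f Y -> laurent_along f Y' -> laurent_along f (Y + Y').
Proof.
move=> [l fl] [l' fl'].
exists [seq (e.1.1 * e'.1.1, e.1.2 + e'.1.2, e.2 + e'.2) | e <- l, e' <- l'] => X t.
rewrite big_allpairs_dep /= scalerDr addrA addrAC fl.
apply: eq_bigr => e _; rewrite addrAC fl' mulr_sumr; apply: eq_bigr => e' _ /=.
by rewrite intrD mulrDl qpowD addrA; ring.
Qed.

(** The coefficients in [laurent_along] do not depend on [X], so the expansions in the coordinate
    directions can be applied in turn to the translates that the earlier ones produce. *)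
Lemma laurent_exp_sum f : (forall i, laurent_along f (delta_mx 0 i)) -> exp_sum f.
Proof.
move=> fl; suff H (s : seq 'I_N) : exists l : seq (C * V * X_), forall X Y,
    f (Y + \sum_(i <- s) X 0 i *: delta_mx 0 i) =
    \sum_(e <- l) e.1.1 * qmon e.1.2 X * f (Y + e.2).
  have [l lE] := H (index_enum 'I_N).
  exists [seq (e.1.1 * f (0 + e.2), e.1.2) | e <- l] => X.
  rewrite big_map {1}[X]row_sum_delta -[X in f X]add0r lE.
  by apply: eq_bigr => e _ /=; ring.
elim: s => [|i s [l IH]].
  exists [:: (1, 0, 0)] => X Y.
  by rewrite big_nil big_seq1 qmon0 !mul1r.
have [l' lE'] := fl i.
exists [seq (e'.1.1 * e.1.1, e'.1.2 *: delta_mx 0 i + e.1.2, e'.2 + e.2) | e' <- l', e <- l] => X Y.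
rewrite big_allpairs_dep /= big_cons addrCA addrC lE'; apply: eq_bigr => e' _.
rewrite addrAC IH mulr_sumr; apply: eq_bigr => e _ /=.
rewrite qmonDl qmonZl qmon_delta qpow_int.
by rewrite [Y + e'.2 + e.2]addrAC -addrA [e.2 + e'.2]addrC; ring.
Qed.

Definition line_continuous (f : X_ -> C) : Prop := forall X Y,
  (fun s : R => f (X + s%:C *: Y) : C^o) @ (0 : R) --> (f X : C^o).

End ExpSums.

(** * Degree bounds and interpolation *)

Section PolyAux.
Variable F : fieldType.

Lemma size_sign_mul (b : bool) (P : {poly F}) : size ((-1) ^+ b * P) = size P.
Proof. by rewrite mulr_sign; case: b; rewrite ?size_polyN. Qed.

Lemma size_det_le n d (A : 'M[{poly F}]_n) :
  (forall i j, (size (A i j) <= d.+1)%N) -> (size (\det A) <= (n * d).+1)%N.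
Proof.
move=> sA; apply: (leq_trans (size_sum _ _ _)); apply/bigmax_leqP => s _.
rewrite size_sign_mul; apply: (leq_trans (size_prod_leq _ _)).
rewrite card_ord leq_subLR addnS ltnS.
apply: (@leq_trans (\sum_(i < n) d.+1)); first by apply: leq_sum => i _.
by rewrite sum_nat_const card_ord mulnS.
Qed.

Lemma size_adj_le n d (A : 'M[{poly F}]_n) i j :
  (forall i j, (size (A i j) <= d.+1)%N) -> (size (\adj A i j) <= (n * d).+1)%N.
Proof.
move=> sA; rewrite mxE /cofactor -signr_odd size_sign_mul.
apply: (@leq_trans (n.-1 * d).+1); last by rewrite ltnS leq_mul2r leq_pred orbT.
by apply: size_det_le => k l; rewrite !mxE.
Qed.

Lemma lagrange_interpolation (n : nat) (w : 'I_n -> F) : injective w ->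
  exists L : 'I_n -> {poly F}, forall P : {poly F}, (size P <= n)%N ->
    P = \sum_l P.[w l] *: L l.
Proof.
move=> wi; pose L l := \prod_(j < n | j != l) ((w l - w j)^-1 *: ('X - (w j)%:P)).
have Ll l : (L l).[w l] = 1.
  rewrite horner_prod big1 // => j jl; rewrite !hornerE mulVf // subr_eq0.
  by apply: contraNneq jl => /wi ->.
have Lk l k : k != l -> (L l).[w k] = 0.
  move=> kl; rewrite horner_prod (bigD1 k) //=.
  by rewrite !hornerE subrr mulr0 mul0r.
have sL l : (size (L l) <= n)%N.
  apply: (leq_trans (size_prod_leq _ _)); rewrite leq_subLR.
  apply: (@leq_trans (\sum_(j < n | j != l) 2).+1).
    rewrite ltnS; apply: leq_sum => j _.
    by apply: (leq_trans (size_scale_leq _ _)); rewrite size_XsubC.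
  rewrite sum_nat_const muln2 -addnn -addnS leq_add2l.
  by rewrite cardC1 card_ord prednK // (leq_ltn_trans _ (ltn_ord l)).
exists L => P sP; apply/eqP; rewrite -subr_eq0; apply/eqP.
apply: (@roots_geq_poly_eq0 _ _ [seq w l | l <- enum 'I_n]).
- apply/allP => x /mapP[k _ ->]; rewrite /root hornerD hornerN horner_sum (bigD1 k) //=.
  rewrite big1 => [|l lk]; last by rewrite hornerZ Lk ?mulr0 // eq_sym.
  by rewrite hornerZ Ll mulr1 addr0 subrr.
- by rewrite map_inj_uniq ?enum_uniq.
- rewrite size_map size_enum_ord; apply: (leq_trans (size_polyD _ _)).
  rewrite geq_max sP size_polyN; apply: (leq_trans (size_sum _ _ _)).
  by apply/bigmax_leqP => l _; apply: (leq_trans (size_scale_leq _ _)).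
Qed.

End PolyAux.

(** * Cancelling denominators along a line *)

Section Division.
Variables (R : realType) (lq : R[i]).
Local Notation C := R[i].
Local Notation qp := (qpow lq).
Hypothesis lq0 : lq != 0.

(** Roots of [Q] are removed one at a time. Each is nonzero, hence a value of [q^(-2 t)], so it is
    also a root of [P]; after division the identity persists at the points over that root by
    continuity of [f]. *)
Lemma exp_division (f : C -> C) (Q P : {poly C}) :
  (forall t b : C, (fun s : R => f (t + s%:C * b) : C^o) @ (0 : R) --> (f t : C^o)) ->
  Q.[0] != 0 ->
  (forall t, f t * Q.[qp (- 2 * t)] = P.[qp (- 2 * t)]) ->
  exists G : {poly C}, (size G <= size P)%N /\ forall t, f t = G.[qp (- 2 * t)].
Proof.
move=> fc; have [n] := ubnP (size Q); elim: n Q P => // n IH Q P sQ Q0 fE.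
have Qn0 : Q != 0 by apply: contraNneq Q0 => ->; rewrite horner0.
have [/eqP sQ1|sQ1] := boolP (size Q == 1%N).
  have /size_poly1P[c c0 Qc] : size Q == 1%N by rewrite sQ1.
  exists (c^-1 *: P); split; first exact: size_scale_leq.
  by move=> t; rewrite hornerZ -fE Qc hornerC mulrCA mulVf // mulr1.
have /closed_rootP[z] := sQ1.
have [z0|z0] := eqVneq z 0; first by rewrite z0 /root (negbTE Q0).
move=> /factor_theorem[Q1 QE].
have [t0 t0E] := qpow_surj lq0 z0.
have : root P z.
  have := fE (- t0 / 2); have -> : - 2 * (- t0 / 2) = t0 by field.
  by rewrite t0E QE !(hornerM, hornerXsubC) subrr !mulr0 => /esym/eqP.
move=> /factor_theorem[P1 PE].
have eE t : qp (- 2 * t) != z -> f t * Q1.[qp (- 2 * t)] = P1.[qp (- 2 * t)].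
  rewrite -subr_eq0 => ne; apply: (mulIf ne).
  by have := fE t; rewrite QE PE !(hornerM, hornerXsubC) mulrA.
have [||t|G [sG GE]] := IH Q1 P1.
- have Q10 : Q1 != 0 by apply: contraNneq Qn0; rewrite QE => ->; rewrite mul0r.
  by move: sQ; rewrite QE size_Mmonic ?monicXsubC // size_XsubC addn2.
- by apply: contraNneq Q0; rewrite QE !(hornerM, hornerXsubC) => ->; rewrite mul0r.
- have [E|/eE //] := eqVneq (qp (- 2 * t)) z.
  (* In the direction [1 / lq] the point [q^(-2 t)] moves along the ray through [z] and equals [z]
     only at [s = 0]. *)
  pose h (s : R) : C^o := z * (expR (- 2 * s))%:C.
  have hE (s : R) : qp (- 2 * (t + s%:C * lq^-1)) = h s.
    rewrite mulrDr qpowD E /h; congr (_ * _).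
    rewrite /qpow -cexp_real; congr cexp.
    by rewrite !rmorphM rmorphN rmorph_nat /= -!mulrA mulVf ?mulr1.
  have hc : h @ (0 : R) --> (z : C^o).
    have -> : z = z * (expR (- 2 * 0))%:C by rewrite mulr0 expR0 mulr1.
    rewrite /h.
    apply: cvgM; first exact: cvg_cst.
    apply: (cvg_comp (fun s : R => expR (- 2 * s)) (real_complex R)); last first.
      exact: real_complex_continuous.
    apply: (cvg_comp (fun s : R => - 2 * s) (@expR R)); last exact: continuous_expR.
    by apply: cvgM; [apply: cvg_cst|apply: cvg_id].
  apply/eqP; rewrite -subr_eq0; apply/eqP.
  apply: (@eq0_of_punctured R (fun s : R => f (t + s%:C * lq^-1) * Q1.[h s] - P1.[h s])).
    rewrite E; apply: cvgB; last exact: horner_cvg.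
    by apply: cvgM; [exact: fc|exact: horner_cvg].
  move=> s s0; rewrite -hE eE ?subrr // hE /h -subr_eq0 -{2}[z]mulr1 -mulrBr mulf_neq0 //.
  rewrite subr_eq0; apply/eqP => /(@complexI R)/eqP.
  rewrite -[X in _ == X](expR0 R) (inj_eq (@expR_inj R)) => /eqP E'.
  by case/eqP: s0; lra.
exists G; split=> //; apply: leq_trans sG _; rewrite PE.
have [->|P10] := eqVneq P1 0; first by rewrite size_poly0.
by rewrite size_Mmonic ?monicXsubC // size_XsubC addn2 /=.
Qed.

End Division.

Lemma horner_binomial (F : fieldType) (a b z : F) k :
  (a%:P - b *: 'X^k).[z] = a - b * z ^+ k.
Proof. by rewrite hornerD hornerN hornerZ hornerXn hornerC. Qed.

(** Divided by the power [(y * T) ^ e] of its dominant term, the bracket has the constant term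
    [G ^ e] and otherwise only [T ^ (- (2 * e))]. *)
Lemma bracket_dominant (F : fieldType) (y T G : F) (e : int) :
  G != 0 -> y != 0 -> T != 0 -> e = 1 \/ e = -1 ->
  G ^ e - y ^ (- (2 * e)) * G ^ (- e) * T ^ (- (2 * e)) =
  (y * T) ^ (- e) * e%:~R * (y * T * G - (y * T * G)^-1).
Proof.
move=> G0 y0 T0 [|] ->.
  have -> : y ^ (- (2 * 1)) = y ^- 2 by [].
  have -> : T ^ (- (2 * 1)) = T ^- 2 by [].
  by rewrite -!invr_expz !expr1z mulr1; field; rewrite G0 y0 T0.
have -> : y ^ (- (2 * -1)) = y ^+ 2 by [].
have -> : T ^ (- (2 * -1)) = T ^+ 2 by [].
by rewrite opprK !expr1z mulrN1z -invr_expz expr1z; field; rewrite G0 y0 T0.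
Qed.

(** * The coefficients as exponential sums *)

Section Coefficients.
Variables (R : realType) (N : nat) (lq : R[i]).
Variables (g : 'I_N -> nat) (mu : 'I_N -> 'I_N -> nat).
Local Notation C := R[i].
Local Notation V := 'rV[int]_N.
Local Notation X_ := 'rV[R[i]]_N.
Local Notation qp := (qpow lq).
Local Notation p := (sqrtq lq).
Local Notation qmon := (qmon lq).
Implicit Types (a b : 'I_N) (M K Z : V) (X Y : X_).

(* [q^(alpha_ab, x + nu)] for [K = 2 nu]. *)
Definition phase a b X K : C := qmon (alpha a b) X * p ^ gform g a b K.

Definition string_system (supp : seq V) (c : V -> X_ -> C) : Prop :=
  forall a b s ka X, (a < b)%N -> (0 < s <= mu a b)%N ->
  \sum_(K <- supp | key a b K == ka) c K X * br (phase a b X K ^+ s) = 0.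

(* The factor of the normalization attached to [alpha a b], as a function of
   [y = q^(alpha_ab, x)]. *)
Definition norm_factor a b (y : C) : C :=
  \prod_(1 <= l < (mu a b).+1) br (p ^ (l * (g a + g b))%:Z / y).

Definition norm_coef X : C :=
  \prod_(q : 'I_N * 'I_N | (q.1 < q.2)%N) norm_factor q.1 q.2 (qmon (alpha q.1 q.2) X).

Hypothesis lq0 : lq != 0.
Hypothesis p_nroot : forall j : int, j != 0 -> p ^ j != 1.
Hypothesis g_gt0 : forall i, (0 < g i)%N.

Variables (supp : seq V) (c : V -> X_ -> C).
Hypothesis usupp : uniq supp.
Hypothesis suppP : forall K, K \in supp <-> in_polytope mu K.
Hypothesis sysc : string_system supp c.
Hypothesis c_rho2 : forall X, c (rho2 mu) X = norm_coef X.
Hypothesis c_cont : forall K, line_continuous (c K).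
Hypothesis c_out : forall K, ~ in_polytope mu K -> forall X, c K X = 0.

Section Direction.
Variables (u : V).
Hypothesis ugen : forall a b, (a < b)%N -> u 0 a != u 0 b.

Let sg a b : int := sgz (u 0 a - u 0 b).
Let wd a b : nat := absz (u 0 a - u 0 b)%R.

Let sgE a b : (a < b)%N -> sg a b = 1 \/ sg a b = -1.
Proof. by move=> /ugen; rewrite /sg -subr_eq0; case: sgzP => // _ _; [left|right]. Qed.

Let sg_wd a b : sg a b * (u 0 a - u 0 b) = (wd a b)%:Z.
Proof.
rewrite /sg /wd; move: (u 0 a - u 0 b) => w.
by have [w0|w0|->] := ltgtP w 0; rewrite ?sgz0 ?mul0r // ?(ltr0_sgz w0) ?(gtr0_sgz w0); lia.
Qed.

(** The degree bound has to be uniform in [X], because [coef_laurent_along] interpolates with a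
    fixed number of nodes. *)
Lemma norm_coef_along : exists d, forall X, exists P : {poly C}, (size P <= d)%N /\
  forall t, norm_coef (X + t *: intv R u) = qp (t * (width mu u)%:~R) * P.[qp (- 2 * t)].
Proof.
pose good (h : C -> C) (w : int) (d : nat) := exists P : {poly C},
  (size P <= d.+1)%N /\ forall t, h t = qp (t * w%:~R) * P.[qp (- 2 * t)].
have goodM h w d h' w' d' : good h w d -> good h' w' d' ->
    good (fun t => h t * h' t) (w + w') (d + d')%N.
  move=> [P [sP hP]] [P' [sP' hP']]; exists (P * P'); split.
    by apply: (leq_trans (size_polyMleq _ _)); lia.
  by move=> t; rewrite hP hP' hornerM intrD mulrDr qpowD mulrACA.
have good1 : good (fun _ => 1) 0 0%N.
  by exists 1; split=> [|t]; rewrite ?size_poly1 // mulr0 qpow0 hornerC mul1r.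
have goodB a b (z y : C) : (a < b)%N -> z != 0 -> y != 0 ->
    good (fun t => br (z / (y * qp (t * (u 0 a - u 0 b)%:~R)))) (wd a b)%:Z (wd a b).
  move=> ab z0 y0; set w := u 0 a - u 0 b.
  exists (if 0 < w then (z / y) *: 'X^(wd a b) - (y / z)%:P
          else (z / y)%:P - (y / z) *: 'X^(wd a b)).
  have sz (k k' : C) : (size (k *: 'X^(wd a b) - k'%:P)%R <= (wd a b).+1)%N.
    apply: (leq_trans (size_polyD _ _)); rewrite geq_max size_polyN.
    rewrite (leq_trans (size_scale_leq _ _)) ?size_polyXn //.
    exact: leq_trans (size_polyC_leq1 _) _.
  split=> [|t]; first by case: ifP => _; rewrite // -opprB size_polyN sz.
  set T := qp (t * w%:~R).
  have T0 : T != 0 by exact: qpow_neq0.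
  have SE : qp (- 2 * t) ^+ wd a b = if 0 < w then T ^- 2 else T ^+ 2.
    rewrite -qpow_nat -!qpow_nat -qpowN; case: ifP => w0; congr qpow.
      have -> : (wd a b)%:R = w%:~R :> C by rewrite -[LHS]/((wd a b)%:Z%:~R) /wd gtz0_abs.
      by rewrite /T; ring.
    have -> : (wd a b)%:R = - w%:~R :> C.
      rewrite -rmorphN -[LHS]/((wd a b)%:Z%:~R); congr (_%:~R).
      by rewrite /wd -/w; lia.
    by ring.
  have -> : qp (t * (wd a b)%:Z%:~R) = if 0 < w then T else T^-1.
    case: ifP => w0; first by rewrite /wd gtz0_abs.
    rewrite -qpowN -mulrN -rmorphN; congr (qpow _ (_ * _%:~R)).
    by rewrite /wd -/w; lia.
  by rewrite /br; case: ifP SE => _ SE; rewrite !(hornerD, hornerN, hornerZ, hornerXn, hornerC) SE;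
    clearbody T; field; rewrite ?z0 ?y0 ?T0.
pose dF a b := (mu a b * wd a b)%N.
have goodF a b y : (a < b)%N -> y != 0 ->
    good (fun t => norm_factor a b (y * qp (t * (u 0 a - u 0 b)%:~R)))
      ((mu a b)%:Z * (wd a b)%:Z) (dF a b).
  move=> ab y0; rewrite /norm_factor /dF; elim: (mu a b) => [|k IH].
    by rewrite mul0r mul0n; case: good1 => P [sP hP]; exists P; split=> // t; rewrite big_nil -hP.
  have := goodM _ _ _ _ _ _ IH (goodB a b (p ^ (k.+1 * (g a + g b))%:Z) y ab
     (expfz_neq0 _ (sqrtq_neq0 lq)) y0).
  case=> P [sP hP]; exists P; split=> [|t]; first by rewrite mulSnr.
  have -> : k.+1%:Z * (wd a b)%:Z = k%:Z * (wd a b)%:Z + (wd a b)%:Z by lia.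
  by rewrite -hP big_nat_recr.
exists (\sum_(q : 'I_N * 'I_N | (q.1 < q.2)%N) dF q.1 q.2).+1 => X.
suff [P [sP hP]] : good (fun t => norm_coef (X + t *: intv R u)) (width mu u)
    (\sum_(q : 'I_N * 'I_N | (q.1 < q.2)%N) dF q.1 q.2)%N.
  by exists P.
rewrite /norm_coef /width; elim: (index_enum _) => [|q s IH].
  by rewrite !big_nil; case: good1 => P [sP hP]; exists P; split=> // t; rewrite big_nil -hP.
rewrite !big_cons; case: ifP => [lt|nlt]; last first.
  by case: IH => P [sP hP]; exists P; split=> // t; rewrite big_cons nlt hP.
have := goodM _ _ _ _ _ _ (goodF q.1 q.2 _ lt (qmon_neq0 lq (alpha q.1 q.2) X)) IH.
case=> P [sP hP]; exists P; split=> [|t]; first by [].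
by rewrite big_cons lt qmonDr qmon_direction dotzC dotz_alpha hP -abszE.
Qed.

Let n := size supp.
Let D := (\sum_(q : 'I_N * 'I_N) mu q.1 q.2).+1.
Let el (k : 'I_n) : V := nth 0 supp k.

Let el_inj : injective el.
Proof. by move=> i j /eqP; rewrite nth_uniq ?ltn_ord // => /eqP/val_inj. Qed.

Let sum_el (f : V -> C) (Q : pred V) :
  \sum_(K <- supp | Q K) f K = \sum_(k < n | Q (el k)) f (el k).
Proof. by rewrite (big_nth 0) big_mkord. Qed.

(* The string conditions along [X + t u], each divided by its dominant power
   of [q^t] and written as polynomials in [q^(-2 t)]. *)
Let entry X (k : 'I_n) (tau : option ('I_N * 'I_N * 'I_n * 'I_D)) : {poly C} :=
  if tau is Some (a, b, l, s) then
    if [&& (a < b)%N, (0 < s <= mu a b)%N & key a b (el k) == key a b (el l)] then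
      (p ^ (sg a b * (s : nat)%:Z * gform g a b (el k)))%:P -
      (qmon (alpha a b) X ^ (- (2 * sg a b * (s : nat)%:Z)) *
       p ^ (- (sg a b * (s : nat)%:Z * gform g a b (el k)))) *: 'X^(s * wd a b)
    else 0
  else (el k == rho2 mu)%:R%:P.

Let A X : 'M[{poly C}]_(n, #|{: option ('I_N * 'I_N * 'I_n * 'I_D)}|) :=
  \matrix_(k, j) entry X k (enum_val j).

Let cvec X (t : C) : 'rV[C]_n := \row_k c (el k) (X + t *: intv R u).

(** At [q^(-2 t) = 0] only dominant terms survive; they form the limit system of the chamber of [u],
    and the column [None] adds the equation at [rho2]. *)
Let row_free_A X : row_free (map_mx (horner^~ 0) (A X)).
Proof.
apply: inj_row_free => v vA.
pose f K := \sum_(k < n | el k == K) v 0 k.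
have fE k : f (el k) = v 0 k.
  by rewrite /f (big_pred1 k) // => l; rewrite (inj_eq el_inj).
have vA' tau : \sum_k v 0 k * (entry X k tau).[0] = 0.
  move/rowP: vA => /(_ (enum_rank tau)); rewrite !mxE => E; rewrite -[RHS]E.
  by apply: eq_bigr => k _; rewrite !mxE enum_rankK.
suff f0 K : f K = 0 by apply/rowP => k; rewrite -fE f0 mxE.
move: K; apply: (limit_system_eq0 g_gt0 (sqrtq_neq0 lq) p_nroot usupp
    (fun K => proj2 (suppP K)) (eps := fun a b => if (a < b)%N then sg a b else 1)).
- move=> K; apply: contra_neqP => nS; rewrite /f big1 // => k /eqP E.
  by case: nS; rewrite -E; apply/suppP; apply: mem_nth.
- by move=> a b; case: ifP => [/sgE //|_]; left.
- move=> a b s ka ab sm; rewrite ab sum_el.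
  have [[l Kl]|nl] := pselect (exists l, key a b (el l) = ka); last first.
    by rewrite big1 // => k /eqP E; case: nl; exists k.
  have sD : (s < D)%N.
    rewrite ltnS; apply: (leq_trans (proj2 (andP sm))).
    by rewrite (bigD1 (a, b)) //= leq_addr.
  rewrite -[RHS](vA' (Some (a, b, l, Ordinal sD))) big_mkcond /=; apply: eq_bigr => k _.
  rewrite ab sm Kl /=; case: ifP => _; last by rewrite horner0 mulr0.
  have w0 : (0 < wd a b)%N by rewrite /wd absz_gt0 subr_eq0 ugen.
  have sw0 : (0 < s * wd a b)%N by rewrite muln_gt0 w0 andbT; case/andP: sm.
  by rewrite horner_binomial expr0n gtn_eqF // mulr0 subr0 fE.
- have := vA' None => /= E; rewrite -[RHS]E /f big_mkcond /=; apply: eq_bigr => k _.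
  by rewrite hornerC; case: eqP => _; rewrite ?mulr1 ?mulr0.
Qed.

Let cvec_entry X t tau : \sum_k cvec X t 0 k * (entry X k tau).[qp (- 2 * t)] =
  if tau is None then c (rho2 mu) (X + t *: intv R u) else 0.
Proof.
case: tau => [[[[a b] l] s]|] /=; last first.
  have /(nthP 0)[i lti Ei] : rho2 mu \in supp by apply/suppP/rho2_in_polytope.
  rewrite (bigD1 (Ordinal lti)) //= big1 => [|k kl].
    by rewrite /cvec mxE /el Ei eqxx hornerC mulr1 addr0.
  rewrite hornerC; case: eqP => [E|]; last by rewrite mulr0.
  by case/eqP: kl; apply: el_inj; rewrite E -Ei.
have [/and3P[ab sm _]|cond] := boolP [&& (a < b)%N, (0 < s <= mu a b)%N & true]; last first.
  rewrite big1 // => k _; rewrite ifF ?horner0 ?mulr0 //.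
  by apply: contraNF cond => /and3P[-> -> _].
have := sysc (key a b (el l)) (X + t *: intv R u) ab sm; rewrite sum_el => E.
set y := qmon (alpha a b) X; set T := qp (t * (u 0 a - u 0 b)%:~R).
have y0 : y != 0 by exact: qmon_neq0.
have T0 : T != 0 by exact: qpow_neq0.
have SE : qp (- 2 * t) ^+ (s * wd a b) = (T ^+ s) ^ (- (2 * sg a b)).
  rewrite -qpow_nat exprnP exprz_exp -qpow_int; congr qpow.
  rewrite natrM -[(wd a b)%:R]/((wd a b)%:Z%:~R) -sg_wd.
  rewrite !(rmorphM, rmorphN) /= -[s%:Z%:~R]/(s%:R).
  by move: (_%:~R) => sgab; ring.
transitivity ((y * T) ^ (- (sg a b * (s : nat)%:Z)) * (sg a b)%:~R * 0); last by rewrite mulr0.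
rewrite -[X in _ = _ * X]E mulr_sumr [RHS]big_mkcond /=; apply: eq_bigr => k _.
rewrite ab sm /=; case: ifP => _; last by rewrite horner0 mulr0.
rewrite horner_binomial mxE mulrCA; congr (_ * _).
rewrite SE /phase qmonDr qmon_direction dotzC dotz_alpha -/y -/T /br.
set G := p ^ gform g a b (el k).
have G0 : G != 0 by rewrite expfz_neq0 // sqrtq_neq0.
have -> : p ^ (sg a b * (s : nat)%:Z * gform g a b (el k)) = (G ^+ s) ^ sg a b.
  by rewrite exprnP !exprz_exp; congr (_ ^ _); ring.
have -> : p ^ (- (sg a b * (s : nat)%:Z * gform g a b (el k))) = (G ^+ s) ^ (- sg a b).
  by rewrite exprnP !exprz_exp; congr (_ ^ _); ring.
have -> : y ^ (- (2 * sg a b * (s : nat)%:Z)) = (y ^+ s) ^ (- (2 * sg a b)).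
  by rewrite exprnP !exprz_exp; congr (_ ^ _); ring.
have -> : (y * T) ^ (- (sg a b * (s : nat)%:Z)) = (y ^+ s * T ^+ s) ^ (- sg a b).
  by rewrite -exprMn exprnP !exprz_exp; congr (_ ^ _); ring.
clearbody G y T; rewrite !exprMn.
apply: bracket_dominant (sgE ab); exact: expf_neq0.
Qed.

Let entry_size : exists d, forall X k tau, (size (entry X k tau) <= d.+1)%N.
Proof.
exists (D * \sum_(q : 'I_N * 'I_N) wd q.1 q.2)%N => X k [[[[a b] l] s]|] /=; last first.
  exact: leq_trans (size_polyC_leq1 _) _.
case: ifP => _; last by rewrite size_poly0.
apply: (leq_trans (size_polyD _ _)); rewrite geq_max size_polyN.
rewrite (leq_trans (size_polyC_leq1 _)) //=.
apply: (leq_trans (size_scale_leq _ _)); rewrite size_polyXn ltnS leq_mul ?(ltnW (ltn_ord s)) //.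
by rewrite (bigD1 (a, b)) //= leq_addr.
Qed.

(* Cramer's rule: the linear system, made square by a left inverse of its
   value at [q^(-2 t) = 0], determines the coefficients rationally. *)
Let cramer : exists d, forall X k, exists Q P : {poly C}, [/\ Q.[0] != 0, (size P <= d)%N &
  forall t, c (el k) (X + t *: intv R u) * Q.[qp (- 2 * t)] =
            c (rho2 mu) (X + t *: intv R u) * P.[qp (- 2 * t)]].
Proof.
have [d sd] := entry_size; exists (n * d).+1 => X k.
have /row_freeP[B AB] := row_free_A X.
pose G := A X *m map_mx polyC B.
have sG i j : (size (G i j) <= d.+1)%N.
  rewrite mxE; apply: (leq_trans (size_sum _ _ _)); apply/bigmax_leqP => l _.
  rewrite !mxE mulrC mul_polyC; apply: (leq_trans (size_scale_leq _ _)).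
  exact: sd.
have evG z : map_mx (horner^~ z) G = map_mx (horner^~ z) (A X) *m B.
  apply/matrixP => i j; rewrite !mxE horner_sum; apply: eq_bigr => l _.
  by rewrite hornerM !mxE hornerC.
have evdet z (M : 'M[{poly C}]_n) : (\det M).[z] = \det (map_mx (horner^~ z) M).
  exact: (esym (det_map_mx (horner_eval z) M)).
pose e : 'rV[C]_#|{: option ('I_N * 'I_N * 'I_n * 'I_D)}| :=
  \row_j (enum_val j == None)%:R.
exists (\det G), ((map_mx polyC (e *m B) *m \adj G) 0 k); split.
- by rewrite evdet evG AB det1 oner_eq0.
- rewrite mxE; apply: (leq_trans (size_sum _ _ _)); apply/bigmax_leqP => l _.
  rewrite mxE mul_polyC; apply: (leq_trans (size_scale_leq _ _)).
  exact: size_adj_le.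
move=> t; set z := qp _.
have cA : cvec X t *m map_mx (horner^~ z) (A X) = c (rho2 mu) (X + t *: intv R u) *: e.
  apply/rowP => j; rewrite mxE.
  transitivity (\sum_k cvec X t 0 k * (entry X k (enum_val j)).[z]).
    by apply: eq_bigr => l _; rewrite !mxE.
  rewrite cvec_entry !mxE; case: (enum_val j) => [tau|] /=; first by rewrite mulr0.
  by rewrite mulr1.
have cG : cvec X t *m map_mx (horner^~ z) G = c (rho2 mu) (X + t *: intv R u) *: (e *m B).
  by rewrite evG mulmxA cA -scalemxAl.
have := congr1 (fun M : 'rV[C]_n => M *m \adj (map_mx (horner^~ z) G)) cG.
rewrite -mulmxA mul_mx_adj mul_mx_scalar => /rowP/(_ k).
rewrite mxE [cvec _ _ _ _]mxE -evdet mulrC => ->.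
rewrite -scalemxAl mxE; congr (_ * _); rewrite mxE [in RHS]mxE horner_sum; apply: eq_bigr => l _.
rewrite hornerM [map_mx _ _ _ _]mxE hornerC; congr (_ * _).
by rewrite -(map_mx_adj (horner_eval z) G) mxE.
Qed.

(** Along the line [c K] is [q^(t H)] times a polynomial in [q^(-2 t)] of size at most [m],
    uniformly in [X]. Its values at [t = 0, ..., m - 1] determine it, and these are values of [c K]
    at the translates [X + l u]. *)
Lemma coef_laurent_along K : laurent_along lq (c K) (intv R u).
Proof.
have [KS|nS] := pselect (in_polytope mu K); last first.
  by exists [::] => X t; rewrite big_nil c_out.
have /(nthP 0)[i lti Ei] : K \in supp by apply/suppP.
have [d1 cr] := cramer; have [d2 nc] := norm_coef_along.
pose H : C := (width mu u)%:~R.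
pose m := (d1 + d2)%N.
have Gex X : exists G : {poly C}, (size G <= m)%N /\
    forall t, c K (X + t *: intv R u) = qp (t * H) * G.[qp (- 2 * t)].
  have [Q [P [Q0 sP QP]]] := cr X (Ordinal lti).
  have [P' [sP' P'E]] := nc X.
  have [|t|G [sG GE]] := @exp_division R lq lq0
      (fun t => qp (- (t * H)) * c K (X + t *: intv R u)) Q (P' * P) _ Q0.
  - move=> t b; apply: (@cvgM R[i] R (nbhs (0 : R))).
      exact: qpow_line_continuous.
    have := @c_cont K (X + t *: intv R u) (b *: intv R u).
    by apply: cvg_trans; apply: near_eq_cvg; near=> s;
      rewrite scalerDl addrA scalerA.
  - have := QP t; rewrite /el /= Ei c_rho2 P'E hornerM => E.
    rewrite -mulrA E -[X in _ * X]mulrA [LHS]mulrA /H.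
    by rewrite -(qpowD lq (- (t * _)) (t * _)) addNr qpow0 mul1r.
  exists G; split.
    apply: (leq_trans sG); apply: (leq_trans (size_polyMleq _ _)).
    by rewrite /m; lia.
  by move=> t; rewrite -GE mulrA -qpowD subrr qpow0 mul1r.
pose w (l : 'I_m) := qp (- 2 * (l : nat)%:R).
have winj : injective w.
  move=> l l' E; apply/val_inj => /=.
  have wE (j : 'I_m) : w j = p ^ (2 * - (2 * (j : nat)%:Z)).
    rewrite -qpow_intr /w; congr qpow; rewrite rmorphN rmorphM /=; ring.
  move: E; rewrite !wE => /(nroot_inj (sqrtq_neq0 lq) p_nroot); lia.
have [L LE] := lagrange_interpolation winj.
exists [seq ((L l)`_j * qp (- ((l : nat)%:R * H)), width mu u - 2 * (j : nat)%:Z,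
             (l : nat)%:R *: intv R u) | l <- enum 'I_m, j <- iota 0 (size (L l))] => X t.
have [G [sG GE]] := Gex X.
rewrite big_allpairs_dep /= GE {1}[G]LE // horner_sum mulr_sumr big_enum /=.
apply: eq_bigr => l _; rewrite hornerZ (horner_coef (L l)) mulr_sumr mulr_sumr.
rewrite -[in RHS](subn0 (size (L l))) -/(index_iota 0 _) big_mkord.
apply: eq_bigr => j _; rewrite GE -/(w l).
rewrite intrB mulrBl qpowD -qpow_nat (mulrC t H).
have -> : qp (- (((2 * (j : nat)%:Z)%:~R : C) * t)) = qp ((j : nat)%:R * (- 2 * t)).
  by congr qpow; rewrite intrM; ring.
rewrite (qpowN lq ((l : nat)%:R * H)); have := qpow_neq0 lq ((l : nat)%:R * H).
move: (qp _) (qp (H * t)) (qp _) G.[_] (L l)`_j => *.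
by field.
Unshelve. all: by end_near.
Qed.

End Direction.
Lemma intvD Z Z' : intv R (Z + Z') = intv R Z + intv R Z'.
Proof. by apply/rowP => i; rewrite !mxE intrD. Qed.

Lemma coef_exp_sum K : exp_sum lq (c K).
Proof.
apply: laurent_exp_sum => i; pose w : V := \row_j (2 * (j : nat)%:Z).
(* A coordinate direction has ties, so it is split into two directions without ties; the factor 2 in
   [w] keeps [w + delta_mx 0 i] free of them. *)
have -> : delta_mx 0 i = intv R (w + delta_mx 0 i) + intv R (- w).
  by rewrite -intvD addrAC subrr add0r; apply/rowP => j; rewrite !mxE; case: (_ && _).
apply: laurent_alongD; apply: coef_laurent_along => a b ab; rewrite !mxE.
  by case: (_ == i); case: (_ == i) => /=; lia.
by lia.
Qed.

Lemma coef_matrix : exists (A : V -> V -> C) (B : seq V),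
  [/\ uniq B, forall K M, A K M != 0 -> M \in B, forall K M, A K M != 0 -> in_polytope mu K &
      forall K X, c K X = \sum_(M <- B) A K M * qmon M X].
Proof.
have ex K : exists AB : (V -> C) * seq V, [/\ uniq AB.2, forall M, AB.1 M != 0 -> M \in AB.2,
    (forall M, AB.1 M != 0 -> in_polytope mu K) &
    forall X, c K X = \sum_(M <- AB.2) AB.1 M * qmon M X].
  have [KS|nS] := pselect (in_polytope mu K).
    by have [A [B [uB AB fE]]] := exp_sum_coef (coef_exp_sum K); exists (A, B).
  exists (fun _ => 0, [::]); split=> //= [M|M|X]; rewrite ?eqxx //.
  by rewrite big_nil c_out.
have [AB ABP] := choice ex.
exists (fun K => (AB K).1), (undup (flatten [seq (AB K).2 | K <- supp])).
have sB K M : (AB K).1 M != 0 -> M \in undup (flatten [seq (AB K).2 | K <- supp]).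
  have [_ sK pK _] := ABP K => ne; rewrite mem_undup; apply/flattenP; exists (AB K).2.
    by apply: map_f; apply/suppP; exact: pK ne.
  exact: sK.
split; [exact: undup_uniq|exact: sB|by move=> K M; case: (ABP K) => _ _ + _; apply|].
move=> K X; have [uK sK pK ->] := ABP K.
apply: sum_eq_support => // [|M|M]; first exact: undup_uniq.
- by rewrite mulf_eq0 negb_or => /andP[/sK].
- by rewrite mulf_eq0 negb_or => /andP[/sB].
Qed.

End Coefficients.

Lemma bracket_shift (F : fieldType) (z y P : F) s :
  P ^+ s * (z * y ^+ s) - (P ^+ s)^-1 * (z * (y ^+ s)^-1) = z * br ((y * P) ^+ s).
Proof. by rewrite /br exprMn invfM; ring. Qed.

(** * The linear system for the coefficient matrix *)

Section CoefficientMatrix.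
Variables (R : realType) (N : nat) (lq : R[i]).
Variables (g : 'I_N -> nat) (mu : 'I_N -> 'I_N -> nat).
Local Notation C := R[i].
Local Notation V := 'rV[int]_N.
Local Notation X_ := 'rV[R[i]]_N.
Local Notation qp := (qpow lq).
Local Notation p := (sqrtq lq).
Local Notation qmon := (qmon lq).
Implicit Types (a b : 'I_N) (M K Z : V) (X Y : X_).

(** Residues modulo 2 and support functions both add under multiplication, so the exponents of the
    normalization can be located factor by factor. *)
Definition bounded_exp (r : V) (W : V -> int) (f : X_ -> C) : Prop :=
  exists l : seq (C * V),
    (forall t, t \in l -> (exists k : V, t.2 = r + 2 *: k) /\ forall u, dotz u t.2 <= W u) /\
    forall X, f X = \sum_(t <- l) t.1 * qmon t.2 X.

Lemma bounded_exp1 : bounded_exp 0 (fun _ => 0) (fun _ => 1).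
Proof.
exists [:: (1, 0)]; split=> [t|X]; last by rewrite big_seq1 qmon0 mulr1.
rewrite inE => /eqP ->; split=> [|u]; last by rewrite dotz0r.
by exists 0; rewrite scaler0 addr0.
Qed.

Lemma bounded_expM r W f r' W' f' : bounded_exp r W f -> bounded_exp r' W' f' ->
  bounded_exp (r + r') (fun u => W u + W' u) (fun X => f X * f' X).
Proof.
move=> [l [lP fl]] [l' [lP' fl']].
exists [seq (t.1 * t'.1, t.2 + t'.2) | t <- l, t' <- l']; split.
  move=> _ /allpairsP[[t t'] /= [tl tl' ->]] /=.
  have [[k ->] b] := lP _ tl; have [[k' ->] b'] := lP' _ tl'; split.
    by exists (k + k'); rewrite scalerDr addrACA.
  by move=> u; rewrite dotzDr lerD.
move=> X; rewrite big_allpairs_dep /= fl fl' mulr_suml; apply: eq_bigr => t _.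
by rewrite mulr_sumr; apply: eq_bigr => t' _; rewrite qmonDl; ring.
Qed.

Lemma bounded_exp_ext r W f r' W' f' : r = r' -> W =1 W' -> f =1 f' ->
  bounded_exp r W f -> bounded_exp r' W' f'.
Proof.
move=> <- EW Ef [l [lP fl]]; exists l; split=> [t /lP[]|X]; last by rewrite -Ef.
by move=> h1 h2; split=> // u; rewrite -EW.
Qed.

Lemma bounded_exp_br (z : C) a b :
  bounded_exp (alpha a b) (fun u => `|u 0 a - u 0 b|) (fun X => br (z / qmon (alpha a b) X)).
Proof.
exists [:: (z, - alpha a b); (- z^-1, alpha a b)]; split=> [t|X].
  rewrite !inE => /orP[] /eqP -> /=.
    split=> [|u]; last by rewrite dotzNr dotz_alpha -normrN ler_norm.
    exists (- alpha a b); rewrite scalerN.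
    by apply/rowP => i; rewrite !mxE; ring.
  split=> [|u]; last by rewrite dotz_alpha ler_norm.
  by exists 0; rewrite scaler0 addr0.
rewrite big_cons big_seq1 /= -scaleN1r qmonZl -invr_expz expr1z /br.
by rewrite invf_div mulNr [_^-1 * _]mulrC.
Qed.

Lemma bounded_exp_norm_coef : bounded_exp (rho2 mu) (width mu) (norm_coef lq g mu).
Proof.
rewrite /rho2 /width /norm_coef.
have F a b : bounded_exp ((mu a b)%:Z *: alpha a b) (fun u => (mu a b)%:Z * `|u 0 a - u 0 b|)
    (fun X => norm_factor lq g mu a b (qmon (alpha a b) X)).
  rewrite /norm_factor; elim: (mu a b) => [|k IH].
    apply: bounded_exp_ext bounded_exp1 => [|u|X]; rewrite ?scale0r ?mul0r //.
    by rewrite big_nil.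
  have := bounded_expM IH (bounded_exp_br (p ^ (k.+1 * (g a + g b))%:Z) a b).
  apply: bounded_exp_ext => [|u|X].
  - by rewrite -[X in _ + X]scale1r -scalerDl; congr (_ *: _); lia.
  - by rewrite -[X in _ + X]mul1r -mulrDl; congr (_ * _); lia.
  - by rewrite [RHS]big_nat_recr.
elim: (index_enum _) => [|q s IH].
  by apply: bounded_exp_ext bounded_exp1 => [|u|X]; rewrite big_nil.
case: (boolP (q.1 < q.2)%N) => [lt|/negbTE nlt]; last first.
  by apply: bounded_exp_ext IH => [|u|X]; rewrite big_cons nlt.
by apply: bounded_exp_ext (bounded_expM (F q.1 q.2) IH) => [|u|X]; rewrite big_cons lt.
Qed.

Hypothesis p_nroot : forall j : int, j != 0 -> p ^ j != 1.
Hypothesis g_gt0 : forall i, (0 < g i)%N.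
Variables (supp : seq V) (c : V -> X_ -> C) (A : V -> V -> C) (B : seq V).
Hypothesis usupp : uniq supp.
Hypothesis suppP : forall K, K \in supp <-> in_polytope mu K.
Hypothesis sysc : string_system lq g mu supp c.
Hypothesis c_rho2 : forall X, c (rho2 mu) X = norm_coef lq g mu X.
Hypothesis uB : uniq B.
Hypothesis AB : forall K M, A K M != 0 -> M \in B.
Hypothesis AK : forall K M, A K M != 0 -> in_polytope mu K.
Hypothesis cE : forall K X, c K X = \sum_(M <- B) A K M * qmon M X.

(** The expanded product [norm_coef] has its exponents in the polytope, and uniqueness of
    exponential expansions transfers this to row [rho2] of [A]. *)
Lemma coef_rho2_polytope M : A (rho2 mu) M != 0 -> in_polytope mu M.
Proof.
have [l [lP lE]] := bounded_exp_norm_coef.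
pose A' M := \sum_(t <- l | t.2 == M) t.1.
pose B' := undup [seq t.2 | t <- l].
have A'B' M' : A' M' != 0 -> M' \in B'.
  apply: contraNT; rewrite mem_undup => nM; rewrite /A' big_seq_cond big1 //.
  by move=> t /andP[tl /eqP E]; case/negP: nM; rewrite -E map_f.
have A'E X : norm_coef lq g mu X = \sum_(M' <- B') A' M' * qmon M' X.
  rewrite lE -(sum_by_key l (fun t => t.2)); apply: eq_big_seq => M' _.
  by rewrite mulr_suml; apply: eq_bigr => t /eqP ->.
pose B2 := undup (B ++ B').
have uB2 : uniq B2 by exact: undup_uniq.
have inB2 M' : (M' \in B2) = (M' \in B) || (M' \in B') by rewrite mem_undup mem_cat.
have E0 M' : A (rho2 mu) M' - A' M' = 0.
  move: M'; apply: (exp_sum_coef0 (lq := lq) p_nroot (B := B2) (X0 := 0)) => // [M'|Z].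
    rewrite inB2; apply: contraNT; rewrite negb_or => /andP[nB nB'].
    rewrite subr_eq0; apply/eqP; transitivity (0 : C).
      by apply/eqP; apply: contraNT nB => /AB.
    by apply/esym/eqP; apply: contraNT nB' => /A'B'.
  under eq_bigr do rewrite mulrBl.
  rewrite sumrB; apply/eqP; rewrite subr_eq0; apply/eqP.
  transitivity (c (rho2 mu) (0 + intv R Z)).
    rewrite cE; apply: sum_eq_support => // M'; rewrite mulf_eq0 negb_or => /andP[/AB ne _] //.
    by rewrite inB2 ne.
  rewrite c_rho2 A'E; apply: sum_eq_support; rewrite ?undup_uniq // => M';
    rewrite mulf_eq0 negb_or => /andP[/A'B' ne _] //.
  by rewrite inB2 ne orbT.
move=> ne; have : A' M != 0 by move/eqP: (E0 M); rewrite subr_eq0 => /eqP <-.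
move=> /A'B'; rewrite mem_undup => /mapP[t tl ->].
by have [[k ->] tW] := lP _ tl; split; [exists k|rewrite -?E].
Qed.

Lemma coef_wall_system : wall_system g mu p supp A.
Proof.
move=> a b s ka M ab sm; pose d := s%:Z *: alpha a b.
(* [A' M'] is the coefficient of [qmon M'] in the string condition; the claim is its vanishing at
   [M' = M + d]. *)
pose A' M' := \sum_(K <- supp | key a b K == ka)
  (A K (M' - d) * p ^ (s%:Z * gform g a b K) - A K (M' + d) * p ^ (- (s%:Z * gform g a b K))).
suff /(_ (M + d)) : forall M', A' M' = 0.
  rewrite /A' sumrB addrK -addrA -scalerDl.
  have -> : s%:Z + s%:Z = 2 * s%:Z :> int by ring.
  by move=> /eqP; rewrite subr_eq0 => /eqP.
pose B' := undup ([seq M + d | M <- B] ++ [seq M - d | M <- B]).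
have inP M' : M' - d \in B -> M' \in B'.
  by move=> h; rewrite mem_undup mem_cat; apply/orP; left; apply/mapP; exists (M' - d); rewrite ?subrK.
have inN M' : M' + d \in B -> M' \in B'.
  by move=> h; rewrite mem_undup mem_cat; apply/orP; right; apply/mapP; exists (M' + d); rewrite ?addrK.
have uB' : uniq B' by exact: undup_uniq.
have shift K X e : (forall M', A K (M' - e) != 0 -> M' \in B') ->
    \sum_(M' <- B') A K (M' - e) * qmon M' X = c K X * qmon e X.
  move=> he; rewrite cE mulr_suml.
  transitivity (\sum_(M' <- [seq M + e | M <- B]) A K (M' - e) * qmon M' X); last first.
    by rewrite big_map; apply: eq_bigr => M' _; rewrite addrK qmonDl mulrA.
  apply: sum_eq_support => // [|M'|M'].
  - by rewrite map_inj_uniq //; exact: addIr.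
  - by rewrite mulf_eq0 negb_or => /andP[/he].
  - rewrite mulf_eq0 negb_or => /andP[/AB h _].
    by apply/mapP; exists (M' - e); rewrite ?subrK.
apply: (exp_sum_coef0 (lq := lq) p_nroot (B := B') (X0 := 0)) => // [M'|Z].
  apply: contraNT => nB; rewrite /A' big1 // => K _.
  have -> : A K (M' - d) = 0 by apply/eqP; apply: contraNT nB => /AB/inP.
  have -> : A K (M' + d) = 0 by apply/eqP; apply: contraNT nB => /AB/inN.
  by rewrite !mul0r subrr.
set X := 0 + _; rewrite -[RHS](sysc ka X ab sm).
under eq_bigr do rewrite /A' mulr_suml.
rewrite exchange_big /=; apply: eq_bigr => K _.
have h1 := shift K X d (fun M' h => inP M' (AB h)).
have h2 := shift K X (- d) (fun M' h => inN M' (AB (eq_ind _ (fun z => A K z != 0) h _ (congr1 (fun z => M' + z) (opprK d))))).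
transitivity (p ^ (s%:Z * gform g a b K) * (c K X * qmon d X) -
              p ^ (- (s%:Z * gform g a b K)) * (c K X * qmon (- d) X)).
  rewrite -h1 -h2 !mulr_sumr -sumrB; apply: eq_bigr => M' _.
  by rewrite opprK mulrBl -!mulrA; congr (_ - _); exact: mulrCA.
have e1 : qmon d X = qmon (alpha a b) X ^+ s by exact: qmonZl.
have e2 : qmon (- d) X = (qmon (alpha a b) X ^+ s)^-1.
  by rewrite /d -scaleNr qmonZl -invr_expz.
have e3 : p ^ (s%:Z * gform g a b K) = (p ^ gform g a b K) ^+ s.
  by rewrite exprnP exprz_exp mulrC.
rewrite e1 e2 -invr_expz e3 /phase; apply: bracket_shift.
Qed.

End CoefficientMatrix.

(** * Vertices and edges of the polytope *)

Section GenericPoint.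
Variables (R : realType) (N : nat) (lq : R[i]).
Local Notation C := R[i].
Local Notation X_ := 'rV[R[i]]_N.
Local Notation p := (sqrtq lq).
Local Notation qmon := (qmon lq).
Hypothesis lq0 : lq != 0.

Lemma qmon_alpha (X : X_) i j : i != j -> qmon (alpha i j) X = qpow lq (X 0 i - X 0 j).
Proof.
move=> ij; rewrite unlock qmonDl -scaleN1r qmonZl !qmon_delta.
by rewrite qpowD qpowN -invr_expz expr1z.
Qed.

Lemma qmon_alphaV (X : X_) i j : qmon (alpha j i) X = (qmon (alpha i j) X)^-1.
Proof.
have -> : alpha j i = - alpha i j by rewrite !unlock opprB.
by rewrite -scaleN1r qmonZl -invr_expz expr1z.
Qed.

(* Either [|q| = 1], and a point with real positive [q^(x_i - x_j) <> 1] works,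
   or [|q| <> 1], and one with [q^(x_i - x_j)] on the unit circle works. *)
Lemma generic_point (r : 'I_N -> nat) : exists X : X_,
  (forall i j, r i = r j -> qmon (alpha i j) X = 1) /\
  (forall i j, r i != r j -> forall k : int, qmon (alpha i j) X ^+ 2 * p ^ k != 1).
Proof.
pose B : nat := (\sum_i r i).+1.
have rB i : (r i < B)%N by rewrite /B ltnS (bigD1 i) //= leq_addr.
have [v vP] : exists v : C, forall (w : int) (k : int), w != 0 -> `|w| < B%:Z ->
    cexp (v * (2 * w%:~R) + k%:~R / 2 * lq) != 1.
  pose al := complex.Re lq / 2.
  have ReE (k : int) : complex.Re (k%:~R / 2 * lq) = k%:~R * al.
    have -> : k%:~R / 2 = (k%:~R / 2)%:C :> C by rewrite rmorphM fmorphV rmorph_int rmorph_nat.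
    by case: lq @al => a b /=; ring.
  have [al0|al0] := eqVneq al 0.
    exists 1 => w k w0 _; apply/negP => /eqP/cexp_eq1[+ _].
    rewrite mul1r raddfD /= ReE al0 mulr0 addr0.
    have -> : 2 * w%:~R = (2 * w%:~R)%:C :> C by rewrite rmorphM rmorph_int rmorph_nat.
    by move=> /= /eqP; rewrite mulf_eq0 intr_eq0 (negbTE w0) orbF pnatr_eq0.
  (* The real part forces [k = 0]; this scale then keeps the angle below 1 in absolute value, where
     the sine vanishes only at 0. *)
  pose th : R := (2 * B%:R)^-1.
  have th0 : 0 < th by rewrite invr_gt0 mulr_gt0 ?ltr0n.
  exists ('i%C * th%:C) => w k w0 wB; apply/negP => /eqP/cexp_eq1[RE IE].
  have wE : 'i%C * th%:C * (2 * w%:~R) = 0 +i* (th * (2 * w%:~R)) :> C.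
    have -> : 2 * w%:~R = (2 * w%:~R)%:C :> C by rewrite rmorphM rmorph_int rmorph_nat.
    by apply/eqP; rewrite eq_complex /=; apply/andP; split; apply/eqP; ring.
  have k0 : k = 0.
    move: RE; rewrite raddfD /= ReE wE /= add0r => /eqP.
    by rewrite mulf_eq0 (negbTE al0) orbF intr_eq0 => /eqP.
  move: IE; rewrite k0 mul0r mul0r addr0 wE /=.
  set x := th * _.
  have xE : `|x| = `|w|%:~R / B%:R.
    rewrite /x normrM (gtr0_norm th0) normrM normr_nat intr_norm.
    by rewrite /th invfM mulrACA mulVf ?pnatr_eq0 // mul1r mulrC.
  have xb : `|x| < 1.
    by rewrite xE ltr_pdivrMr ?ltr0n // mul1r -[B%:R]/(B%:Z%:~R) ltr_int.
  have x0 : x != 0 by rewrite -normr_gt0 xE divr_gt0 ?ltr0z ?normr_gt0 ?ltr0n.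
  have sn0 (t : R) : 0 < t -> t < 1 -> sin t != 0.
    move=> t0 t1; rewrite gt_eqF // sin_gt0_pi // t0 (lt_le_trans t1) //.
    by apply: le_trans (pi_ge2 R); rewrite ler1n.
  move: xb; rewrite ltr_norml => /andP[xl xr].
  move: x0; rewrite neq_lt => /orP[xn|xp] s0; last by have := sn0 _ xp xr; rewrite s0 eqxx.
  have := @sn0 (- x); rewrite sinN s0 oppr0 eqxx => /(_ _ _)/negP; apply=> //; lra.
exists (\row_i (v / lq * (r i)%:R)); split=> i j rij.
  have [->|ij] := eqVneq i j.
    by rewrite -[alpha j j]/(alpha j j) unlock subrr qmon0.
  by rewrite qmon_alpha // !mxE rij subrr qpow0.
move=> k; have ij : i != j by apply: contra_neq rij => ->.
have wB : `|(r i)%:Z - (r j)%:Z| < B%:Z by have := rB i; have := rB j; clear; lia.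
have w0 : (r i)%:Z - (r j)%:Z != 0 by rewrite subr_eq0.
have := vP _ k w0 wB; rewrite cexpD.
have -> : cexp (v * (2 * ((r i)%:Z - (r j)%:Z)%:~R)) = qmon (alpha i j)
    (\row_i (v / lq * (r i)%:R)) ^+ 2.
  rewrite qmon_alpha // !mxE -qpow_nat /qpow; congr cexp.
  by rewrite intrB; field.
have -> // : cexp (k%:~R / 2 * lq) = p ^ k by rewrite -qpow_half_int.
Qed.

End GenericPoint.

Section Edges.
Variables (R : realType) (N : nat) (lq : R[i]).
Variables (g : 'I_N -> nat) (mu : 'I_N -> 'I_N -> nat).
Local Notation C := R[i].
Local Notation V := 'rV[int]_N.
Local Notation X_ := 'rV[R[i]]_N.
Local Notation qp := (qpow lq).
Local Notation p := (sqrtq lq).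
Local Notation qmon := (qmon lq).
Implicit Types (a b i j : 'I_N) (M K Z eta : V) (X Y : X_).

Hypothesis lq0 : lq != 0.
Hypothesis p_nroot : forall j : int, j != 0 -> p ^ j != 1.
Hypothesis g_gt0 : forall i, (0 < g i)%N.
Hypothesis mu_sym : forall i j, mu i j = mu j i.
Hypothesis g_mu : forall a b i, a != b -> i != a -> i != b ->
  (g a * mu a i)%N = (g b * mu b i)%N.

Variables (supp : seq V) (c : V -> X_ -> C).
Hypothesis usupp : uniq supp.
Hypothesis suppP : forall K, K \in supp <-> in_polytope mu K.
Hypothesis sysc : string_system lq g mu supp c.
Hypothesis c_rho2 : forall X, c (rho2 mu) X = norm_coef lq g mu X.
Hypothesis c_out : forall K, ~ in_polytope mu K -> forall X, c K X = 0.
Hypothesis c_exp : forall K, exp_sum lq (c K).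

Let p_neq0 : p != 0 := sqrtq_neq0 lq.

Definition pair_factor i j X : C := norm_factor lq g mu i j (qmon (alpha i j) X).

(* The coefficient expected at the vertex in direction [eta]; for a tie
   [eta_a = eta_b], the common factor along the corresponding edge. *)
Definition vertex_coef eta X : C :=
  \prod_(q : 'I_N * 'I_N | eta 0 q.2 < eta 0 q.1) pair_factor q.1 q.2 X.

Lemma exp_sum_br1 (z : C) M : exp_sum lq (fun X => br (z / qmon M X)).
Proof.
exists [:: (z, - M); (- z^-1, M)] => X; rewrite big_cons big_seq1 /=.
by rewrite qmonN /br invf_div mulNr [_^-1 * _]mulrC.
Qed.

Lemma exp_sum_br2 (z : C) M : exp_sum lq (fun X => br (qmon M X * z)).
Proof.
exists [:: (z, M); (- z^-1, - M)] => X; rewrite big_cons big_seq1 /=.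
by rewrite qmonN /br invfM mulNr [z^-1 * _]mulrC [z * _]mulrC.
Qed.

Lemma exp_sum_vertex_coef eta : exp_sum lq (vertex_coef eta).
Proof.
by apply: exp_sum_prod => q; apply: exp_sum_prod => l; exact: exp_sum_br1.
Qed.

Lemma exp_sum_edge_coef a b (G m k : nat) :
  exp_sum lq (fun X => edge_coef p G m k (qmon (alpha a b) X)).
Proof.
apply: exp_sumM; last by apply: exp_sum_prod => l; exact: exp_sum_br1.
apply: exp_sumM; first exact: exp_sum_cst.
by apply: exp_sum_prod => l; exact: exp_sum_br2.
Qed.

Section Tie.
Variables (a b : 'I_N) (eta : V).
Hypothesis ab : (a < b)%N.
Hypothesis eab : eta 0 a = eta 0 b.
Hypothesis etaP : forall i j, (i < j)%N -> eta 0 i = eta 0 j -> i = a /\ j = b.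

Let nab : a != b. Proof. by rewrite -val_eqE neq_ltn ab. Qed.
Let m := mu a b.
Let G := (g a + g b)%N.
Let node (r : int) : V := face_centre mu eta + r *: alpha a b.

(** The edge is centred on the hyperplane orthogonal to [alpha a b]: with [eta_a = eta_b], each
    other index contributes with the same sign at [a] and [b], and [g_mu] cancels the two. *)
Lemma gform_face_centre : gform g a b (face_centre mu eta) = 0.
Proof.
rewrite /gform !face_centreE // !mulr_sumr -sumrB big1 // => j _.
rewrite eab; have [->|ja] := eqVneq j a; first by rewrite eab subrr sgz0; ring.
have [->|jb] := eqVneq j b; first by rewrite subrr sgz0; ring.
by rewrite mulrCA [X in _ - X]mulrCA -!PoszM (g_mu nab ja jb) subrr.
Qed.

Lemma node_parity : in_parity mu (node m%:Z).
Proof.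
exists (\sum_(q : 'I_N * 'I_N | (q.1 < q.2)%N)
  (- ((eta 0 q.1 < eta 0 q.2)%R%:Z * (mu q.1 q.2)%:Z)) *: alpha q.1 q.2).
have E : m%:Z *: alpha a b = \sum_(q : 'I_N * 'I_N | (q.1 < q.2)%N)
    ((q == (a, b))%:Z * (mu q.1 q.2)%:Z) *: alpha q.1 q.2.
  rewrite (bigD1 (a, b)) //= eqxx mul1r big1 ?addr0 // => q /andP[_ /negbTE ->].
  by rewrite mul0r scale0r.
rewrite /node E /face_centre /rho2 scaler_sumr -!big_split /=; apply: eq_bigr => -[i j] /= ij.
rewrite scalerA -!scalerDl; congr (_ *: _).
have [[-> ->]|ne] := eqVneq (i, j) (a, b); first by rewrite eab subrr sgz0 ltxx /=; ring.
have [lt|gt|e] := ltgtP (eta 0 i) (eta 0 j).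
- by rewrite ltr0_sgz ?subr_lt0 //=; ring.
- by rewrite gtr0_sgz ?subr_gt0 //=; ring.
- by case/eqP: ne; have [-> ->] := etaP ij e.
Qed.

Lemma node_polytope r : in_polytope mu (node r) -> exists k : nat,
  (k <= m)%N /\ r = m%:Z - 2 * k%:Z.
Proof.
move=> rS; have [[k1 E1] _] := rS.
have Ew : dotz eta (node r) = width mu eta.
  by rewrite dotzDr dotz_face_centre_self dotzZr dotz_alpha eab subrr mulr0 addr0.
have [r' [E' r'm]] := face_edge ab eab etaP rS Ew.
have rr' : r = r'.
  by move/addrI/rowP: E' => /(_ a); rewrite !mxE alpha_l // !mulr1.
have [k2 E2] := node_parity.
have : r - m%:Z = 2 * (k1 0 a - k2 0 a).
  have /rowP/(_ a) : node r - node m%:Z = 2 *: (k1 - k2).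
    by rewrite E1 E2 opprD addrACA subrr add0r scalerBr.
  by rewrite !mxE alpha_l // !mulr1 => <-; ring.
rewrite rr' => h; exists (absz ((m%:Z - r') %/ 2)%Z).
by move: r'm h; rewrite -/m; move: (k1 0 a - k2 0 a) (m) => w m'; clear; lia.
Qed.

Lemma face_node K : in_polytope mu K -> dotz eta K = width mu eta -> exists r, K = node r.
Proof. by move=> KS /(face_edge ab eab etaP KS)[r [-> _]]; exists r. Qed.

Let nk (k : nat) : V := node (m%:Z - 2 * k%:Z).

(** [eta] is constant on the line through the edge and maximal on the edge, so the line meets the
    polytope only in the edge and the string condition involves only its nodes. *)
Lemma edge_system X s : (0 < s <= m)%N ->
  \sum_(0 <= k < m.+1) c (nk k) X *
    br ((qmon (alpha a b) X * p ^ ((m%:Z - 2 * k%:Z) * G%:Z)) ^+ s) = 0.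
Proof.
move=> sm; rewrite -[RHS](sysc (key a b (face_centre mu eta)) X ab sm).
pose F K := if key a b K == key a b (face_centre mu eta)
            then c K X * br (phase lq g a b X K ^+ s) else 0.
pose L := [seq nk k | k <- index_iota 0 m.+1].
have uL : uniq L.
  rewrite map_inj_uniq ?iota_uniq // => k k' /addrI/rowP/(_ a).
  by rewrite !mxE alpha_l // !mulr1 => /addrI/oppr_inj; clear; lia.
transitivity (\sum_(K <- L) F K).
  rewrite big_map; apply: eq_bigr => k _; rewrite /F key_line // eqxx.
  by rewrite /phase gformD gformZ gform_alpha // gform_face_centre add0r.
rewrite [RHS]big_mkcond -/F; apply: sum_eq_support => // K.
- rewrite /F; case: ifP => [/eqP kE|_]; last by rewrite eqxx.
  have [KS|nS] := pselect (in_polytope mu K); last by rewrite c_out // mul0r eqxx.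
  move=> _; have Ew : dotz eta K = width mu eta.
    by rewrite -(dotz_key K eab) kE dotz_key // dotz_face_centre_self.
  have [r Kr] := face_node KS Ew; rewrite Kr in KS *.
  have [k [km ->]] := node_polytope KS.
  by apply/mapP; exists k => //; rewrite mem_index_iota.
- rewrite /F; case: ifP => [/eqP kE|_]; last by rewrite eqxx.
  have [KS _|nS] := pselect (in_polytope mu K); first exact/suppP.
  by rewrite c_out // mul0r eqxx.
Qed.

(** Where [edge_coef 0] is nonzero, [edge_coefP] propagates the coefficient of the first vertex
    along the edge. Both sides are exponential sums, so a lattice translate of a generic point
    suffices. *)
Lemma edge_coefs : (forall X, c (nk 0) X = vertex_coef eta X * pair_factor a b X) ->
  forall k X, (k <= m)%N ->
  c (nk k) X = vertex_coef eta X * edge_coef p G m k (qmon (alpha a b) X).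
Proof.
move=> c0 k X km; apply/eqP; rewrite -subr_eq0; apply/eqP; move: X.
have [X0 [_ X0g]] := generic_point (N := N) lq0 (fun i => i : nat).
have G0 : (0 < G)%N by rewrite addn_gt0 g_gt0.
apply: (exp_sum_eq0 p_nroot (X0 := X0)) => [|Z].
  have h := exp_sumD (c_exp (nk k)) (exp_sumM (exp_sum_cst N lq (-1))
    (exp_sumM (exp_sum_vertex_coef eta) (exp_sum_edge_coef a b G m k))).
  by apply: exp_sum_ext h => X /=; rewrite mulN1r.
set X := X0 + _; pose y := qmon (alpha a b) X.
have y0 : y != 0 by exact: qmon_neq0.
have yg (j : int) : y ^+ 2 * p ^ j != 1.
  rewrite /y /X qmonDr exprMn qmon_intv -mulrA [(p ^ _) ^+ 2]exprnP exprz_exp -expfzDr //.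
  by apply: X0g; rewrite neq_ltn ab.
have := @edge_coefP _ _ G m p_neq0 p_nroot G0 y (fun k => c (nk k) X) y0 yg (edge_system X) k km.
rewrite /= c0 -mulrA => E.
have h0 : edge_coef p G m 0 y = pair_factor a b X.
  by rewrite edge_coef0 //; apply: eq_bigr => j _; rewrite PoszM.
have h0n : edge_coef p G m 0 y != 0.
  rewrite edge_coef0 // prodf_seq_neq0; apply/allP => j _ /=.
  rewrite br_eq0 ?mulf_neq0 ?invr_neq0 ?expfz_neq0 // expr_div_n.
  apply: contra (yg (- (j%:Z * G%:Z * 2))) => /eqP E1.
  rewrite -invr_expz -exprz_exp -exprnP.
  by move/(congr1 (fun z => z * y ^+ 2)): E1; rewrite mul1r divfK ?expf_neq0 // => <-; rewrite divff ?expf_neq0 ?expfz_neq0.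
apply/eqP; rewrite subr_eq0; apply/eqP; apply: (mulIf h0n).
by rewrite E h0 -/y mulrAC mulrA.
Qed.

End Tie.
Lemma pair_eq_swap i j a b : ((i, j) == (a, b)) = ((j, i) == (b, a)).
Proof. by rewrite !xpair_eqE andbC. Qed.

Lemma sgz_sub (x y : int) : sgz (x - y) = if x < y then -1 else if y < x then 1 else 0.
Proof.
have [h|h|->] := ltgtP x y; last by rewrite subrr sgz0.
  by rewrite ltr0_sgz // subr_lt0.
by rewrite gtr0_sgz // subr_gt0.
Qed.

Lemma face_centre_order eta eta' : (forall i j, (eta 0 i < eta 0 j) = (eta' 0 i < eta' 0 j)) ->
  face_centre mu eta = face_centre mu eta'.
Proof.
move=> E; apply: eq_bigr => -[i j] /= _; congr ((_ * _) *: _).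
by rewrite !sgz_sub !E.
Qed.

Section Break.
Variables (a b : 'I_N) (eta eta' : V).
Hypothesis ab : (a < b)%N.
Hypothesis eab : eta 0 a = eta 0 b.
Hypothesis Elt : forall i j, (i, j) != (a, b) -> (i, j) != (b, a) ->
  (eta' 0 i < eta' 0 j) = (eta 0 i < eta 0 j).

Lemma face_centre_break : face_centre mu eta' =
  face_centre mu eta + (sgz (eta' 0 a - eta' 0 b) * (mu a b)%:Z) *: alpha a b.
Proof.
rewrite /face_centre (bigD1 (a, b)) //= addrC; congr (_ + _).
rewrite [RHS](bigD1 (a, b)) //= eab subrr sgz0 mul0r scale0r add0r.
apply: eq_bigr => -[i j] /= /andP[ij ne]; congr ((_ * _) *: _).
have ne' : (i, j) != (b, a).
  by apply/eqP => -[i_b j_a]; move: ij; rewrite i_b j_a ltnNge (ltnW ab).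
by rewrite !sgz_sub !Elt // pair_eq_swap.
Qed.

Lemma vertex_coef_up X : eta' 0 b < eta' 0 a ->
  vertex_coef eta' X = vertex_coef eta X * pair_factor a b X.
Proof.
move=> lt; rewrite /vertex_coef (bigD1 (a, b)) //= mulrC; congr (_ * _).
apply: eq_bigl => -[i j] /=; have [[-> ->]|ne] := eqVneq (i, j) (a, b).
  by rewrite andbF eab ltxx.
have [[-> ->]|ne'] := eqVneq (i, j) (b, a); first by rewrite eab ltxx ltNge (ltW lt).
by rewrite andbT Elt // pair_eq_swap.
Qed.

End Break.

Lemma vertex_coef_down a b eta eta' X : eta 0 a = eta 0 b ->
  (forall i j, (i, j) != (a, b) -> (i, j) != (b, a) ->
    (eta' 0 i < eta' 0 j) = (eta 0 i < eta 0 j)) ->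
  eta' 0 a < eta' 0 b -> vertex_coef eta' X = vertex_coef eta X * pair_factor b a X.
Proof.
move=> eab Elt lt; rewrite /vertex_coef (bigD1 (b, a)) //= mulrC; congr (_ * _).
apply: eq_bigl => -[i j] /=; have [[-> ->]|ne] := eqVneq (i, j) (b, a).
  by rewrite andbF eab ltxx.
have [[-> ->]|ne'] := eqVneq (i, j) (a, b); first by rewrite eab ltxx ltNge (ltW lt).
by rewrite andbT Elt // pair_eq_swap.
Qed.

(* The order [0 < 1 < ...] of the indices with [b] moved to the position [v]. *)
Definition moved b (v : int) : V := \row_i (if i == b then v else - (2 * (i : nat)%:Z)).

Lemma moved_tie a b : (a < b)%N -> forall i j, (i < j)%N ->
  moved b (- (2 * (a : nat)%:Z)) 0 i = moved b (- (2 * (a : nat)%:Z)) 0 j -> i = a /\ j = b.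
Proof.
move=> ab i j; rewrite !mxE -!val_eqE /= => ij E; suff [ia jb] : i = a :> nat /\ j = b :> nat.
  by split; exact/val_inj.
move: ij E ab; move: (nat_of_ord a) (nat_of_ord i) (nat_of_ord j) (nat_of_ord b) => w x y z.
by clear; case: eqP => [->|ne]; case: eqP => [->|ne'] *; split; lia.
Qed.

(** At [k = b] the order is the standard one and the vertex is [rho2]. Each further step moves [b]
    past one index [a], crossing the edge where they tie: the known vertex is its first node, and
    the last node trades the factor of [alpha a b] for that of [alpha b a]. *)
Lemma vertex_coef_moved b (k : nat) X : (k <= b)%N ->
  c (face_centre mu (moved b (1 - 2 * k%:Z))) X = vertex_coef (moved b (1 - 2 * k%:Z)) X.
Proof.
move=> kb; rewrite -(subKn kb); elim: (b - k)%N (leq_subr k b) X => {k kb} [|d IH] db X.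
  rewrite subn0.
  have E i j : (moved b (1 - 2 * b%:Z) 0 i < moved b (1 - 2 * b%:Z) 0 j) =
               (std N 0 i < std N 0 j).
    rewrite !mxE -!val_eqE /=; move: (nat_of_ord i) (nat_of_ord j) (nat_of_ord b) => x y z; clear.
    by case: eqP => [->|ne]; case: eqP => [->|ne']; rewrite ?ltxx //; apply/idP/idP; lia.
  rewrite (face_centre_order E) face_centre_std c_rho2; apply: eq_bigl => q.
  by rewrite E !mxE; apply/idP/idP; clear; lia.
have kb : (b - d.+1 < b)%N by clear -db; lia.
pose a := Ordinal (ltn_trans kb (ltn_ord b)).
have ab : (a < b)%N by [].
have ak : (b - d = a.+1)%N by rewrite /=; clear -db; lia.
pose t := moved b (- (2 * (a : nat)%:Z)).
have nab : a != b by rewrite -val_eqE neq_ltn ab.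
have eab : t 0 a = t 0 b by rewrite !mxE eqxx (negbTE nab).
have tP := moved_tie ab.
have Elt (v : int) i j : `|v + 2 * (a : nat)%:Z| <= 1 -> (i, j) != (a, b) -> (i, j) != (b, a) ->
    (moved b v 0 i < moved b v 0 j) = (t 0 i < t 0 j).
  move=> vb; rewrite !xpair_eqE !mxE -!val_eqE /=; move: vb; rewrite /=.
  move: (b - d.+1)%N (nat_of_ord i) (nat_of_ord j) (nat_of_ord b) => w x y z; clear => vb h1 h2.
  by case: eqP => ne; case: eqP => ne'; rewrite ?ltxx //; apply/idP/idP; lia.
have nk0 X' : c (face_centre mu t + ((mu a b)%:Z - 2 * 0%:Z) *: alpha a b) X' =
    vertex_coef t X' * pair_factor a b X'.
  have vb : `|1 - 2 * (b - d)%:Z + 2 * (a : nat)%:Z| <= 1 by rewrite ak; clear; lia.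
  have lt : moved b (1 - 2 * (b - d)%:Z) 0 b < moved b (1 - 2 * (b - d)%:Z) 0 a.
    by rewrite !mxE eqxx (negbTE nab) ak; clear; lia.
  have E := fun i j => Elt _ i j vb.
  have := IH (ltnW db) X'; rewrite (face_centre_break ab eab E) (vertex_coef_up eab E) //.
  by rewrite gtr0_sgz ?subr_gt0 // mul1r mulr0 subr0.
have lt : moved b (1 - 2 * (b - d.+1)%:Z) 0 a < moved b (1 - 2 * (b - d.+1)%:Z) 0 b.
  by rewrite !mxE eqxx (negbTE nab) /=; clear; lia.
have vb : `|1 - 2 * (b - d.+1)%:Z + 2 * (a : nat)%:Z| <= 1 by rewrite /=; clear; lia.
have E := fun i j => Elt _ i j vb.
rewrite (face_centre_break ab eab E) (vertex_coef_down _ eab E) //.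
rewrite ltr0_sgz ?subr_lt0 // mulN1r.
have := edge_coefs ab eab tP nk0 X (leqnn _).
have -> : (mu a b)%:Z - 2 * (mu a b)%:Z = - (mu a b)%:Z by ring.
move=> ->; congr (_ * _); rewrite edge_coef_last ?addn_gt0 ?g_gt0 // -qmon_alphaV /pair_factor /norm_factor mu_sym.
by apply: eq_bigr => l _; rewrite PoszM addnC.
Qed.

Lemma edge_coefs_moved a b (k : nat) X : (a < b)%N -> (k <= mu a b)%N ->
  c (face_centre mu (moved b (- (2 * (a : nat)%:Z))) + ((mu a b)%:Z - 2 * k%:Z) *: alpha a b) X =
  vertex_coef (moved b (- (2 * (a : nat)%:Z))) X *
  edge_coef p (g a + g b) (mu a b) k (qmon (alpha a b) X).
Proof.
move=> ab km; pose t := moved b (- (2 * (a : nat)%:Z)).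
have nab : a != b by rewrite -val_eqE neq_ltn ab.
have eab : t 0 a = t 0 b by rewrite !mxE eqxx (negbTE nab).
have Elt i j : (i, j) != (a, b) -> (i, j) != (b, a) ->
    (moved b (1 - 2 * a.+1%:Z) 0 i < moved b (1 - 2 * a.+1%:Z) 0 j) = (t 0 i < t 0 j).
  rewrite !xpair_eqE !mxE -!val_eqE /=.
  move: (nat_of_ord a) (nat_of_ord i) (nat_of_ord j) (nat_of_ord b) => w x y z; clear => h1 h2.
  by case: eqP => ne; case: eqP => ne'; rewrite ?ltxx //; apply/idP/idP; lia.
have lt : moved b (1 - 2 * a.+1%:Z) 0 b < moved b (1 - 2 * a.+1%:Z) 0 a.
  by rewrite !mxE eqxx (negbTE nab); clear; lia.
apply: (edge_coefs ab eab (moved_tie ab)) km => X'.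
have := vertex_coef_moved X' ab; rewrite (face_centre_break ab eab Elt).
by rewrite (vertex_coef_up eab Elt) // gtr0_sgz ?subr_gt0 // mul1r mulr0 subr0.
Qed.

End Edges.

Lemma add_inv_inj (F : fieldType) (x y : F) : x != 0 -> y != 0 ->
  x + x^-1 = y + y^-1 -> x * y != 1 -> x = y.
Proof.
move=> x0 y0 E xy; apply/eqP; rewrite -subr_eq0.
have : (x - y) * (x * y - 1) = 0.
  transitivity (((x + x^-1) - (y + y^-1)) * (x * y)); last by rewrite E subrr mul0r.
  by field; rewrite x0 y0.
by move=> /eqP; rewrite mulf_eq0 [_ - 1 == 0]subr_eq0 (negbTE xy) orbF.
Qed.

(** Every other index lies on the same side of [a] and of [b], so the factors that involve them
    occur in the pairs that [fl] and [fr] compare. *)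
Lemma ordered_prod_eq (K : comPzRingType) N (f f' : 'I_N -> 'I_N -> K) (a b : 'I_N)
    (eta : 'rV[int]_N) : a != b -> eta 0 a = eta 0 b ->
  (forall j, j != a -> j != b -> f a j * f b j = f' a j * f' b j) ->
  (forall j, j != a -> j != b -> f j a * f j b = f' j a * f' j b) ->
  (forall i j, i != a -> i != b -> j != a -> j != b -> f i j = f' i j) ->
  \prod_(q : 'I_N * 'I_N | eta 0 q.2 < eta 0 q.1) f q.1 q.2 =
  \prod_(q : 'I_N * 'I_N | eta 0 q.2 < eta 0 q.1) f' q.1 q.2.
Proof.
move=> nab eab fl fr fo; have nba : b != a by rewrite eq_sym.
have splitE (h : 'I_N -> 'I_N -> K) :
    \prod_(q : 'I_N * 'I_N | eta 0 q.2 < eta 0 q.1) h q.1 q.2 =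
    \prod_(j | eta 0 j < eta 0 a) (h a j * h b j) *
    \prod_(i | (i != a) && (i != b)) \prod_(j | eta 0 j < eta 0 i) h i j.
  rewrite -(pair_big_dep xpredT (fun i j => eta 0 j < eta 0 i) h) /=.
  rewrite (bigD1 a) //= (bigD1 b (P := fun i => i != a)) //= mulrA -eab -big_split /=.
  by congr (_ * _).
rewrite !splitE; congr (_ * _).
  apply: eq_bigr => j lt; apply: fl; apply: contraTneq lt => ->; by rewrite ?eab ltxx.
apply: eq_bigr => i /andP[ia ib].
have [lt|ge] := ltP (eta 0 a) (eta 0 i); last first.
  apply: eq_bigr => j lt; apply: fo => //.
    by apply: contraTneq lt => ->; rewrite -leNgt.
  by apply: contraTneq lt => ->; rewrite -leNgt -eab.
have lt' : eta 0 b < eta 0 i by rewrite -eab.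
rewrite (bigD1 a) //= [RHS](bigD1 a) //= (bigD1 b) ?lt' //= [in RHS](bigD1 b) ?lt' ?nba //=.
rewrite !mulrA fr //; congr (_ * _).
by apply: eq_bigr => j /andP[/andP[_ ja] jb]; apply: fo.
Qed.

(** * Relations on the walls *)

Section Walls.
Variables (R : realType) (N : nat) (lq : R[i]).
Variables (g : 'I_N -> nat) (mu : 'I_N -> 'I_N -> nat).
Local Notation C := R[i].
Local Notation V := 'rV[int]_N.
Local Notation X_ := 'rV[R[i]]_N.
Local Notation qp := (qpow lq).
Local Notation p := (sqrtq lq).
Local Notation qmon := (qmon lq).
Implicit Types (a b i j : 'I_N) (M K Z eta : V) (X Y : X_).

Hypothesis lq0 : lq != 0.
Hypothesis p_nroot : forall j : int, j != 0 -> p ^ j != 1.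
Hypothesis g_gt0 : forall i, (0 < g i)%N.
Hypothesis mu_sym : forall i j, mu i j = mu j i.
Hypothesis g_mu : forall a b i, a != b -> i != a -> i != b ->
  (g a * mu a i)%N = (g b * mu b i)%N.

(* The factors of the normalization attached to [alpha a j] and [alpha b j],
   at the point [x + t alpha_ab / 2] with [x] on the wall of [alpha a b]. *)
Definition pair_product a b j (t : int) (y e : C) : C :=
  (\prod_(1 <= l < (mu a j).+1) br (p ^ (l%:Z * (g a + g j)%:Z - t * (g a)%:Z) / y)) *
  (\prod_(1 <= l < (mu b j).+1) br (p ^ (l%:Z * (g b + g j)%:Z + t * (g b)%:Z) / (e * y))).

Hypothesis pair_productN : forall a b j (s : nat) y e, (a < b)%N -> j != a -> j != b ->
  (0 < s <= mu a b)%N -> y != 0 -> e ^+ 2 = 1 ->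
  pair_product a b j s%:Z y e = pair_product a b j (- s%:Z) y e.

Variables (supp : seq V) (c : V -> X_ -> C).
Hypothesis usupp : uniq supp.
Hypothesis suppP : forall K, K \in supp <-> in_polytope mu K.
Hypothesis sysc : string_system lq g mu supp c.
Hypothesis c_rho2 : forall X, c (rho2 mu) X = norm_coef lq g mu X.
Hypothesis c_out : forall K, ~ in_polytope mu K -> forall X, c K X = 0.
Hypothesis c_exp : forall K, exp_sum lq (c K).

Let p_neq0 : p != 0 := sqrtq_neq0 lq.

(* In the coordinates [X_i = (p_i, x)] the point [x + t alpha_ab / 2]. *)
Definition wall_shift a b (t : int) X : X_ :=
  X + (t%:~R / 2) *: ((g a)%:R *: delta_mx 0 a - (g b)%:R *: delta_mx 0 b).

Lemma qmon_wall_shift a b t X M :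
  qmon M (wall_shift a b t X) = qmon M X * p ^ (t * gform g a b M).
Proof.
rewrite qmonDr qmonZr -qpow_half_int; congr (_ * qpow _ _).
have -> : \sum_i (M 0 i)%:~R * ((g a)%:R *: delta_mx 0 a - (g b)%:R *: delta_mx 0 b : X_) 0 i =
    (gform g a b M)%:~R.
  transitivity (\sum_i ((M 0 i)%:~R * (g a)%:R * (i == a)%:R - (M 0 i)%:~R * (g b)%:R * (i == b)%:R : C)).
    by apply: eq_bigr => i _; rewrite !mxE /=; ring.
  rewrite sumrB (bigD1 a) //= big1 => [|i /negbTE ->]; last by rewrite mulr0.
  rewrite [X in _ - X](bigD1 b) //= [X in _ - (_ + X)]big1 => [|i /negbTE ->]; last by rewrite mulr0.
  rewrite !eqxx !mulr1 !addr0 /gform intrB !intrM -[(g a)%:Z%:~R]/((g a)%:R) -[(g b)%:Z%:~R]/((g b)%:R).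
  by rewrite ![(M 0 _)%:~R * _]mulrC.
by rewrite intrM; ring.
Qed.

Lemma gform_alpha_sym a b i j : gform g i j (alpha a b) = gform g a b (alpha i j).
Proof.
have h x y : (g x)%:Z * (x == y)%:Z = (g y)%:Z * (y == x)%:Z.
  by rewrite eq_sym; case: eqP => [->|_] //; rewrite !mulr0.
by rewrite /gform !alphaE !mulrBr (h i a) (h i b) (h j a) (h j b); ring.
Qed.

Lemma phase_wall_shift a b t X i j K :
  phase lq g i j (wall_shift a b t X) K = phase lq g i j X (K + t *: alpha a b).
Proof.
rewrite /phase qmon_wall_shift -mulrA -expfzDr // gformD gformZ gform_alpha_sym.
by rewrite addrC.
Qed.

Section OneWall.
Variables (a b : 'I_N) (s : nat) (X : X_).
Hypothesis ab : (a < b)%N.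
Hypothesis sm : (0 < s <= mu a b)%N.
Hypothesis Xab : qmon (alpha a b) X ^+ 2 = 1.

Let nab : a != b. Proof. by rewrite -val_eqE neq_ltn ab. Qed.

Lemma pair_factor_wall j t : j != a -> j != b ->
  pair_factor lq g mu a j (wall_shift a b t X) * pair_factor lq g mu b j (wall_shift a b t X) =
  pair_product a b j t (qmon (alpha a j) X) (qmon (alpha b a) X).
Proof.
move=> ja jb; have [aj bj] : a != j /\ b != j by rewrite ![_ == j]eq_sym.
have frac (z y : C) (e e' : int) : z != 0 -> p ^ e / (z * p ^ e') = p ^ (e - e') / z.
  by move=> z0; rewrite invfM mulrCA invr_expz mulrC -expfzDr.
have fa : gform g a b (alpha a j) = g a.
  by rewrite /gform alpha_l // alpha_o ?mulr1 ?mulr0 ?subr0 // eq_sym.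
have fb : gform g a b (alpha b j) = - (g b)%:Z.
  by rewrite /gform alpha_l // alpha_o ?mulr1 ?mulr0 ?sub0r.
rewrite /pair_factor !qmon_wall_shift fa fb; congr (_ * _); apply: eq_bigr => l _; congr br.
  by rewrite frac ?qmon_neq0 // PoszM.
have -> : alpha b j = alpha b a + alpha a j.
  by apply/rowP => i; rewrite mxE !alphaE; ring.
by rewrite frac ?qmon_neq0 // qmonDl PoszM mulrN opprK.
Qed.

Lemma pair_factor_wallV j t : j != a -> j != b ->
  pair_factor lq g mu j a (wall_shift a b t X) * pair_factor lq g mu j b (wall_shift a b t X) =
  pair_product a b j (- t) (qmon (alpha j a) X) (qmon (alpha a b) X).
Proof.
move=> ja jb.
have frac (z : C) (e e' : int) : z != 0 -> p ^ e / (z * p ^ e') = p ^ (e - e') / z.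
  by move=> z0; rewrite invfM mulrCA invr_expz mulrC -expfzDr.
have fa : gform g a b (alpha j a) = - (g a)%:Z.
  by rewrite /gform alpha_r // alpha_o ?mulrN1 ?mulr0 ?subr0 // eq_sym.
have fb : gform g a b (alpha j b) = g b.
  by rewrite /gform alpha_r // (@alpha_o _ j b a) ?mulrN1 ?mulr0 ?sub0r ?opprK // eq_sym.
rewrite /pair_factor !qmon_wall_shift fa fb /norm_factor !(mu_sym j).
congr (_ * _); apply: eq_bigr => l _; congr br.
  by rewrite frac ?qmon_neq0 // PoszM addnC mulrN mulNr.
have -> : alpha j b = alpha a b + alpha j a.
  by apply/rowP => i; rewrite mxE !alphaE; ring.
by rewrite frac ?qmon_neq0 // qmonDl PoszM addnC mulNr.
Qed.

Lemma vertex_coef_wall eta : eta 0 a = eta 0 b ->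
  vertex_coef lq g mu eta (wall_shift a b s%:Z X) =
  vertex_coef lq g mu eta (wall_shift a b (- s%:Z) X).
Proof.
move=> eab; have [s0 _] := andP sm.
have pairE j : j != a -> j != b ->
    pair_factor lq g mu a j (wall_shift a b s%:Z X) * pair_factor lq g mu b j (wall_shift a b s%:Z X) =
    pair_factor lq g mu a j (wall_shift a b (- s%:Z) X) *
    pair_factor lq g mu b j (wall_shift a b (- s%:Z) X).
  move=> ja jb; have e2 : qmon (alpha b a) X ^+ 2 = 1 by rewrite qmon_alphaV exprVn Xab invr1.
  have E := pair_productN ab ja jb sm (qmon_neq0 lq (alpha a j) X) e2.
  exact (etrans (pair_factor_wall s%:Z ja jb)
    (etrans E (esym (pair_factor_wall (- s%:Z) ja jb)))).
have pairVE j : j != a -> j != b ->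
    pair_factor lq g mu j a (wall_shift a b s%:Z X) * pair_factor lq g mu j b (wall_shift a b s%:Z X) =
    pair_factor lq g mu j a (wall_shift a b (- s%:Z) X) *
    pair_factor lq g mu j b (wall_shift a b (- s%:Z) X).
  move=> ja jb; have := pair_factor_wallV (- s%:Z) ja jb; rewrite opprK => EN.
  have E := pair_productN ab ja jb sm (qmon_neq0 lq (alpha j a) X) Xab.
  exact (etrans (pair_factor_wallV s%:Z ja jb) (etrans (esym E) (esym EN))).
have offE i j : i != a -> i != b -> j != a -> j != b ->
    pair_factor lq g mu i j (wall_shift a b s%:Z X) =
    pair_factor lq g mu i j (wall_shift a b (- s%:Z) X).
  move=> ia ib ja jb; rewrite /pair_factor !qmon_wall_shift.
  have -> : gform g a b (alpha i j) = 0.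
    by rewrite /gform !alpha_o ?mulr0 ?subrr // eq_sym.
  by rewrite !mulr0.
exact: (ordered_prod_eq nab eab pairE pairVE offE).
Qed.

(** By [phase_wall_shift], moving the point by [t alpha_ab / 2] and the exponents by [t alpha_ab]
    changes phases equally. So both terms of the wall difference satisfy string conditions with the
    phases at the unshifted [X], and they can be subtracted. *)
Lemma shifted_system supp' i j (r : nat) ka (t : int) : (i < j)%N -> (0 < r <= mu i j)%N ->
  uniq supp' -> (forall K, in_polytope mu (K - t *: alpha a b) -> K \in supp') ->
  \sum_(K <- supp' | key i j K == ka)
    c (K - t *: alpha a b) (wall_shift a b t X) * br (phase lq g i j X K ^+ r) = 0.
Proof.
move=> ij rm us hs; set d := t *: alpha a b; set Xt := wall_shift a b t X.
rewrite -[RHS](sysc (key i j (- d) + ka) Xt ij rm) [RHS]big_mkcond [LHS]big_mkcond /=.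
pose F K := if key i j K == ka then c (K - d) Xt * br (phase lq g i j X K ^+ r) else 0.
have F0 K : F K != 0 -> in_polytope mu (K - d).
  rewrite /F; case: ifP => _; last by rewrite eqxx.
  by have [//|nS] := pselect (in_polytope mu (K - d)); rewrite c_out // mul0r eqxx.
transitivity (\sum_(K <- [seq K + d | K <- supp]) F K).
  apply: sum_eq_support => // [|K /F0/hs //|K /F0/suppP KS].
    by rewrite map_inj_uniq //; exact: addIr.
  by apply/mapP; exists (K - d); rewrite ?subrK.
rewrite big_map; apply: eq_bigr => K _; rewrite /F addrK /Xt phase_wall_shift -/d.
congr (if _ then _ else _).
have -> : key i j (K + d) = key i j K - key i j (- d) by rewrite keyN opprK keyD.
by rewrite subr_eq addrC.
Qed.

Lemma wall_relation K :
  (forall i j, (i < j)%N -> (i, j) != (a, b) ->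
     forall k : int, qmon (alpha i j) X ^+ 2 * p ^ k != 1) ->
  c (K - s%:Z *: alpha a b) (wall_shift a b s%:Z X) =
  c (K + s%:Z *: alpha a b) (wall_shift a b (- s%:Z) X).
Proof.
move=> Xgen; set d := s%:Z *: alpha a b.
pose f K := c (K - d) (wall_shift a b s%:Z X) - c (K + d) (wall_shift a b (- s%:Z) X).
suff : f K = 0 by move=> /eqP; rewrite subr_eq0 => /eqP.
apply/eqP; apply/negP => /negP fK.
(* [eta] does not see the shift by [d] and asks for no strings along [alpha a b], the one root for
   which [X] is not generic; its face is the edge described by [edge_coefs_moved]. *)
pose eta := moved b (- (2 * (a : nat)%:Z)).
have eab : eta 0 a = eta 0 b by rewrite !mxE eqxx (negbTE nab).
have fP K' : f K' != 0 -> in_polytope mu (K' - d) \/ in_polytope mu (K' + d).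
  have [KS|nS] := pselect (in_polytope mu (K' - d)); first by left.
  have [KS|nS'] := pselect (in_polytope mu (K' + d)); first by right.
  by rewrite /f !c_out // subrr eqxx.
have dd : dotz eta d = 0 by rewrite dotzZr dotz_alpha eab subrr mulr0.
pose supp' := undup ([seq K + d | K <- supp] ++ [seq K - d | K <- supp]).
have usupp' : uniq supp' by exact: undup_uniq.
have inP K' : in_polytope mu (K' - d) -> K' \in supp'.
  move=> /suppP h; rewrite mem_undup mem_cat; apply/orP; left.
  by apply/mapP; exists (K' - d); rewrite ?subrK.
have inN K' : in_polytope mu (K' + d) -> K' \in supp'.
  move=> /suppP h; rewrite mem_undup mem_cat; apply/orP; right.
  by apply/mapP; exists (K' + d); rewrite ?addrK.
have fsupp K' : f K' != 0 -> K' \in supp' by case/fP => [/inP|/inN].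
have inN' K' : in_polytope mu (K' - (- s%:Z) *: alpha a b) -> K' \in supp'.
  by rewrite scaleNr opprK; exact: inN.
have par K' : f K' != 0 -> exists k : V, K' = rho2 mu + d + 2 *: k.
  case/fP => -[[k E] _].
    by exists k; rewrite addrAC -E subrK.
  have aux (z r k' K2 : V) : K2 + z = r + 2 *: k' -> K2 = r + z + 2 *: (k' - z).
    move=> E'; apply/rowP => i; move/rowP: E' => /(_ i); rewrite !mxE.
    by move: (K2 0 i) (z 0 i) (r 0 i) (k' 0 i) => x1 x2 x3 x4 h; rewrite mulrBr addrCA; move: (2 * x4) h => x5 h; clear -h; lia.
  by exists (k - d); exact: aux.
have full i j : (i < j)%N -> eta 0 i != eta 0 j -> full_string f i j (mu i j).
  move=> ij eij; have nij : i != j by rewrite -val_eqE neq_ltn ij.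
  have ne : (i, j) != (a, b) by apply: contraNneq eij => -[-> ->]; rewrite eab.
  have gen := Xgen i j ij ne.
  pose ph K' := phase lq g i j X K'.
  have ph0 K' : ph K' != 0 by rewrite mulf_neq0 ?qmon_neq0 ?expfz_neq0.
  apply: (@full_string_moments _ _ f supp' usupp' fsupp _ i j _
    (fun K' => br (ph K')) (fun K' => ph K' + (ph K')^-1) nij) => [K2 K3 f2 f3|K' _|K2 K3 _ _ kE wE|ka k km].
  - have [k2 ->] := par _ f2; have [k3 ->] := par _ f3.
    by exists (k3 - k2); rewrite scalerBr -[RHS]addrA [2 *: k2 + _]addrC subrK.
  - by rewrite br_eq0 // /ph /phase exprMn [(p ^ _) ^+ 2]exprnP exprz_exp; exact: gen.
  - have neq1 : ph K2 * ph K3 != 1 by rewrite /ph /phase mulrACA -expr2 -expfzDr //; exact: gen.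
    have := add_inv_inj (ph0 _) (ph0 _) wE neq1.
    move=> /(mulfI (qmon_neq0 lq (alpha i j) X)) /(nroot_inj p_neq0 p_nroot).
    exact: (gform_inj g_gt0 nij kE).
  - rewrite -big_filter; apply: (bracket_moments ph0) km => r rm.
    rewrite big_filter.
    have sys1 := shifted_system (t := s%:Z) ka ij rm usupp' inP.
    have sys2 := shifted_system (t := - s%:Z) ka ij rm usupp' inN'.
    have := congr2 (fun u v : C => u - v) sys1 sys2; rewrite subrr -sumrB => sys12.
    apply: etrans sys12; apply: eq_bigr => K' _.
    by rewrite scaleNr opprK -mulrBl.
have bnd K' : f K' != 0 -> `|dotz eta K'| <= width mu eta.
  case/fP => /(polytope_abs eta); rewrite ?dotzBr ?dotzDr dd ?subr0 ?addr0 //.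
have [K1 [fK1 EK1]] := width_attained fsupp fK full bnd.
have [r K1E] : exists r : int, K1 = face_centre mu eta + r *: alpha a b.
  have tP := moved_tie ab.
  case: (fP _ fK1) => KS; have := face_edge ab eab tP KS.
    rewrite dotzBr dd subr0 => /(_ EK1)[r [E _]]; exists (r + s%:Z).
    by rewrite scalerDl addrA -E subrK.
  rewrite dotzDr dd addr0 => /(_ EK1)[r [E _]]; exists (r - s%:Z).
  by rewrite scalerBl addrA -E addrK.
have edge k Y km := edge_coefs_moved lq0 p_nroot g_gt0 mu_sym g_mu usupp suppP sysc c_rho2
  c_out c_exp (k := k) Y ab km.
have node r' := @node_polytope N mu a b eta ab eab (moved_tie ab) r'.
have vc := vertex_coef_wall eab.
have [s0 sm'] := andP sm.
have yE t : qmon (alpha a b) (wall_shift a b t X) = qmon (alpha a b) X * p ^ (t * (g a + g b)%:Z).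
  by rewrite qmon_wall_shift gform_alpha.
have G0 : (0 < g a + g b)%N by rewrite addn_gt0 g_gt0.
have wall := edge_coef_wall p_neq0 p_nroot G0 Xab.
have nodeE (t k : int) : r + t = (mu a b)%:Z - 2 * k ->
    K1 + t *: alpha a b = face_centre mu eta + ((mu a b)%:Z - 2 * k) *: alpha a b.
  by move=> <-; rewrite K1E -addrA -scalerDl.
move: (fK1) => fK1'; move/eqP: fK1; apply; rewrite /f -scaleNr.
have both (k : nat) : (k + s <= mu a b)%N -> r + s%:Z = (mu a b)%:Z - 2 * k%:Z ->
    c (K1 + (- s%:Z) *: alpha a b) (wall_shift a b s%:Z X) -
    c (K1 + s%:Z *: alpha a b) (wall_shift a b (- s%:Z) X) = 0.
  move=> km rE; rewrite (nodeE s%:Z k rE) (nodeE (- s%:Z) (k + s)%:Z); last by clear -rE; lia.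
  rewrite (edge _ _ km) (edge k _ (leq_trans (leq_addr _ _) km)) !yE mulNr (wall _ _ _ km) vc.
  by rewrite subrr.
have out t Y : (forall k : nat, (k <= mu a b)%N -> r + t <> (mu a b)%:Z - 2 * k%:Z) ->
    c (K1 + t *: alpha a b) Y = 0.
  move=> ne; apply: c_out; rewrite K1E -addrA -scalerDl => /node[k [km E]].
  exact: (ne k km E).
(* If both shifts of [K1] are nodes of the edge, [edge_coef_wall] equates their coefficients.
   Otherwise the one node left is fewer than [s] steps from an end of the edge, where its
   coefficient vanishes on the wall. *)
case: (fP _ fK1') => KS.
  have [k [km rE]] : exists k : nat, (k <= mu a b)%N /\ r + - s%:Z = (mu a b)%:Z - 2 * k%:Z.
    by apply: node; rewrite -/eta scalerDl addrA -K1E scaleNr.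
  have [sk|ks] := leqP s k.
    by apply: (both (k - s)%N); [rewrite subnK|clear -sk rE; lia].
  rewrite (nodeE (- s%:Z) k rE) (edge k _ km) yE (edge_coef_wall_low _ p_neq0 Xab ks sm').
  rewrite mulr0 sub0r; apply/eqP; rewrite oppr_eq0; apply/eqP; apply: (out s%:Z) => k' _; clear -ks rE; lia.
have [k [km rE]] : exists k : nat, (k <= mu a b)%N /\ r + s%:Z = (mu a b)%:Z - 2 * k%:Z.
  by apply: node; rewrite -/eta scalerDl addrA -K1E.
have [ksm|ksm] := leqP (k + s) (mu a b); first exact: (both k).
rewrite (nodeE s%:Z k rE) (edge k _ km) yE mulNr (edge_coef_wall_high p_neq0 G0 Xab km ksm sm').
rewrite mulr0 subr0; apply: (out (- s%:Z)) => k' k'm; clear -ksm k'm rE; lia.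
Qed.

End OneWall.

(** On the wall [qmon M] depends only on [key a b M], so independence of characters splits
    [wall_relation] into one equation for each line parallel to the root. *)
Lemma coef_wall_system_transpose (A : V -> V -> C) (B : seq V) : uniq B ->
  (forall K M, A K M != 0 -> M \in B) ->
  (forall K M, A K M != 0 -> in_polytope mu M) ->
  (forall K X, c K X = \sum_(M <- B) A K M * qmon M X) ->
  wall_system g mu p supp (fun K M => A M K).
Proof.
move=> uB AB AM cE a b s ka K ab sm; set d := (2 * s%:Z) *: alpha a b.
have nab : a != b by rewrite -val_eqE neq_ltn ab.
(* Giving [b] the label of [a] puts [X0] on the wall of [alpha a b] and keeps it generic for all
   other roots. *)
have [X0 [X0e X0ne]] := generic_point lq0 (fun i => if i == b then a : nat else i).
have X0ab : qmon (alpha a b) X0 = 1.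
  by apply: X0e; rewrite eqxx (negbTE nab).
pose D M := A K M * p ^ (s%:Z * gform g a b M) - A (K + d) M * p ^ (- (s%:Z * gform g a b M)).
suff : \sum_(M <- B | key a b M == ka) D M = 0.
  rewrite sumrB => /eqP; rewrite subr_eq0 => /eqP E.
  have toB K' (w : V -> C) : \sum_(M <- supp | key a b M == ka) A K' M * w M =
      \sum_(M <- B | key a b M == ka) A K' M * w M.
    rewrite big_mkcond [RHS]big_mkcond /=; apply: sum_eq_support => // M.
      by case: ifP => _; rewrite ?eqxx // mulf_eq0 negb_or => /andP[/AM/suppP].
    by case: ifP => _; rewrite ?eqxx // mulf_eq0 negb_or => /andP[/AB].
  by rewrite !toB.
have indep Z : \sum_(M <- B) (D M * qmon (key a b M) X0) * p ^ (2 * dotz (key a b M) Z) = 0.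
  (* Copying the coordinate at [a] to [b] keeps the point on the wall; no freedom is lost, since
     keys have coordinate 0 at [b]. *)
  pose Z' : V := \row_i (if i == b then Z 0 a else Z 0 i).
  have Z'a : Z' 0 a = Z 0 a by rewrite mxE (negbTE nab).
  have Z'b : Z' 0 b = Z' 0 a by rewrite Z'a mxE eqxx.
  pose X := X0 + intv R Z'.
  have Xab : qmon (alpha a b) X = 1.
    by rewrite qmonDr X0ab qmon_intv dotzC dotz_alpha Z'b subrr mulr0 mulr1.
  have Xgen i j : (i < j)%N -> (i, j) != (a, b) -> forall k : int, qmon (alpha i j) X ^+ 2 * p ^ k != 1.
    move=> ij ne k; rewrite qmonDr qmon_intv exprMn -mulrA.
    have -> : (p ^ (2 * dotz (alpha i j) Z')) ^+ 2 * p ^ k = p ^ (2 * dotz (alpha i j) Z' * 2 + k).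
      by rewrite (expfzDr _ _ p_neq0) -[p ^ (_ * 2)]exprz_exp.
    apply: X0ne.
    case: (eqVneq i b) => [ib|nib]; case: (eqVneq j b) => [jb|njb].
    - by move: ij; rewrite ib jb ltnn.
    - by rewrite neq_ltn (ltn_trans ab) // -ib.
    - by apply: contraNneq ne => /val_inj ->; rewrite jb.
    - by rewrite neq_ltn ij.
  have keyX M : qmon M X = qmon (key a b M) X by rewrite qmonDl qmonZl Xab exp1rz mulr1.
  have keyZ M : dotz (key a b M) Z' = dotz (key a b M) Z.
    have kb : key a b M 0 b = 0.
      by rewrite !mxE alpha_r // mulrN1 subrr.
    rewrite /dotz; apply: eq_bigr => i _; rewrite [Z' 0 i]mxE; case: eqP => [->|//].
    by rewrite kb !mul0r.
  have Xab2 : qmon (alpha a b) X ^+ 2 = 1 by rewrite Xab expr1n.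
  have rel := wall_relation ab sm Xab2 (K + s%:Z *: alpha a b) Xgen.
  have KE : K + s%:Z *: alpha a b + s%:Z *: alpha a b = K + d.
    by rewrite -addrA -scalerDl; congr (_ + _ *: _); clear; lia.
  move: rel; rewrite addrK KE !cE => /eqP; rewrite -subr_eq0 -sumrB => /eqP rel.
  apply: etrans rel; apply: eq_bigr => M _.
  have shiftE t : qmon M (wall_shift a b t X) =
      qmon (key a b M) X0 * p ^ (2 * dotz (key a b M) Z) * p ^ (t * gform g a b M).
    by rewrite qmon_wall_shift keyX qmonDr qmon_intv keyZ.
  rewrite !shiftE /D mulNr.
  by move: (qmon _ _) (p ^ _) (p ^ _) (p ^ _) => u1 u2 u3 u4; ring.
have := exp_indep p_nroot indep ka.
rewrite (eq_bigr (fun M => D M * qmon ka X0)) => [|M /eqP ->] //.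
rewrite -mulr_suml => /eqP; rewrite mulf_eq0 (negbTE (qmon_neq0 _ _ _)) orbF.
by move/eqP.
Qed.

Hypothesis c_cont : forall K, line_continuous (c K).

Theorem coef_symmetric : exists A : V -> V -> C, (forall K M, A K M = A M K) /\
  forall K X, c K X = \sum_(M <- supp) A K M * qmon M X.
Proof.
have [A [B [uB AB AK cE]]] := coef_matrix lq0 p_nroot g_gt0 usupp suppP sysc c_rho2 c_cont c_out.
have sys := coef_wall_system p_nroot sysc uB AB cE.
have AM : forall K M, A K M != 0 -> in_polytope mu M.
  apply: (wall_system_polytope g_gt0 p_neq0 p_nroot usupp (fun K h => (suppP K).2 h) sys AK AB).
  by move=> M; exact: (coef_rho2_polytope p_nroot c_rho2 uB AB cE).
exists A; split.
  exact: (wall_system_sym g_gt0 p_neq0 p_nroot usupp (fun K h => (suppP K).2 h) sys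
    (coef_wall_system_transpose uB AB AM cE) AK AM).
move=> K X; rewrite cE; apply: sum_eq_support => // M; rewrite mulf_eq0 negb_or => /andP[] //.
  by move=> /AB.
by move=> /AM/suppP.
Qed.

End Walls.

(** * The deformed root system *)

Section DeformedRoots.
Variables (R : realType) (n m : nat).
Hypothesis m_gt0 : (0 < m)%N.
Local Notation I := 'I_n.+1.
Local Notation C := R[i].
Local Notation V := 'rV[int]_n.+1.
Local Notation X_ := 'rV[R[i]]_n.+1.
Local Notation RV := 'rV[R]_n.+1.
Implicit Types (a b i j : I) (K Z u : V) (x z X : X_).

Definition weight (i : I) : nat := if i == ord_max then m else 1.

Definition edge_mult (i j : I) : nat := if (i == ord_max) || (j == ord_max) then 1 else m.

(* [q] is [p = q^(1/2)], [y] is [q^((alpha_aj, x))], [e = +-1]; when [b] is the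
   last index both sides telescope to the same product of [m + 1] brackets. *)
Lemma pair_productN (lq : C) (a b j : I) (s : nat) (y e : C) : (a < b)%N -> j != a -> j != b ->
  (0 < s <= edge_mult a b)%N -> y != 0 -> e ^+ 2 = 1 ->
  pair_product lq weight edge_mult a b j s%:Z y e =
  pair_product lq weight edge_mult a b j (- s%:Z) y e.
Proof.
move=> ab ja jb sm y0 e2.
have e0 : e != 0 by apply: contra_eq_neq e2 => ->; rewrite expr0n eq_sym oner_eq0.
have eV : e^-1 = e by apply: (mulfI e0); rewrite divff // -expr2 e2.
have bre (w : C) : br (w / (e * y)) = e * br (w / y).
  by rewrite /br !invfM !invrK eV; ring.
have aN : a != ord_max by rewrite -val_eqE neq_ltn (leq_trans ab) // -ltnS.
have swap (k : nat) (f f' : nat -> C) :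
    (\prod_(1 <= l < k) f l) * (\prod_(1 <= l < k) (e * f' l)) =
    (\prod_(1 <= l < k) f' l) * (\prod_(1 <= l < k) (e * f l)).
  by rewrite !big_split /=; ring.
have prE t : pair_product lq weight edge_mult a b j t y e =
    (\prod_(1 <= l < (edge_mult a j).+1)
       br (sqrtq lq ^ (l%:Z * (weight a + weight j)%:Z - t * (weight a)%:Z) / y)) *
    (\prod_(1 <= l < (edge_mult b j).+1)
       (e * br (sqrtq lq ^ (l%:Z * (weight b + weight j)%:Z + t * (weight b)%:Z) / y))).
  by congr (_ * _); apply: eq_bigr => l _; exact: bre.
rewrite !prE.
have [bN|bN] := eqVneq b ord_max.
  have s1 : s = 1%N by move: sm; rewrite /edge_mult bN eqxx orbT; clear; lia.
  have jN : j != ord_max by rewrite -bN.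
  rewrite /edge_mult /weight bN eqxx (negbTE aN) (negbTE jN) /= s1 !big_nat1.
  pose f (k : nat) := br (sqrtq lq ^ ((2 * k + 1)%N : int) / y).
  have lowE : \prod_(1 <= l < m.+1) br (sqrtq lq ^ (l%:Z * (1 + 1)%:Z - 1%:Z * 1%:Z) / y) =
      \prod_(0 <= k < m) f k.
    by rewrite big_add1; apply: eq_bigr => k _; congr (br (_ ^ _ / _)); clear; lia.
  have highE : \prod_(1 <= l < m.+1) br (sqrtq lq ^ (l%:Z * (1 + 1)%:Z - - 1%:Z * 1%:Z) / y) =
      \prod_(0 <= k < m) f k.+1.
    by rewrite big_add1; apply: eq_bigr => k _; congr (br (_ ^ _ / _)); clear; lia.
  rewrite lowE highE.
  have -> : 1%:Z * (m + 1)%:Z + 1%:Z * m%:Z = (2 * m + 1)%N by clear; lia.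
  have -> : 1%:Z * (m + 1)%:Z + - 1%:Z * m%:Z = (2 * 0 + 1)%N by clear; lia.
  rewrite -/(f m) -/(f 0%N) !mulrA ![_ * e]mulrC -!mulrA; congr (_ * _).
  by rewrite -big_nat_recr // [RHS]mulrC -big_nat_recl.
have wab : weight a = 1%N /\ weight b = 1%N by rewrite /weight (negbTE aN) (negbTE bN).
have -> : edge_mult a j = edge_mult b j by rewrite /edge_mult (negbTE aN) (negbTE bN).
case: wab => -> ->; rewrite swap; congr (_ * _); apply: eq_bigr => l _; last by rewrite mulNr.
by rewrite mulNr opprK.
Qed.

Lemma weight_gt0 i : (0 < weight i)%N.
Proof. by rewrite /weight; case: ifP. Qed.

Lemma edge_mult_sym i j : edge_mult i j = edge_mult j i.
Proof. by rewrite /edge_mult orbC. Qed.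

(** This links the multiplicities to the lengths of the deformed roots: when one of [a], [b] is the
    last index, both sides are [m], once as squared length and once as multiplicity. *)
Lemma weight_edge_mult a b i : a != b -> i != a -> i != b ->
  (weight a * edge_mult a i)%N = (weight b * edge_mult b i)%N.
Proof.
rewrite /weight /edge_mult => ab ia ib.
case: (eqVneq i ord_max) => iN; first by rewrite -iN ![_ == i]eq_sym (negbTE ia) (negbTE ib).
case: (eqVneq a ord_max) => aN; case: (eqVneq b ord_max) => bN //=; rewrite ?muln1 ?mul1n //.
Qed.

Definition length i : R := if i == ord_max then sqm R m else 1.

Lemma sqr_length i : length i ^+ 2 = (weight i)%:R.
Proof.
rewrite /length /weight; case: ifP => _; last by rewrite expr1n.
by rewrite sqr_sqrtr ?ler0n.
Qed.

Lemma length_neq0 i : length i != 0.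
Proof. by rewrite -sqrf_eq0 sqr_length pnatr_eq0 -lt0n weight_gt0. Qed.

(* [p_i = e_i] for [i <= n] and [p_(n+1) = sqrt m e_(n+1)] *)
Definition latt K : RV := \row_i ((K 0 i)%:~R * length i).

Lemma lattD K K' : latt (K + K') = latt K + latt K'.
Proof. by apply/rowP => i; rewrite !mxE intrD mulrDl. Qed.

Lemma lattZ (k : int) K : latt (k *: K) = k%:~R *: latt K.
Proof. by apply/rowP => i; rewrite !mxE intrM mulrA. Qed.

Lemma latt_inj : injective latt.
Proof.
move=> K K' E; apply/rowP => i; move/rowP: E => /(_ i); rewrite !mxE.
by move=> /(mulIf (length_neq0 i)) /intr_inj.
Qed.

Lemma latt0 : latt 0 = 0.
Proof. by apply/rowP => i; rewrite !mxE mul0r. Qed.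

Lemma latt_sum (J : Type) (s : seq J) (Q : pred J) (f : J -> V) :
  latt (\sum_(j <- s | Q j) f j) = \sum_(j <- s | Q j) latt (f j).
Proof. exact: (big_morph latt lattD latt0). Qed.

Definition hat x : X_ := \row_i ((length i)%:C * x 0 i).

Definition unhat X : X_ := \row_i (X 0 i / (length i)%:C).

Lemma lengthC_neq0 i : (length i)%:C != 0 :> C.
Proof. by rewrite fmorph_eq0 length_neq0. Qed.

Lemma hatK : cancel hat unhat.
Proof. by move=> x; apply/rowP => i; rewrite !mxE mulrAC divff ?mul1r ?lengthC_neq0. Qed.

Lemma unhatK : cancel unhat hat.
Proof. by move=> x; apply/rowP => i; rewrite !mxE mulrC divfK ?lengthC_neq0. Qed.

Lemma dotC_latt K x : dotC (cvec (latt K)) x = \sum_i (K 0 i)%:~R * hat x 0 i.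
Proof.
by apply: eq_bigr => i _; rewrite !mxE rmorphM rmorph_int mulrA.
Qed.

Lemma qmon_latt lq K x : qpow lq (2 * dotC (cvec (2^-1 *: latt K)) x) = qmon lq K (hat x).
Proof.
rewrite /qmon -dotC_latt; congr qpow.
rewrite /dotC mulr_sumr; apply: eq_bigr => i _; rewrite !mxE rmorphM /= mulrA mulrA.
by rewrite fmorphV rmorph_nat divff ?mul1r // pnatr_eq0.
Qed.

Lemma latt_delta i : latt (delta_mx 0 i) = length i *: delta_mx 0 i.
Proof.
by apply/rowP => j; rewrite !mxE eqxx /=; case: eqP => [->|]; rewrite ?mul1r ?mulr1 ?mul0r ?mulr0.
Qed.

Lemma latt_alpha a b : latt (alpha a b) = length a *: delta_mx 0 a - length b *: delta_mx 0 b.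
Proof. by rewrite unlock lattD -scaleN1r lattZ !latt_delta scaleN1r. Qed.

Lemma big_Rplus (T : Type) (idx : T) (op : Monoid.com_law idx) (F : RV -> T) :
  \big[op/idx]_(r <- Rplus R n m) F r =
  \big[op/idx]_(q : I * I | (q.1 < q.2)%N) F (latt (alpha q.1 q.2)).
Proof.
rewrite big_cat /= big_image big_image /=.
rewrite -(pair_big_dep xpredT (fun i j : I => (i < j)%N) (fun i j => F (latt (alpha i j)))) /=.
rewrite big_ord_recr /= [X in _ = op _ X]big_pred0 => [|j]; last by rewrite /= ltnNge -ltnS ltn_ord.
rewrite Monoid.mulm1.
rewrite -(pair_big_dep xpredT (fun i j : 'I_n => (i < j)%N) (fun i j : 'I_n => F (ee R i - ee R j))) /=.
rewrite -big_split /=; apply: eq_bigr => i _.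
have wN (k : 'I_n) : (widen_ord (leqnSn n) k == ord_max) = false.
  by rewrite -val_eqE /= ltn_eqF.
rewrite [RHS]big_mkcond big_ord_recr /= ltn_ord -big_mkcond /=; congr (op _ _).
  by apply: eq_bigr => j _; rewrite latt_alpha /length !wN !scale1r.
by rewrite latt_alpha /length wN eqxx scale1r.
Qed.

Lemma ord_neq_max a : a != ord_max -> exists i : 'I_n, a = widen_ord (leqnSn n) i.
Proof.
move=> aN; have lt : (a < n)%N by rewrite ltn_neqAle -ltnS ltn_ord andbT; move: aN; rewrite -val_eqE.
by exists (Ordinal lt); apply: val_inj.
Qed.

Lemma ltn_neq_max a b : (a < b)%N -> a != ord_max.
Proof. by move=> ab; rewrite -val_eqE neq_ltn (leq_trans ab) // -ltnS. Qed.

Lemma latt_widen (i j : 'I_n) :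
  latt (alpha (widen_ord (leqnSn n) i) (widen_ord (leqnSn n) j)) = ee R i - ee R j.
Proof. by rewrite latt_alpha /length -!val_eqE /= !ltn_eqF // !scale1r. Qed.

Lemma latt_last (i : 'I_n) :
  latt (alpha (widen_ord (leqnSn n) i) ord_max) = ee R i - sqm R m *: elast R n.
Proof. by rewrite latt_alpha /length eqxx -val_eqE /= ltn_eqF // scale1r. Qed.

Lemma latt_alpha_R0 a b : (a < b)%N -> (latt (alpha a b) \in R0 R n) = (b != ord_max).
Proof.
move=> ab; have [i aE] := ord_neq_max (ltn_neq_max ab); case: (eqVneq b ord_max) => [bE|bN] /=.
  have R0z v : v \in R0plus R n -> v 0 ord_max = 0.
    case/mapP => -[k l] _ -> /=; rewrite !mxE /= -!val_eqE /= !gtn_eqF ?subrr //; exact: ltn_ord.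
  apply/negP; rewrite mem_cat => vR; have : latt (alpha a b) 0 ord_max == 0.
    case/orP: vR => [/R0z -> //|/mapP[v /R0z v0 ->]]; by rewrite mxE v0 oppr0.
  rewrite mxE bE alpha_r; last by rewrite -bE -val_eqE neq_ltn ab.
  by rewrite mulN1r oppr_eq0 (negbTE (length_neq0 _)).
have [j bE] := ord_neq_max bN.
rewrite aE bE latt_widen mem_cat; apply/orP; left.
apply/mapP; exists (i, j) => //.
by rewrite mem_enum inE /=; move: ab; rewrite aE bE.
Qed.

Lemma latt_alpha_Rplus a b : (a < b)%N -> latt (alpha a b) \in Rplus R n m.
Proof.
move=> ab; have [i aE] := ord_neq_max (ltn_neq_max ab); rewrite mem_cat.
case: (eqVneq b ord_max) => [bE|bN].
  by apply/orP; right; apply/mapP; exists i; rewrite ?mem_enum // aE bE latt_last.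
have [j bE] := ord_neq_max bN.
apply/orP; left; apply/mapP; exists (i, j); last by rewrite aE bE latt_widen.
by rewrite mem_enum inE /=; move: ab; rewrite aE bE.
Qed.

Lemma mult_latt a b : (a < b)%N -> mult m (latt (alpha a b)) = edge_mult a b.
Proof.
move=> ab; rewrite /mult latt_alpha_R0 // /edge_mult.
by rewrite (negbTE (ltn_neq_max ab)) /=; case: eqP.
Qed.

Lemma rho_latt : rho R n m = 2^-1 *: latt (rho2 edge_mult).
Proof.
rewrite /rho big_Rplus latt_sum; congr (_ *: _); apply: eq_bigr => q lt.
by rewrite mult_latt // lattZ.
Qed.

Definition coord u (v : RV) : R := \sum_i (u 0 i)%:~R * (v 0 i / length i).

Lemma coord_latt u K : coord u (latt K) = (dotz u K)%:~R.
Proof.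
rewrite /coord /dotz rmorph_sum; apply: eq_bigr => i _ /=.
by rewrite mxE mulfK ?length_neq0 // intrM.
Qed.

Lemma coordD u v w : coord u (v + w) = coord u v + coord u w.
Proof. by rewrite -big_split; apply: eq_bigr => i _ /=; rewrite mxE mulrDl mulrDr. Qed.

Lemma coordZ u k v : coord u (k *: v) = k * coord u v.
Proof. by rewrite mulr_sumr; apply: eq_bigr => i _; rewrite mxE; ring. Qed.

Lemma coord_sum u (J : Type) (s : seq J) (Q : pred J) (f : J -> RV) :
  coord u (\sum_(j <- s | Q j) f j) = \sum_(j <- s | Q j) coord u (f j).
Proof.
apply: (big_morph (coord u) (coordD u)).
by rewrite /coord big1 // => i _; rewrite mxE mul0r mulr0.
Qed.

Lemma suppN_latt v : suppN m v ->
  exists K, v = 2^-1 *: latt K /\ in_polytope edge_mult K.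
Proof.
move=> [[k [l vE]] [h [h01 hE]]].
pose k' : V := \row_i (if insub (val i) is Some j then k j else l).
have kE : v - rho R n m = latt k'.
  rewrite vE; apply/rowP => i; rewrite !mxE summxE.
  case: (insubP 'I_n (val i)) => [j jn jE|]; rewrite /length.
    have iE : i = widen_ord (leqnSn n) j by apply: val_inj.
    rewrite iE -!val_eqE /= !ltn_eqF // (bigD1 j) //= big1 => [|j'].
      by rewrite !mxE -!val_eqE /= !eqxx mulr0 !addr0.
    by rewrite eq_sym -val_eqE !mxE -!val_eqE /= => /negbTE ->; rewrite mulr0.
  rewrite -leqNgt => ni.
  have iE : i = ord_max by apply: val_inj; apply/eqP; rewrite eqn_leq ni -ltnS ltn_ord.
  rewrite iE !eqxx big1 ?add0r ?mulr1 // => j _.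
  by rewrite !mxE -!val_eqE /= gtn_eqF ?mulr0.
have vK : v = 2^-1 *: latt (rho2 edge_mult + 2 *: k').
  rewrite lattD lattZ scalerDr -rho_latt scalerA mulVf ?scale1r ?pnatr_eq0 //.
  by rewrite -kE addrC subrK.
exists (rho2 edge_mult + 2 *: k'); split=> //; split=> [|u]; first by exists k'.
rewrite -(ler_int R) -coord_latt.
have -> : latt (rho2 edge_mult + 2 *: k') = 2 *: v.
  by rewrite vK scalerA divff ?scale1r ?pnatr_eq0.
rewrite hE !big_Rplus coordZ coordD coord_sum -scaleN1r coordZ rho_latt coordZ coord_latt.
rewrite dotz_sumr /width !rmorph_sum /=.
(* Doubling turns the point of the polytope into the combination of roots with coefficients
   [2 h - mult], each between [- mult] and [mult]. *)
rewrite mulrDr mulN1r mulrN mulrA divff ?mul1r ?pnatr_eq0 // -sumrN mulr_sumr -big_split /=.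
apply: ler_sum => q lt.
have /h01 := latt_alpha_Rplus lt; rewrite mult_latt // => /andP[h0 h1].
rewrite dotzZr dotz_alpha coordZ coord_latt dotz_alpha !intrM intr_norm.
move: (h _) (_ - _) h0 h1 => t w; rewrite -[(_ %:Z)%:~R]/(_%:R).
move: (_%:~R) ((edge_mult _ _)%:R) => w' mm t0 tm.
by have [w0|w0] := ler0P w'; nra.
Qed.

Lemma suppN_rho : suppN m (rho R n m).
Proof.
split; first by exists (fun _ => 0), 0; rewrite subrr big1 ?mul0r ?scale0r ?addr0 // => i _; rewrite scale0r.
exists (fun v => (mult m v)%:R); split=> [v _|]; first by rewrite ler0n lexx.
rewrite -[X in _ + X]/(\sum_(r <- Rplus R n m) (mult m r)%:R *: r).
have -> : \sum_(r <- Rplus R n m) (mult m r)%:R *: r = 2 *: rho R n m.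
  by rewrite /rho scalerA divff ?scale1r ?pnatr_eq0.
by rewrite scaler_nat mulr2n addKr.
Qed.

End DeformedRoots.

(** * From the Baker-Akhiezer conditions to string conditions *)

Section BakerAkhiezer.
Variables (R : realType) (n m : nat) (lq : R[i]).
Hypothesis m_gt0 : (0 < m)%N.
Local Notation I := 'I_n.+1.
Local Notation C := R[i].
Local Notation V := 'rV[int]_n.+1.
Local Notation X_ := 'rV[R[i]]_n.+1.
Local Notation g := (@weight n m).
Local Notation mu := (@edge_mult n m).
Local Notation hat := (@hat R n m).
Local Notation unhat := (@unhat R n m).
Local Notation latt := (@latt R n m).
Local Notation qp := (qpow lq).
Local Notation p := (sqrtq lq).
Local Notation qmon := (qmon lq).
Implicit Types (a b i j : I) (K Z u : V) (x z X : X_).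

Variables (c : 'rV[R]_n.+1 -> X_ -> C) (Psi : X_ -> X_ -> C).
Hypothesis p_nroot : forall j : int, j != 0 -> p ^ j != 1.
Hypothesis PsiE : BA_expansion m lq c Psi.
Hypothesis Psi0 : BA_R0_conditions m lq Psi.
Hypothesis Psi1 : BA_R1_conditions m lq Psi.
Hypothesis c_cont : forall nu, suppN m nu -> continuous (c nu : 'rV[R[i]^o]_n.+1 -> R[i]^o).
Hypothesis c_rho : forall x, c (rho R n m) x = BA_norm m lq x.
Variables (supp : seq V).
Hypothesis usupp : uniq supp.
Hypothesis suppP : forall K, K \in supp <-> in_polytope mu K.

Let p_neq0 : p != 0 := sqrtq_neq0 lq.

(** Extension by zero gives a function on the whole integer lattice; [unhat] recovers [x] from the
    coordinates [(p_i, x)]. *)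
Definition coef K X : C :=
  if `[< suppN m (2^-1 *: latt K) >] then c (2^-1 *: latt K) (unhat X) else 0.

Let half_latt_inj : injective (fun K => 2^-1 *: latt K).
Proof.
move=> K K' /(congr1 (fun v => 2 *: v)); rewrite !scalerA divff ?scale1r ?pnatr_eq0 //.
exact: latt_inj.
Qed.

Lemma expansion_coef x z : Psi x z =
  qp (2 * dotC x z) * \sum_(K <- supp) coef K (hat x) * qmon K (hat z).
Proof.
rewrite PsiE; congr (_ * _).
pose r := [seq 2^-1 *: latt K | K <- supp & `[< suppN m (2^-1 *: latt K) >]].
have rP v : suppN m v -> v \in r.
  move=> Sv; have [K [vE KP]] := suppN_latt m_gt0 Sv; apply/mapP; exists K => //.
  by rewrite mem_filter -vE; apply/andP; split; [apply/asboolP|apply/suppP].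
rewrite (@fsbigE _ _ _ _ _ r) => [||v|v Sv]; last 1 first.
- by rewrite (rP _ Sv).
- rewrite big_map big_filter_cond big_mkcond /=; apply: eq_bigr => K _.
  rewrite /coef; case: asboolP => S /=; last by rewrite mul0r.
  by rewrite mem_set // hatK // qmon_latt.
- by rewrite map_inj_uniq // filter_uniq.
by move=> /mapP[K]; rewrite mem_filter => /andP[/asboolP S _] ->.
Qed.

Lemma coef_out K : ~ in_polytope mu K -> forall X, coef K X = 0.
Proof.
move=> nK X; rewrite /coef; case: asboolP => // S.
have [K' [/half_latt_inj E KP]] := suppN_latt m_gt0 S.
by case: nK; rewrite E.
Qed.

Lemma hatD x z : hat (x + z) = hat x + hat z.
Proof. by apply/rowP => i; rewrite !mxE mulrDr. Qed.

Lemma unhatD X Y : unhat (X + Y) = unhat X + unhat Y.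
Proof. by apply/rowP => i; rewrite !mxE mulrDl. Qed.

Lemma unhatZ k X : unhat (k *: X) = k *: unhat X.
Proof. by apply/rowP => i; rewrite !mxE mulrA. Qed.

Lemma coef_line_continuous K : line_continuous (coef K).
Proof.
move=> X Y; rewrite /coef; case: asboolP => S; last exact: cvg_cst.
under eq_fun do rewrite unhatD unhatZ.
pose f (t : R) : 'rV[R[i]^o]_n.+1 := unhat X + t%:C *: unhat Y.
suff h : f @ (0 : R) --> (unhat X : 'rV[R[i]^o]_n.+1).
  exact: (cvg_comp _ _ h (@c_cont _ S (unhat X))).
have -> : unhat X = unhat X + (0 : R)%:C *: unhat Y by rewrite scale0r addr0.
apply: cvgD; first exact: cvg_cst.
apply: cvgZr_tmp; exact: real_complex_continuous.
Qed.

Lemma coef_rho2 X : coef (rho2 mu) X = norm_coef lq g mu X.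
Proof.
have E : 2^-1 *: latt (rho2 mu) = rho R n m by rewrite rho_latt.
rewrite /coef E asboolT; last exact: suppN_rho.
rewrite c_rho /BA_norm big_Rplus; apply: eq_bigr => q lt; rewrite mult_latt //.
apply: eq_big_nat => l _; have nq : q.1 != q.2 by rewrite -val_eqE neq_ltn lt.
set al := alpha q.1 q.2.
have dx x : dotC (cvec (latt al)) x = hat x 0 q.1 - hat x 0 q.2.
  rewrite dotC_latt (bigD1 q.1) //= (bigD1 q.2) /= 1?eq_sym // big1 => [|i /andP[i1 i2]].
    by rewrite alpha_l // alpha_r // mul1r mulN1r addr0.
  by rewrite alpha_o // mul0r.
have hl i : hat (cvec (latt al)) 0 i = (al 0 i)%:~R * (g i)%:R.
  rewrite !mxE rmorphM rmorph_int /= mulrCA -rmorphM -expr2 sqr_length.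
  by rewrite rmorph_nat.
have -> : dotC (cvec (latt al)) ((l%:R / 2) *: cvec (latt al) - unhat X) =
    ((l * (g q.1 + g q.2))%N%:Z)%:~R / 2 - (X 0 q.1 - X 0 q.2).
  transitivity ((l%:R / 2) * dotC (cvec (latt al)) (cvec (latt al)) - dotC (cvec (latt al)) (unhat X)).
    rewrite /dotC mulr_sumr -sumrB; apply: eq_bigr => i _; rewrite !mxE; ring.
  rewrite !dx unhatK // !hl alpha_l // alpha_r // -[(_%:Z)%:~R]/(_%:R).
  by rewrite natrM natrD; ring.
by rewrite /qbr qpowN /br qpowD qpow_half_int qpowN qmon_alpha.
Qed.

(** One form for both kinds of condition: [s (g_a - g_b)] is zero for a root of [R0], and for a root
    of [R1], where [s = 1], it is [1 - m]. *)
Lemma shift_relation a b s x z : (a < b)%N -> (0 < s <= mu a b)%N ->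
  qp (s%:R * ((g a)%:R - (g b)%:R) + 2 * hat z 0 a) = qp (2 * hat z 0 b) ->
  Psi x (z + s%:R *: cvec (latt (delta_mx 0 a))) =
  Psi x (z + s%:R *: cvec (latt (delta_mx 0 b))).
Proof.
move=> ab sm; have aN := ltn_neq_max ab; have [i aE] := ord_neq_max aN.
have da : latt (delta_mx 0 a) = ee R i.
  by rewrite latt_delta /length (negbTE aN) scale1r aE.
have hatE k : hat z 0 k = dotC (cvec (latt (delta_mx 0 k))) z.
  rewrite dotC_latt (bigD1 k) //= big1 => [|k' /negbTE k'k]; first by rewrite !mxE !eqxx mul1r addr0.
  by rewrite mxE k'k andbF mul0r.
rewrite !hatE da; case: (eqVneq b ord_max) => [bE|bN].
  have s1 : s = 1%N by move: sm; rewrite /edge_mult bE eqxx orbT; clear; lia.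
  have db : cvec (latt (delta_mx 0 b)) = (sqm R m)%:C *: cvec (elast R n).
    by apply/rowP => k; rewrite latt_delta /length bE eqxx !mxE rmorphM.
  rewrite s1 !scale1r db => E; apply: Psi1.
  apply: etrans (etrans E _); congr qpow.
    by rewrite mul1r /weight (negbTE aN) bE eqxx.
  rewrite -mulrA; congr (_ * _); rewrite /dotC mulr_sumr; apply: eq_bigr => k _.
  by rewrite !mxE mulrA.
have [j bE] := ord_neq_max bN.
have db : latt (delta_mx 0 b) = ee R j by rewrite latt_delta /length (negbTE bN) scale1r bE.
rewrite db /weight (negbTE aN) (negbTE bN) subrr mulr0 add0r => E; apply: Psi0 => //.
  by move: ab; rewrite aE bE.
by move: sm; rewrite /edge_mult (negbTE aN) (negbTE bN).
Qed.

Lemma coef_string_system : string_system lq g mu supp coef.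
Proof.
move=> a b s ka X ab sm.
have nab : a != b by rewrite -val_eqE neq_ltn ab.
set y := qmon (alpha a b) X.
pose D K := coef K X * br (phase lq g a b X K ^+ s).
(* The extra power of [p] depends on [K] only through its key, so it is constant on each line and is
   divided out once [exp_indep] has separated the lines. *)
suff H Z : \sum_(K <- supp) (D K * p ^ (s%:Z * (g a)%:Z * key a b K 0 a)) *
    p ^ (2 * dotz (key a b K) Z) = 0.
  have := exp_indep p_nroot H ka.
  rewrite (eq_bigr (fun K => D K * p ^ (s%:Z * (g a)%:Z * ka 0 a))) => [|K /eqP ->] //.
  rewrite -mulr_suml => /eqP; rewrite mulf_eq0 (negbTE (expfz_neq0 _ p_neq0)) orbF.
  by move/eqP.
pose Z' : V := \row_i (if i == b then Z 0 a else Z 0 i).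
have Z'a : Z' 0 a = Z 0 a by rewrite mxE (negbTE nab).
have Z'b : Z' 0 b = Z' 0 a by rewrite Z'a mxE eqxx.
have keyZ K : dotz K Z' = dotz (key a b K) Z.
  rewrite dotzC -(dotz_key _ (esym Z'b)) dotzC.
  have kb : key a b K 0 b = 0 by rewrite !mxE alpha_r // mulrN1 subrr.
  rewrite /dotz; apply: eq_bigr => i _; rewrite [Z' 0 i]mxE; case: eqP => [->|//].
  by rewrite kb !mul0r.
pose dg : int := (g a)%:Z - (g b)%:Z.
(* The shift of the coordinate at [b] by [s (g_a - g_b) / 2] places [W] on the hyperplane where
   [shift_relation] applies. *)
pose W : X_ := intv R Z' + ((s%:Z * dg)%:~R / 2) *: delta_mx 0 b.
have Wa : W 0 a = (Z' 0 a)%:~R by rewrite !mxE (negbTE nab) andbF mulr0 addr0.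
have Wb : W 0 b = (Z' 0 a)%:~R + (s%:Z * dg)%:~R / 2 by rewrite -Z'b !mxE !eqxx mulr1.
have rel : qp (s%:R * ((g a)%:R - (g b)%:R) + 2 * hat (unhat W) 0 a) = qp (2 * hat (unhat W) 0 b).
  rewrite unhatK // Wa Wb; congr qpow.
  rewrite /dg intrM intrB -[s%:Z%:~R]/(s%:R) -[(g a)%:Z%:~R]/((g a)%:R) -[(g b)%:Z%:~R]/((g b)%:R).
  by field.
have := shift_relation (unhat X) ab sm rel.
have dotE (k : I) : 2 * dotC (unhat X) (unhat W + s%:R *: cvec (latt (delta_mx 0 k))) =
    2 * dotC (unhat X) (unhat W) + 2 * s%:R * X 0 k.
  have XkE : dotC (cvec (latt (delta_mx 0 k))) (unhat X) = X 0 k.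
    rewrite dotC_latt unhatK // (bigD1 k) //= big1 => [|k' /negbTE k'k].
      by rewrite !mxE !eqxx mul1r addr0.
    by rewrite mxE k'k andbF mul0r.
  rewrite -XkE -mulrA -mulrDr; congr (_ * _); rewrite /dotC mulr_sumr -big_split /=.
  by apply: eq_bigr => i _; rewrite !mxE; ring.
have hatW (k : I) K : qmon K (hat (unhat W + s%:R *: cvec (latt (delta_mx 0 k)))) =
    p ^ (2 * dotz (key a b K) Z) * p ^ (s%:Z * dg * K 0 b) * p ^ (2 * s%:Z * (g k)%:Z * K 0 k).
  have -> : hat (unhat W + s%:R *: cvec (latt (delta_mx 0 k))) = W + (s%:R * (g k)%:R) *: delta_mx 0 k.
    rewrite hatD unhatK //; congr (_ + _); apply/rowP => i; rewrite latt_delta !mxE eqxx /=.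
    case: eqP => [->|_]; last by rewrite !mulr0.
    by rewrite !mulr1 mulrCA -rmorphM -expr2 sqr_length rmorph_nat.
  have deltaE (j : I) : \sum_i (K 0 i)%:~R * (delta_mx 0 j : X_) 0 i = (K 0 j)%:~R.
    rewrite (bigD1 j) //= big1 => [|i /negbTE ij]; first by rewrite !mxE !eqxx mulr1 addr0.
    by rewrite mxE ij andbF mulr0.
  rewrite !qmonDr !qmonZr !deltaE qmon_intv keyZ; congr (_ * _ * _).
    by rewrite -qpow_half_int !intrM mulrAC.
  rewrite -qpow_half_int !intrM -[s%:Z%:~R]/(s%:R) -[(g k)%:Z%:~R]/((g k)%:R).
  by congr qpow; field.
have sideE (k : I) : Psi (unhat X) (unhat W + s%:R *: cvec (latt (delta_mx 0 k))) =
    qp (2 * dotC (unhat X) (unhat W)) * (qp (2 * s%:R * X 0 k) *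
    \sum_(K <- supp) coef K X *
      (p ^ (2 * dotz (key a b K) Z) * p ^ (s%:Z * dg * K 0 b) * p ^ (2 * s%:Z * (g k)%:Z * K 0 k))).
  rewrite expansion_coef dotE qpowD -mulrA unhatK //; congr (_ * (_ * _)).
  by apply: eq_bigr => K _; rewrite hatW.
rewrite !sideE => /(mulfI (qpow_neq0 lq _)).
have Xab : qp (2 * s%:R * X 0 a) = y ^+ (2 * s) * qp (2 * s%:R * X 0 b).
  rewrite /y qmon_alpha // -qpow_nat -qpowD natrM; congr qpow; ring.
rewrite Xab -mulrA mulrCA => /(mulfI (qpow_neq0 lq _))/eqP.
rewrite -subr_eq0 mulr_sumr -sumrB => /eqP rel'.
have ys0 : y ^+ s != 0 by rewrite expf_neq0 ?qmon_neq0.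
(* The two sides of the relation carry the factors [y^(2 s)] and 1; taking out [y^s] balances them
   into a bracket. *)
apply: (mulfI ys0); rewrite mulr0; apply: etrans rel'; rewrite mulr_sumr; apply: eq_bigr => K _.
have e1 : key a b K 0 a = K 0 a + K 0 b by rewrite !mxE alpha_l // mulr1.
set P1 := p ^ (_ * key a b K 0 a); set P2 := p ^ (2 * dotz _ _).
set E := p ^ (s%:Z * dg * _); set Pa := p ^ (_ * K 0 a); set Pb := p ^ (2 * s%:Z * _ * K 0 b).
pose G := p ^ (s%:Z * gform g a b K).
have G0 : G != 0 by exact: expfz_neq0.
have wE : phase lq g a b X K ^+ s = y ^+ s * G.
  by rewrite exprMn /G [s%:Z * _]mulrC -exprz_exp.
have Ea : G * P1 = E * Pa.
  by rewrite -!expfzDr // e1 /gform /dg; congr (_ ^ _); ring.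
have Eb : G^-1 * P1 = E * Pb.
  by rewrite /G invr_expz -!expfzDr // e1 /gform /dg; congr (_ ^ _); ring.
rewrite -![P2 * E * _]mulrA -Ea -Eb /D wE mulnC exprM.
move: ys0; clearbody G P1 P2; move: (y ^+ s) (coef K X) => Q k Q0.
by rewrite /br; field; rewrite Q0 G0.
Qed.

Theorem BA_symmetric x z : lq != 0 -> Psi x z = Psi z x.
Proof.
move=> lq0.
have c_exp := coef_exp_sum lq0 p_nroot (@weight_gt0 n m m_gt0) usupp suppP coef_string_system
  coef_rho2 coef_line_continuous coef_out.
have [A [Asym AE]] := coef_symmetric lq0 p_nroot (@weight_gt0 n m m_gt0) (@edge_mult_sym n m)
  (@weight_edge_mult n m) (@pair_productN R n m lq) usupp suppP coef_string_system
  coef_rho2 coef_out c_exp coef_line_continuous.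
have PE x' z' : Psi x' z' = qp (2 * dotC x' z') *
    \sum_(K <- supp) \sum_(M <- supp) A K M * qmon M (hat x') * qmon K (hat z').
  by rewrite expansion_coef; congr (_ * _); apply: eq_bigr => K _; rewrite AE mulr_suml.
rewrite !PE; congr (qp (2 * _) * _).
  by apply: eq_bigr => i _; exact: mulrC.
rewrite exchange_big; apply: eq_bigr => M _; apply: eq_bigr => K _.
by rewrite Asym mulrAC.
Qed.

End BakerAkhiezer.

Theorem theorem7p4 (R : realType) (n m : nat) (q lq : R[i])
    (Psi : 'rV[R[i]]_n.+1 -> 'rV[R[i]]_n.+1 -> R[i]) :
  (0 < m)%N ->
  cexp lq = q ->
  (forall k : nat, (0 < k)%N -> q ^+ k != 1) ->
  BA_normalized m lq Psi ->
  forall x z, Psi x z = Psi z x.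
Proof.
move=> m0 <- nr [c [[PsiE Psi0 Psi1] c_cont c_rho]] x z.
have lq0 : lq != 0.
  by apply: contraNneq (nr 1%N isT) => ->; rewrite expr1 cexp0.
have [supp [usupp suppP]] := polytope_seq (@edge_mult n m).
exact: (BA_symmetric m0 (sqrtq_nroot nr) PsiE Psi0 Psi1 c_cont c_rho usupp suppP).
Qed.
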